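(* Let $m\geq -1/2$, $s>1/2$, and put $\mu:=\min\{2\sqrt{1+m},\ \tfrac32\sqrt{4+m}\}$. Assume that $u_0\in H^{s+2}_*$ and $v_0\in H^{s}_*$ satisfy $$\varepsilon:=\max\Big\{|u_0|_1\,,\ \frac{|v_0|_0}{\sqrt{1+m}}\Big\}\ \leq\ \varepsilon_0:=0.08\sqrt{\mu}\,.$$ Then the weak solution $u(t,x)$ of the beam equation $$u_{tt}+u_{xxxx}-\Big(m+\frac1{2\pi}\int_0^\pi u_x^2\,dx\Big)u_{xx}=0$$ with hinged-hinged boundary conditions and initial data $u(0,x)=u_0(x)$, $u_t(0,x)=v_0(x)$ satisfies $$\sup_{x\in[0,\pi]}|u(t,x)|\leq 2\varepsilon\,,\qquad \forall\,|t|\leq T_0\,\mu\,\varepsilon^{-4}\,,$$ for some $T_0$ with $$T_0\geq 0.008\,(1-68\,\varepsilon^2/\mu)\geq 0.0045\,.$$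
   Context: $\mathbb N=\{1,2,3,\dots\}$, $x\in[0,\pi]$, $t\in\mathbb R$, and $\phi_j(x):=\sqrt{2/\pi}\,\sin(jx)$ for $j\in\mathbb N$. For $s\ge 0$, $H^s_*$ is the Hilbert space of functions $u(x)=\sum_{j\in\mathbb N}u_j\phi_j(x)$, $u_j\in\mathbb R$, with finite norm $|u|_s:=\big(\sum_{j\in\mathbb N}u_j^2j^{2s}\big)^{1/2}$. The hinged-hinged boundary conditions are $u(t,0)=u(t,\pi)=u_{xx}(t,0)=u_{xx}(t,\pi)=0$. Weak solution: given an open interval of times $\mathcal I\ni 0$, $s>1/2$, and initial data $u_0\in H^{s+2}_*$, $v_0\in H^s_*$, a $C^2$ function $t\mapsto u(t,\cdot)\in H^{s+2}_*$ is a weak solution of the equation with data $(u_0,v_0)$ if $u(0,x)=u_0(x)$, $u_t(0,x)=v_0(x)$ and, for every test function $\eta\in C^\infty_c((0,\pi))$ and every $t\in\mathcal I$, $$\int_0^{\pi}\Big[u_{tt}\eta+u_{xx}\eta_{xx}+\Big(m+\frac 1{2\pi}\int_0^{\pi}u_x^2\,dx\Big) u_x \eta_x\Big]dx=0\,.$$ *)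

(* Defs.v *)
(* Stdlib reals and Coquelicot. *)
From Stdlib Require Import Reals.
From Coquelicot Require Import Coquelicot.
Open Scope R_scope.

Definition phi (j : nat) (x : R) : R := sqrt (2 / PI) * sin (INR j * x).

(* The modes are j = 1, 2, ..., so a coefficient sequence a : nat -> R stores
   the coefficient of phi (S n) at index n. *)
Definition coef (f : R -> R) (n : nat) : R :=
  RInt (fun x => f x * phi (S n) x) 0 PI.

Definition h_term (r : R) (a : nat -> R) (n : nat) : R :=
  a n ^ 2 * Rpower (INR (S n)) (2 * r).

(* H^r_* on the side of the coefficients; here r may be negative, in which case
   the sequence represents a distribution. *)
Definition in_h (r : R) (a : nat -> R) : Prop := ex_series (h_term r a).

Definition h_norm (r : R) (a : nat -> R) : R := sqrt (Series (h_term r a)).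

(* H^r_* as a space of functions on [0, PI].  It is only used with r > 1/2,
   where finiteness of the norm makes the sine series converge absolutely and
   uniformly; hence f is continuous on [0, PI] and coef f is the only possible
   coefficient sequence. *)
Definition in_Hstar (r : R) (f : R -> R) : Prop :=
  in_h r (coef f) /\
  forall x, 0 <= x <= PI -> is_series (fun n => coef f n * phi (S n) x) (f x).

Definition Hstar_norm (r : R) (f : R -> R) : R := h_norm r (coef f).

Definition C0_h (r : R) (a b : Rbar) (w : R -> nat -> R) : Prop :=
  forall t : R, Rbar_lt a t -> Rbar_lt t b ->
    in_h r (w t) /\
    is_lim (fun tau => h_norm r (fun n => w tau n - w t n)) t 0.

Definition derive_h (r : R) (a b : Rbar) (w w' : R -> nat -> R) : Prop :=
  forall t : R, Rbar_lt a t -> Rbar_lt t b ->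
    is_lim (fun k => h_norm r (fun n => (w (t + k) n - w t n) / k - w' t n)) 0 0.

(* C^infty_c ((0, PI)), the functions being extended by zero to R. *)
Definition test_function (eta : R -> R) : Prop :=
  (forall n x, ex_derive_n eta n x) /\
  exists c d, 0 < c /\ d < PI /\ forall x, eta x <> 0 -> c <= x <= d.

(* A weak solution on the open time interval (a, b), containing 0, is a path
   with values in H^{s+2}_* that is C^2 on the scale fixed by data in
   H^{s+2}_* x H^s_*:
     u in C^0(H^{s+2}_* ), u_t in C^0(H^s_* ), u_tt in C^0(H^{s-2}_* ).
   (If u is C^2 with values in H^{s+2}_* itself, this holds a fortiori.)
   ut and utt are the coefficient sequences of u_t and u_tt.  For s < 2, u_tt is
   in general only a distribution, and the integral of u_tt eta is the duality
   pairing  sum_j (u_tt)_j eta_j,  which is that integral when u_tt is square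
   integrable.  The hinged-hinged boundary conditions are carried by
   u t in H^{s+2}_* with s > 1/2. *)
Definition weak_solution (m s : R) (a b : Rbar) (u0 v0 : R -> R)
    (u : R -> R -> R) : Prop :=
  Rbar_lt a 0 /\ Rbar_lt 0 b /\
  (forall t : R, Rbar_lt a t -> Rbar_lt t b -> in_Hstar (s + 2) (u t)) /\
  (forall x, 0 <= x <= PI -> u 0 x = u0 x) /\
  (forall x, 0 <= x <= PI -> is_derive (fun t => u t x) 0 (v0 x)) /\
  exists ut utt : R -> nat -> R,
    C0_h (s + 2) a b (fun t => coef (u t)) /\
    C0_h s a b ut /\
    C0_h (s - 2) a b utt /\
    derive_h s a b (fun t => coef (u t)) ut /\
    derive_h (s - 2) a b ut utt /\
    forall eta, test_function eta ->
    forall t : R, Rbar_lt a t -> Rbar_lt t b ->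
      Series (fun n => utt t n * coef eta n)
      + RInt (fun x =>
          Derive_n (u t) 2 x * Derive_n eta 2 x
          + (m + 1 / (2 * PI) * RInt (fun y => Derive (u t) y ^ 2) 0 PI)
            * Derive (u t) x * Derive eta x) 0 PI
      = 0.

Definition mu (m : R) : R := Rmin (2 * sqrt (1 + m)) (3 / 2 * sqrt (4 + m)).

Definition epsilon (m : R) (u0 v0 : R -> R) : R :=
  Rmax (Hstar_norm 1 u0) (Hstar_norm 0 v0 / sqrt (1 + m)).

Definition sup_abs (f : R -> R) : Rbar :=
  Lub_Rbar (fun y => exists x, 0 <= x <= PI /\ y = Rabs (f x)).

(* |t| <= T mu eps^{-4}, with eps^{-4} = +infinity when eps = 0. *)
Definition in_window (T mu eps t : R) : Prop := Rabs t * eps ^ 4 <= T * mu.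

(* Main.v *)
Require Import Defs.
From Stdlib Require Import Reals Lra Lia Psatz Factorial FunctionalExtensionality Classical.
From Coquelicot Require Import Coquelicot.
(** Write [u = sum_n u_n phi (S n)] and [k = n + 1].  On coefficients the beam
    equation is a chain of oscillators
      [u_n'' + k^2 (k^2 + m + P / (2 PI)) u_n = 0],  [P = sum_n k^2 u_n^2 = |u|_1^2],
    coupled only through [P].  Without the nonlinearity each action
      [I_n = k^2 u_n^2 + v_n^2 / (k^2 + m)],  [v_n = u_n'],
    is conserved.  The data give [I = sum_n I_n <= 2 epsilon^2] at time 0, and a
    weighted Cauchy-Schwarz inequality gives [sup |u| <= 2 epsilon] whenever
    [P <= 3 epsilon^2].  As [P <= I], it suffices that [I] stays below
    [3 epsilon^2] up to time [mu epsilon^(-4) / 100], a window slightly larger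
    than the one of the theorem.

    The derivative of [I] is quartic in the amplitude, which alone would give a
    time of order [epsilon^(-2)].  It is however purely oscillating: the only
    resonances between two pairs of modes are those that preserve the actions.
    A quartic correction [F], explicit in the quantities
      [a_n = k^2 u_n^2 - v_n^2 / (k^2 + m)],  [b_n = 2 k^2 u_n v_n / (k^2 + m)],
    makes the derivative of [I + F] sextic.  Its coefficients
    [1 / (k^2 + l^2 + m)] solve the homological equation exactly, because
    [(k^2 + m) + l^2] is the denominator ([bilinear_sum_resonance],
    [modified_action_derive]).  There are thus no small denominators, [F] is a
    small fraction of [I], and a continuity argument in time closes the estimate
    ([action_bound]).  The differentiation is carried out on the first [N] modes;
    the error is the tail of [P], which vanishes as [N] grows because [|u|_2] is
    bounded on compact time intervals.

    A weak solution satisfies the mode equations, although a sine is not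
    compactly supported and [u_tt] is only in [H^{s-2}].  Let [g_n] be the
    coefficients of the residual of the equation.  Since [s > 1/2], the series
    [G = sum_n (g_n / k^2) phi (S n)] converges uniformly, and the weak form says
    that the integral of [G eta''] vanishes for every test function [eta].  Taking for [eta'']
    second differences of narrow bumps, one finds that the second differences of
    [G] vanish; as [G] is continuous and zero at both ends, [G = 0]
    ([weakly_affine_zero], [pairing_vanishes], [modes_of_weak_solution]).

    A solution is built by Picard iteration in rotating coordinates, where the
    linear frequencies disappear from the size of the vector field.  The
    nonlinearity multiplies each mode by a scalar that is the same for all modes
    up to bounded weights, so every mode is bounded by its own initial size times
    a common factor of time, and all regularity persists ([picard_lindelof]).  With [P]
    clamped at a constant the solution is global ([clamped_modes]), and the
    a priori bound shows that the clamp is inactive in the window. *)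

Open Scope R_scope.

(** * Series, limits and derivatives of real functions *)

(** The ring tactic recognises an equation between reals only if its type is
    syntactically [R] and not the carrier of a canonical structure. *)
Ltac as_R := match goal with |- @eq _ ?a ?b => change (@eq R a b) end.
Ltac rring := as_R; ring.

Lemma sum_n_Rplus (u v : nat -> R) (N : nat) :
  sum_n (fun k => u k + v k) N = sum_n u N + sum_n v N.
Proof. exact (sum_n_plus u v N). Qed.

Lemma sum_n_Rmult_l (c : R) (u : nat -> R) (N : nat) :
  sum_n (fun k => c * u k) N = c * sum_n u N.
Proof. exact (sum_n_mult_l c u N). Qed.

Lemma sum_n_Rmult_r (c : R) (u : nat -> R) (N : nat) :
  sum_n (fun k => u k * c) N = sum_n u N * c.
Proof. exact (sum_n_mult_r c u N). Qed.

Lemma sum_n_SR (u : nat -> R) (N : nat) :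
  sum_n u (S N) = sum_n u N + u (S N).
Proof. exact (sum_Sn u N). Qed.

Lemma sum_n_Rext (u v : nat -> R) (N : nat) :
  (forall k, u k = v k) -> sum_n u N = sum_n v N.
Proof. exact (sum_n_ext u v N). Qed.

Lemma sum_n_Rle (u v : nat -> R) (N : nat) :
  (forall k, (k <= N)%nat -> u k <= v k) -> sum_n u N <= sum_n v N.
Proof.
  induction N as [|N IH]; intros H.
  - rewrite !sum_O. apply H. lia.
  - rewrite !sum_n_SR. apply Rplus_le_compat.
    + apply IH. intros k Hk. apply H. lia.
    + apply H. lia.
Qed.

Lemma sum_n_Rabs (u : nat -> R) (N : nat) :
  Rabs (sum_n u N) <= sum_n (fun k => Rabs (u k)) N.
Proof.
  induction N as [|N IH].
  - rewrite !sum_O. lra.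
  - rewrite !sum_n_SR. eapply Rle_trans; [apply Rabs_triang|]. lra.
Qed.

Lemma sum_n_Rabs_le (u v : nat -> R) (N : nat) :
  (forall k, (k <= N)%nat -> Rabs (u k) <= v k) ->
  Rabs (sum_n u N) <= sum_n v N.
Proof.
  intros H. eapply Rle_trans; [apply sum_n_Rabs|]. now apply sum_n_Rle.
Qed.

Lemma sum_n_Rge0 (u : nat -> R) (N : nat) :
  (forall k, 0 <= u k) -> 0 <= sum_n u N.
Proof.
  intros H. induction N as [|N IH].
  - rewrite sum_O. apply H.
  - rewrite sum_n_SR. specialize (H (S N)). lra.
Qed.

Lemma is_derive_Rplus (f g : R -> R) (x df dg : R) :
  is_derive f x df -> is_derive g x dg -> is_derive (fun y => f y + g y) x (df + dg).
Proof. exact (is_derive_plus (V := R_NormedModule) f g x df dg). Qed.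

Lemma is_derive_Rminus (f g : R -> R) (x df dg : R) :
  is_derive f x df -> is_derive g x dg -> is_derive (fun y => f y - g y) x (df - dg).
Proof. exact (is_derive_minus (V := R_NormedModule) f g x df dg). Qed.

Lemma is_derive_Rmult (f g : R -> R) (x df dg : R) :
  is_derive f x df -> is_derive g x dg ->
  is_derive (fun y => f y * g y) x (df * g x + f x * dg).
Proof. intros Hf Hg. apply (is_derive_mult f g x df dg Hf Hg Rmult_comm). Qed.

Lemma is_derive_Rsum (f : nat -> R -> R) (d : nat -> R) (N : nat) (x : R) :
  (forall k, is_derive (f k) x (d k)) ->
  is_derive (fun y => sum_n (fun k => f k y) N) x (sum_n d N).
Proof.
  intros H. apply (is_derive_sum_n (K := R_AbsRing) (V := R_NormedModule) f N x d). auto.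
Qed.

Lemma continuous_Rplus (f g : R -> R) (x : R) :
  continuous f x -> continuous g x -> continuous (fun y => f y + g y) x.
Proof. exact (continuous_plus (V := R_NormedModule) f g x). Qed.

Lemma continuous_Rminus (f g : R -> R) (x : R) :
  continuous f x -> continuous g x -> continuous (fun y => f y - g y) x.
Proof. exact (continuous_minus (V := R_NormedModule) f g x). Qed.

Lemma ex_series_Rplus (a b : nat -> R) :
  ex_series a -> ex_series b -> ex_series (fun n => a n + b n).
Proof. exact (ex_series_plus (V := R_NormedModule) a b). Qed.

Lemma ex_series_Rminus (a b : nat -> R) :
  ex_series a -> ex_series b -> ex_series (fun n => a n - b n).
Proof. exact (ex_series_minus (V := R_NormedModule) a b). Qed.

Lemma ex_series_Rscal (c : R) (a : nat -> R) :
  ex_series a -> ex_series (fun n => c * a n).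
Proof. exact (ex_series_scal (V := R_NormedModule) c a). Qed.

Lemma ex_series_dom (a b : nat -> R) :
  (forall n, Rabs (a n) <= b n) -> ex_series b -> ex_series a.
Proof. intros H Hb. exact (ex_series_le a b H Hb). Qed.

Lemma ex_series_pos_dom (a b : nat -> R) :
  (forall n, 0 <= a n <= b n) -> ex_series b -> ex_series a.
Proof.
  intros H Hb. apply ex_series_dom with b; auto.
  intros n. rewrite Rabs_pos_eq; apply H.
Qed.

Lemma Series_abs_le (a b : nat -> R) :
  (forall n, Rabs (a n) <= b n) -> ex_series b -> Rabs (Series a) <= Series b.
Proof.
  intros H Hb.
  assert (Ha : ex_series (fun n => Rabs (a n))).
  { apply ex_series_dom with b; auto. intros n. now rewrite Rabs_Rabsolu. }
  eapply Rle_trans; [now apply Series_Rabs|].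
  apply Series_le; auto. intros n. split; [apply Rabs_pos|auto].
Qed.

Lemma Series_tail (a : nat -> R) (N : nat) :
  ex_series a -> Series a = sum_n a N + Series (fun k => a (S N + k)%nat).
Proof.
  intros H. rewrite (Series_incr_n a (S N)); auto; [|lia].
  simpl pred. now rewrite sum_n_Reals.
Qed.

Lemma ex_series_tail (a : nat -> R) (N : nat) :
  ex_series a -> ex_series (fun k => a (N + k)%nat).
Proof. intros H. now apply ex_series_incr_n. Qed.

Lemma Series_ge0 (a : nat -> R) : (forall n, 0 <= a n) -> ex_series a -> 0 <= Series a.
Proof.
  intros H Ha. eapply Rle_trans; [apply Rabs_pos|].
  apply (Series_abs_le (fun _ => 0) a); auto.
  intros n. rewrite Rabs_R0. apply H.
Qed.

Lemma sum_n_le_Series (a : nat -> R) (N : nat) :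
  (forall n, 0 <= a n) -> ex_series a -> sum_n a N <= Series a.
Proof.
  intros H Ha. rewrite (Series_tail a N Ha).
  assert (0 <= Series (fun k => a (S N + k)%nat)).
  { apply Series_ge0; auto. now apply ex_series_tail. }
  lra.
Qed.

Lemma Series_term_le (a : nat -> R) (N : nat) :
  (forall n, 0 <= a n) -> ex_series a -> a N <= Series a.
Proof.
  intros H Ha. eapply Rle_trans; [|now apply sum_n_le_Series with (N := N)].
  destruct N as [|N]; [rewrite sum_O; lra|].
  rewrite sum_n_SR. pose proof (sum_n_Rge0 a N H). lra.
Qed.

Lemma Series_le_bound (a : nat -> R) (B : R) :
  (forall N, sum_n a N <= B) -> ex_series a -> Series a <= B.
Proof.
  intros H [l Hl]. rewrite (is_series_unique a l Hl).
  change (Rbar_le (Finite l) (Finite B)).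
  apply (filterlim_le (F := eventually) (sum_n a) (fun _ => B)).
  - now exists 0%nat.
  - exact Hl.
  - apply filterlim_const.
Qed.

Lemma ex_series_bounded (a : nat -> R) (B : R) :
  (forall n, 0 <= a n) -> (forall N, sum_n a N <= B) -> ex_series a.
Proof.
  intros H HB. apply ex_finite_lim_seq_incr with (M := B).
  - intros n. change (sum_n a n <= sum_n a (S n)).
    rewrite sum_n_SR. specialize (H (S n)). lra.
  - exact HB.
Qed.

Lemma filterlim_R_intro {T} (F : (T -> Prop) -> Prop) {FF : Filter F} (f : T -> R) (l : R) :
  (forall eps, 0 < eps -> F (fun x => Rabs (f x - l) < eps)) -> filterlim f F (locally l).
Proof. intros H. apply (filterlim_locally f l). intros e. exact (H e (cond_pos e)). Qed.

Lemma filterlim_R_elim {T} {F : (T -> Prop) -> Prop} {FF : Filter F} {f : T -> R} {l : R} :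
  filterlim f F (locally l) -> forall eps, 0 < eps -> F (fun x => Rabs (f x - l) < eps).
Proof. intros H e He. exact (proj1 (filterlim_locally f l) H (mkposreal e He)). Qed.

Lemma Series_tail_lim (a : nat -> R) (eps : R) :
  ex_series a -> 0 < eps ->
  exists N, Rabs (Series (fun k => a (S N + k)%nat)) < eps.
Proof.
  intros Ha He. destruct Ha as [l Hl].
  pose proof (filterlim_R_elim Hl eps He) as Hl'.
  destruct Hl' as [N HN]. exists N.
  specialize (HN N (le_n N)).
  pose proof (Series_tail a N (ex_intro _ l Hl)) as E.
  rewrite (is_series_unique a l Hl) in E.
  assert (HN' : Rabs (sum_n a N - l) < eps) by exact HN.
  rewrite Rabs_minus_sym in HN'.
  replace (Series (fun k => a (S N + k)%nat)) with (l - sum_n a N) by lra.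
  exact HN'.
Qed.

Lemma filterlim_sum_n {T} (F : (T -> Prop) -> Prop) {FF : Filter F}
  (f : nat -> T -> R) (l : nat -> R) (N : nat) :
  (forall n, filterlim (f n) F (locally (l n))) ->
  filterlim (fun x => sum_n (fun n => f n x) N) F (locally (sum_n l N)).
Proof.
  intros H. induction N as [|N IH].
  - apply filterlim_ext with (f 0%nat); [intros x; now rewrite sum_O|].
    rewrite sum_O. apply H.
  - apply filterlim_ext with (fun x => plus (sum_n (fun n => f n x) N) (f (S N) x)).
    { intros x. now rewrite sum_Sn. }
    rewrite sum_Sn. eapply filterlim_comp_2; [exact IH|apply H|].
    exact (filterlim_plus (V := R_NormedModule) (sum_n l N) (l (S N))).
Qed.

Lemma geometric_small (A e : R) : 0 <= A -> 0 < e ->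
  exists N, forall k, (N <= k)%nat -> A * (1 / 2) ^ k < e.
Proof.
  intros HA He.
  destruct (pow_lt_1_zero (1 / 2) ltac:(rewrite Rabs_pos_eq; lra) (e / (A + 1))
    ltac:(apply Rdiv_lt_0_compat; lra)) as [N HN].
  exists N. intros k Hk. specialize (HN k Hk).
  assert (H0 : 0 <= (1 / 2) ^ k) by (apply pow_le; lra).
  rewrite Rabs_pos_eq in HN by auto.
  apply Rmult_lt_compat_l with (r := A + 1) in HN; [|lra].
  replace ((A + 1) * (e / (A + 1))) with e in HN by (field; lra). lra.
Qed.

Lemma Rle_of_geometric (x y A : R) : 0 <= A -> (forall k, x <= y + A * (1 / 2) ^ k) -> x <= y.
Proof.
  intros HA H. apply le_epsilon. intros e He.
  destruct (geometric_small A e HA He) as [N HN].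
  specialize (HN N (le_n N)). specialize (H N). lra.
Qed.

Lemma zero_of_geometric (x A : R) : 0 <= A -> (forall k, Rabs x <= A * (1 / 2) ^ k) -> x = 0.
Proof.
  intros HA H. assert (E : Rabs x <= 0).
  { apply Rle_of_geometric with A; auto. intros k. rewrite Rplus_0_l. apply H. }
  destruct (Req_dec x 0) as [|Hn]; auto. pose proof (Rabs_pos_lt _ Hn). lra.
Qed.

Lemma geometric_limit (u : nat -> R) (A : R) :
  (forall k, Rabs (u (S k) - u k) <= A * (1 / 2) ^ k) ->
  forall k, Rabs (u k - real (Lim_seq u)) <= 2 * A * (1 / 2) ^ k.
Proof.
  intros H.
  assert (HA : 0 <= A).
  { specialize (H 0%nat). simpl in H. pose proof (Rabs_pos (u 1%nat - u 0%nat)). lra. }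
  assert (Hg : forall k, is_series (fun j => A * (1 / 2) ^ (k + j)) (2 * A * (1 / 2) ^ k)).
  { intros k. pose proof (is_series_geom (1 / 2) ltac:(rewrite Rabs_pos_eq; lra)) as E.
    apply (is_series_scal_l (A * (1 / 2) ^ k)) in E.
    assert (E1 : A * (1 / 2) ^ k * / (1 - 1 / 2) = 2 * A * (1 / 2) ^ k :> R) by field.
    rewrite <- E1. revert E. apply is_series_ext. intros j. rewrite pow_add. as_R.
    change (A * (1 / 2) ^ k * (1 / 2) ^ j = A * ((1 / 2) ^ k * (1 / 2) ^ j)). ring. }
  set (d := fun j => u (S j) - u j).
  assert (Hd : ex_series d).
  { apply ex_series_dom with (fun j => A * (1 / 2) ^ j); auto. eexists. exact (Hg 0%nat). }
  assert (E : forall k, u k + Series (fun j => d (k + j)%nat) = u 0%nat + Series d).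
  { induction k as [|k IH]; [reflexivity|].
    rewrite <- IH. rewrite (Series_incr_1 (fun j => d (k + j)%nat)) by now apply ex_series_tail.
    unfold d at 2. rewrite Nat.add_0_r.
    rewrite (Series_ext (fun j => d (k + S j)%nat) (fun j => d (S k + j)%nat)).
    - ring.
    - intros j. f_equal. lia. }
  assert (B : forall k, Rabs (u k - (u 0%nat + Series d)) <= 2 * A * (1 / 2) ^ k).
  { intros k. rewrite <- (E k).
    replace (u k - (u k + Series (fun j => d (k + j)%nat)))
      with (- Series (fun j => d (k + j)%nat)) by ring.
    rewrite Rabs_Ropp, <- (is_series_unique _ _ (Hg k)).
    apply Series_abs_le; [|eexists; apply Hg]. intros j. apply H. }
  rewrite (is_lim_seq_unique u (u 0%nat + Series d)); [exact B|].
  refine (filterlim_R_intro _ _ _ _). intros e He.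
  destruct (geometric_small (2 * A) e ltac:(lra) He) as [N HN].
  exists N. intros k Hk. eapply Rle_lt_trans; [apply B|now apply HN].
Qed.

#[local] Instance locally'_proper (x : R) : ProperFilter (locally' x).
Proof. exact (Rbar_locally'_filter x). Qed.

(** Dominated convergence for series, along an arbitrary filter.  The domination
    has to hold for all terms at once, on one set of the filter. *)
Lemma tannery {T} (F : (T -> Prop) -> Prop) {FF : ProperFilter F}
  (f : nat -> T -> R) (l b : nat -> R) :
  ex_series b ->
  F (fun x => forall n, Rabs (f n x) <= b n) ->
  (forall n, filterlim (f n) F (locally (l n))) ->
  filterlim (fun x => Series (fun n => f n x)) F (locally (Series l)).
Proof.
  intros Hb Hd Hl.
  assert (Hlb : forall n, Rabs (l n) <= b n).
  { intros n.
    assert (L := filterlim_comp T R R (f n) Rabs F (locally (l n)) (locally (Rabs (l n))) (Hl n)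
      (continuous_Rabs (l n))).
    change (Rbar_le (Finite (Rabs (l n))) (Finite (b n))).
    apply (filterlim_le (F := F) (fun x => Rabs (f n x)) (fun _ => b n)).
    - revert Hd. apply filter_imp. auto.
    - exact L.
    - apply filterlim_const. }
  refine (filterlim_R_intro _ _ _ _). intros e He.
  destruct (Series_tail_lim b (e / 3) Hb ltac:(lra)) as [N HN].
  assert (HS := filterlim_sum_n F f l N Hl).
  pose proof (filterlim_R_elim HS (e / 3) ltac:(lra)) as HS'. clear HS.
  generalize (filter_and _ _ Hd HS'). apply filter_imp. intros x [Hx Hs].
  rewrite (Series_tail l N) by now apply ex_series_dom with b.
  rewrite (Series_tail (fun n => f n x) N) by now apply ex_series_dom with b.
  assert (Hbt : ex_series (fun k => b (S N + k)%nat)) by now apply ex_series_tail.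
  pose proof (Series_abs_le (fun k => l (S N + k)%nat) (fun k => b (S N + k)%nat)
    (fun k => Hlb _) Hbt) as H1.
  pose proof (Series_abs_le (fun k => f (S N + k)%nat x) (fun k => b (S N + k)%nat)
    (fun k => Hx _) Hbt) as H2.
  apply Rabs_def2 in HN. apply Rabs_def2 in Hs.
  apply Rabs_le_between in H1. apply Rabs_le_between in H2.
  apply Rabs_def1; lra.
Qed.

Lemma increment_le (f f' : R -> R) (a b M : R) :
  (forall x, Rmin a b <= x <= Rmax a b -> is_derive f x (f' x)) ->
  (forall x, Rmin a b <= x <= Rmax a b -> Rabs (f' x) <= M) ->
  Rabs (f b - f a) <= M * Rabs (b - a).
Proof.
  intros Hd HM.
  destruct (MVT_gen f a b f') as [c [Hc E]].
  - intros x Hx. apply Hd. lra.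
  - intros x Hx. apply continuity_pt_filterlim.
    apply (ex_derive_continuous f x). exists (f' x). now apply Hd.
  - rewrite E, Rabs_mult. apply Rmult_le_compat_r; [apply Rabs_pos|].
    now apply HM.
Qed.

(** In this form differentiability is a limit along a filter, to which [tannery]
    applies. *)
Lemma is_derive_quotient (f : R -> R) (x l : R) :
  is_derive f x l <->
  filterlim (fun k => (f (x + k) - f x) / k) (locally' 0) (locally l).
Proof.
  rewrite is_derive_Reals.
  unfold derivable_pt_lim. split.
  - intros H. refine (filterlim_R_intro _ _ _ _). intros e He. destruct (H e He) as [d Hd]. exists d. intros k Hk Hk0.
    apply Hd; auto. change (Rabs (k - 0) < d) in Hk. now rewrite Rminus_0_r in Hk.
  - intros H e He. destruct (filterlim_R_elim H e He) as [d Hd]. exists d. intros k Hk0 Hk.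
    apply Hd; auto. change (Rabs (k - 0) < d). now rewrite Rminus_0_r.
Qed.

Lemma quotient_le (f f' : R -> R) (x d M k : R) :
  (forall y, Rabs (y - x) < d -> is_derive f y (f' y)) ->
  (forall y, Rabs (y - x) < d -> Rabs (f' y) <= M) ->
  Rabs k < d -> k <> 0 -> Rabs ((f (x + k) - f x) / k) <= M.
Proof.
  intros Hd HM Hk Hk0.
  assert (Hin : forall y, Rmin x (x + k) <= y <= Rmax x (x + k) -> Rabs (y - x) < d).
  { intros y. unfold Rmin, Rmax. apply Rabs_def2 in Hk.
    destruct (Rle_dec x (x + k)); intros; apply Rabs_def1; lra. }
  pose proof (increment_le f f' x (x + k) M
    (fun y Hy => Hd y (Hin y Hy)) (fun y Hy => HM y (Hin y Hy))) as H.
  replace (x + k - x) with k in H by ring.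
  unfold Rdiv. rewrite Rabs_mult, Rabs_inv.
  apply (Rmult_le_reg_r (Rabs k)); [now apply Rabs_pos_lt|].
  rewrite Rmult_assoc, Rinv_l; [lra|]. now apply Rabs_no_R0.
Qed.

(** The difference quotients are dominated by the mean value inequality, hence
    converge termwise. *)
Lemma is_derive_Series (f f' : nat -> R -> R) (b : nat -> R) (x d : R) :
  0 < d -> ex_series b ->
  (forall y, Rabs (y - x) < d -> ex_series (fun n => f n y)) ->
  (forall n y, Rabs (y - x) < d -> is_derive (f n) y (f' n y)) ->
  (forall n y, Rabs (y - x) < d -> Rabs (f' n y) <= b n) ->
  is_derive (fun y => Series (fun n => f n y)) x (Series (fun n => f' n x)).
Proof.
  intros Hd Hb Hex Hder Hbd.
  assert (Hx : Rabs (x - x) < d) by now rewrite Rminus_diag, Rabs_R0.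
  apply is_derive_quotient.
  apply filterlim_ext_loc with
    (fun k => Series (fun n => (f n (x + k) - f n x) / k)).
  - exists (mkposreal d Hd). intros k Hk Hk0.
    change (Rabs (k - 0) < d) in Hk. rewrite Rminus_0_r in Hk.
    unfold Rdiv. rewrite Series_scal_r. f_equal.
    apply Series_minus; apply Hex; auto.
    assert (E : x + k - x = k) by ring. now rewrite E.
  - apply (tannery (locally' 0) (FF := Rbar_locally'_filter 0) _ _ b); auto.
    + exists (mkposreal d Hd). intros k Hk Hk0 n.
      change (Rabs (k - 0) < d) in Hk. rewrite Rminus_0_r in Hk.
      apply quotient_le with (f' n) d; auto.
    + intros n. now apply is_derive_quotient, Hder.
Qed.

(** * The modified action of finitely many modes *)

(** Square of the wavenumber [j + 1] of the mode stored at index [j]. *)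
Definition nn (j : nat) : R := INR (S j) ^ 2.
(** The linear frequency of mode [j] is the square root of [nn j * hh m j]. *)
Definition hh (m : R) (j : nat) : R := nn j + m.

(** For a mode with displacement [x] and velocity [y] put
    [z = sqrt (nn j) * x + i * y / sqrt (hh m j)], which rotates under the linear
    flow.  Then [action] is [|z|^2], [re_square] is the real part of [z^2] and
    [im_square] its imaginary part times [sqrt (nn j / hh m j)]; this weight
    removes every square root. *)
Definition action (m : R) (j : nat) (x y : R) : R := nn j * x ^ 2 + y ^ 2 / hh m j.
Definition re_square (m : R) (j : nat) (x y : R) : R := nn j * x ^ 2 - y ^ 2 / hh m j.
Definition im_square (m : R) (j : nat) (x y : R) : R := 2 * nn j * x * y / hh m j.

Lemma INR_S_ge1 (j : nat) : 1 <= INR (S j).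
Proof. rewrite S_INR. pose proof (pos_INR j). lra. Qed.

Lemma nn_ge1 (j : nat) : 1 <= nn j.
Proof. unfold nn. pose proof (INR_S_ge1 j). nra. Qed.

Lemma nn_sqr_ge0 (j : nat) (x : R) : 0 <= nn j * x ^ 2.
Proof. pose proof (nn_ge1 j). pose proof (pow2_ge_0 x). nra. Qed.

Lemma hh_ge (m : R) (j : nat) : m >= - (1 / 2) -> 1 + m <= hh m j.
Proof. intros. unfold hh. pose proof (nn_ge1 j). lra. Qed.

Lemma hh_pos (m : R) (j : nat) : m >= - (1 / 2) -> 0 < hh m j.
Proof. intros H. pose proof (hh_ge m j H). lra. Qed.

Lemma nn_le_hh (m : R) (j : nat) : m >= - (1 / 2) -> nn j <= 2 * hh m j.
Proof. intros H. unfold hh. pose proof (nn_ge1 j). lra. Qed.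

Lemma action_ge0 (m : R) (j : nat) (x y : R) : m >= - (1 / 2) -> 0 <= action m j x y.
Proof.
  intros H. unfold action. pose proof (nn_ge1 j). pose proof (hh_pos m j H).
  assert (0 <= y ^ 2 / hh m j).
  { apply Rdiv_le_0_compat; auto. apply pow2_ge_0. }
  pose proof (pow2_ge_0 x). nra.
Qed.

Lemma re_square_le (m : R) (j : nat) (x y : R) :
  m >= - (1 / 2) -> Rabs (re_square m j x y) <= action m j x y.
Proof.
  intros H. unfold action, re_square. pose proof (nn_ge1 j). pose proof (hh_pos m j H).
  assert (0 <= y ^ 2 / hh m j).
  { apply Rdiv_le_0_compat; auto. apply pow2_ge_0. }
  pose proof (pow2_ge_0 x). apply Rabs_le. split; nra.
Qed.

Lemma im_square_le (m : R) (j : nat) (x y : R) :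
  m >= - (1 / 2) -> Rabs (im_square m j x y) <= 2 * action m j x y.
Proof.
  intros H. unfold action, im_square. pose proof (nn_ge1 j) as Hn. pose proof (hh_pos m j H) as Hh.
  pose proof (nn_le_hh m j H) as Hnh.
  set (n := nn j) in *. set (h := hh m j) in *.
  assert (E : 2 * (n * x ^ 2 + y ^ 2 / h)
              = (2 * h * n * x ^ 2 + 2 * y ^ 2) / h) by (field; lra).
  rewrite E. unfold Rdiv. rewrite Rabs_mult, (Rabs_pos_eq (/ h)).
  2: { left. now apply Rinv_0_lt_compat. }
  apply Rmult_le_compat_r; [left; now apply Rinv_0_lt_compat|].
  assert (n * n * x ^ 2 <= 2 * h * n * x ^ 2).
  { pose proof (pow2_ge_0 x). assert (0 <= n * x ^ 2) by nra. nra. }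
  apply Rabs_le. split; nra.
Qed.

(** In this and the next two lemmas the mode equation is perturbed by [q * nn j].
    At [q = 0] the action is constant and the square of [z] rotates at twice the
    frequency. *)
Lemma action_derive (m : R) (j : nat) (U V : R -> R) (q t : R) :
  m >= - (1 / 2) ->
  is_derive U t (V t) ->
  is_derive V t (- (nn j * hh m j + q * nn j) * U t) ->
  is_derive (fun s => action m j (U s) (V s)) t (- q * im_square m j (U t) (V t)).
Proof.
  intros Hm HU HV. pose proof (hh_pos m j Hm) as Hh. unfold action, im_square.
  evar_last.
  - auto_derive; [repeat split; eexists; eassumption|reflexivity].
  - change (fun x : R => U x) with U. change (fun x : R => V x) with V.
    rewrite (is_derive_unique _ _ _ HU), (is_derive_unique _ _ _ HV).
    field. lra.
Qed.

Lemma re_square_derive (m : R) (j : nat) (U V : R -> R) (q t : R) :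
  m >= - (1 / 2) ->
  is_derive U t (V t) ->
  is_derive V t (- (nn j * hh m j + q * nn j) * U t) ->
  is_derive (fun s => re_square m j (U s) (V s)) t
    ((2 * hh m j + q) * im_square m j (U t) (V t)).
Proof.
  intros Hm HU HV. pose proof (hh_pos m j Hm) as Hh. unfold re_square, im_square.
  evar_last.
  - auto_derive; [repeat split; eexists; eassumption|reflexivity].
  - change (fun x : R => U x) with U. change (fun x : R => V x) with V.
    rewrite (is_derive_unique _ _ _ HU), (is_derive_unique _ _ _ HV).
    field. lra.
Qed.

Lemma im_square_derive (m : R) (j : nat) (U V : R -> R) (q t : R) :
  m >= - (1 / 2) ->
  is_derive U t (V t) ->
  is_derive V t (- (nn j * hh m j + q * nn j) * U t) ->
  is_derive (fun s => im_square m j (U s) (V s)) t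
    (- 2 * nn j * re_square m j (U t) (V t)
     - q * (nn j / hh m j) * (action m j (U t) (V t) + re_square m j (U t) (V t))).
Proof.
  intros Hm HU HV. pose proof (hh_pos m j Hm) as Hh. unfold re_square, im_square, action.
  evar_last.
  - auto_derive; [repeat split; eexists; eassumption|reflexivity].
  - change (fun x : R => U x) with U. change (fun x : R => V x) with V.
    rewrite (is_derive_unique _ _ _ HU), (is_derive_unique _ _ _ HV).
    field. lra.
Qed.

(** Coefficients of the normal form correction, that is, solutions of the
    homological equation. *)
Definition dd (m : R) (j k : nat) : R := / (nn j + nn k + m).

Lemma dd_bound (m : R) (j k : nat) : m >= - (1 / 2) -> 0 < dd m j k <= / (1 + m).
Proof.
  intros H. unfold dd. pose proof (nn_ge1 j). pose proof (nn_ge1 k).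
  split; [apply Rinv_0_lt_compat; lra|]. apply Rinv_le_contravar; lra.
Qed.

Lemma dd_sym (m : R) (j k : nat) : dd m j k = dd m k j.
Proof. unfold dd. f_equal. ring. Qed.

Definition bilinear_sum (d : nat -> nat -> R) (x y : nat -> R) (N : nat) : R :=
  sum_n (fun j => sum_n (fun k => d j k * (x j * y k)) N) N.

Lemma bilinear_sum_le (d : nat -> nat -> R) (x y X Y : nat -> R) (D : R) (N : nat) :
  0 <= D ->
  (forall j k, Rabs (d j k) <= D) ->
  (forall j, Rabs (x j) <= X j) -> (forall k, Rabs (y k) <= Y k) ->
  Rabs (bilinear_sum d x y N) <= D * (sum_n X N * sum_n Y N).
Proof.
  intros HD Hd HX HY. unfold bilinear_sum.
  replace (D * (sum_n X N * sum_n Y N))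
    with (sum_n (fun j => sum_n (fun k => D * (X j * Y k)) N) N).
  - apply sum_n_Rabs_le. intros j _. apply sum_n_Rabs_le. intros k _.
    rewrite !Rabs_mult. apply Rmult_le_compat; auto using Rabs_pos.
    + apply Rmult_le_pos; apply Rabs_pos.
    + apply Rmult_le_compat; auto using Rabs_pos.
  - rewrite (sum_n_Rext _ (fun j => X j * (D * sum_n Y N))).
    + rewrite sum_n_Rmult_r. rring.
    + intros j. rewrite (sum_n_Rext _ (fun k => (D * X j) * Y k)).
      * rewrite sum_n_Rmult_l. rring.
      * intros k. rring.
Qed.

Lemma bilinear_sum_derive (d : nat -> nat -> R) (x y : nat -> R -> R) (x' y' : nat -> R) (N : nat) (t : R) :
  (forall j, is_derive (x j) t (x' j)) -> (forall j, is_derive (y j) t (y' j)) ->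
  is_derive (fun s => bilinear_sum d (fun j => x j s) (fun j => y j s) N) t
    (bilinear_sum d x' (fun j => y j t) N + bilinear_sum d (fun j => x j t) y' N).
Proof.
  intros Hx Hy. unfold bilinear_sum. rewrite <- sum_n_Rplus.
  apply (is_derive_Rsum (fun j s => sum_n (fun k => d j k * (x j s * y k s)) N)). intros j.
  rewrite <- sum_n_Rplus.
  apply (is_derive_Rsum (fun k s => d j k * (x j s * y k s))). intros k.
  evar_last.
  - apply (is_derive_scal (fun s => x j s * y k s)).
    apply (is_derive_Rmult (x j) (y k)); [apply Hx|apply Hy].
  - simpl. rring.
Qed.

Lemma bilinear_sum_sym (d : nat -> nat -> R) (x y : nat -> R) (N : nat) :
  (forall j k, d j k = d k j) -> bilinear_sum d x y N = bilinear_sum d y x N.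
Proof.
  intros Hd. unfold bilinear_sum. rewrite sum_n_switch.
  apply sum_n_Rext. intros j. apply sum_n_Rext. intros k. rewrite Hd. rring.
Qed.

Lemma bilinear_sum_plus_r (d : nat -> nat -> R) (x y z : nat -> R) (N : nat) :
  bilinear_sum d x (fun k => y k + z k) N = bilinear_sum d x y N + bilinear_sum d x z N.
Proof.
  unfold bilinear_sum. rewrite <- sum_n_Rplus. apply sum_n_Rext. intros j.
  rewrite <- sum_n_Rplus. apply sum_n_Rext. intros k. rring.
Qed.

Lemma bilinear_sum_scal_r (d : nat -> nat -> R) (x y : nat -> R) (a : R) (N : nat) :
  bilinear_sum d x (fun k => a * y k) N = a * bilinear_sum d x y N.
Proof.
  unfold bilinear_sum. rewrite <- sum_n_Rmult_l. apply sum_n_Rext. intros j.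
  rewrite <- sum_n_Rmult_l. apply sum_n_Rext. intros k. rring.
Qed.

(** The homological equation: the two terms are what the linear flow produces from
    the correction, and [hh m k + nn j] is the inverse of [dd m j k]. *)
Lemma bilinear_sum_resonance (m : R) (a b : nat -> R) (N : nat) :
  m >= - (1 / 2) ->
  bilinear_sum (dd m) a (fun k => hh m k * b k) N + bilinear_sum (dd m) b (fun k => nn k * a k) N
  = sum_n a N * sum_n b N.
Proof.
  intros Hm. rewrite (bilinear_sum_sym (dd m) b) by apply dd_sym.
  unfold bilinear_sum. rewrite <- sum_n_Rplus, <- sum_n_Rmult_r.
  apply sum_n_Rext. intros j. rewrite <- sum_n_Rplus, <- sum_n_Rmult_l.
  apply sum_n_Rext. intros k. unfold dd, hh.
  pose proof (nn_ge1 j). pose proof (nn_ge1 k). field. lra.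
Qed.

(** Coefficient of the nonlocal term of the beam equation. *)
Definition cc : R := 1 / (2 * PI).

Lemma cc_bound : 0 < cc <= 1 / 6.
Proof.
  unfold cc. pose proof PI_RGT_0. pose proof PI2_3_2. unfold PI2 in *.
  split.
  - apply Rdiv_lt_0_compat; lra.
  - apply Rmult_le_reg_r with (2 * PI); [lra|]. field_simplify; lra.
Qed.

(** Quartic term that turns the action into an almost conserved quantity: its
    derivative along the linear flow cancels the quartic derivative of the action.
    The arguments [i], [a], [b] stand for [action], [re_square], [im_square]. *)
Definition correction (m : R) (i a b : nat -> R) (N : nat) : R :=
  cc / 2 * (1 / 2 * (sum_n i N * sum_n (fun k => a k / hh m k) N)
            + 1 / 4 * (bilinear_sum (dd m) a a N - bilinear_sum (dd m) b b N)).

(** Sextic part of the derivative of the modified action, divided by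
    [cc * q / 4]. *)
Definition remainder (m : R) (i a b : nat -> R) (N : nat) : R :=
  - (sum_n b N * sum_n (fun k => a k / hh m k) N)
  + sum_n i N * sum_n (fun k => b k / hh m k) N
  + (bilinear_sum (dd m) a b N + bilinear_sum (dd m) b (fun k => nn k / hh m k * (i k + a k)) N).

(** [(i j + a j) / 2] is [nn j] times the squared displacement, so the sum in the
    first term is the part of [|u|_1^2] carried by the modes up to [N].  If [q] is
    [cc * |u|_1^2] this term only contains the neglected modes; the quartic terms
    have cancelled through [bilinear_sum_resonance]. *)
Lemma modified_action_derive (m : R) (i a b : nat -> R -> R) (N : nat) (q t : R) :
  m >= - (1 / 2) ->
  (forall j, is_derive (i j) t (- q * b j t)) ->
  (forall j, is_derive (a j) t ((2 * hh m j + q) * b j t)) ->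
  (forall j, is_derive (b j) t
     (- 2 * nn j * a j t - q * (nn j / hh m j) * (i j t + a j t))) ->
  is_derive (fun s => sum_n (fun j => i j s) N
      + correction m (fun j => i j s) (fun j => a j s) (fun j => b j s) N) t
    (- (q - cc * (sum_n (fun j => (i j t + a j t) / 2) N)) * sum_n (fun j => b j t) N
     + cc * q / 4
       * remainder m (fun j => i j t) (fun j => a j t) (fun j => b j t) N).
Proof.
  intros Hm Hi Ha Hb.
  assert (HI : is_derive (fun s => sum_n (fun j => i j s) N) t
                 (- q * sum_n (fun j => b j t) N)).
  { rewrite <- sum_n_Rmult_l.
    apply (is_derive_Rsum (fun j s => i j s)).
    auto. }
  assert (HA : is_derive (fun s => sum_n (fun k => a k s / hh m k) N) t
                 (2 * sum_n (fun k => b k t) N + q * sum_n (fun k => b k t / hh m k) N)).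
  { rewrite <- !sum_n_Rmult_l, <- sum_n_Rplus.
    apply (is_derive_Rsum (fun k s => a k s / hh m k)). intros k.
    evar_last.
    - apply (is_derive_ext (fun s => / hh m k * a k s)).
      + intros s. unfold Rdiv. apply Rmult_comm.
      + apply is_derive_scal. apply Ha.
    - simpl. pose proof (hh_pos m k Hm). field. lra. }
  pose proof (bilinear_sum_derive (dd m) a a _ _ N t Ha Ha) as HG1.
  pose proof (bilinear_sum_derive (dd m) b b _ _ N t Hb Hb) as HG2.
  unfold correction.
  evar_last.
  - apply (is_derive_Rplus); [exact HI|].
    apply is_derive_scal. apply (is_derive_Rplus).
    + apply is_derive_scal. apply (is_derive_Rmult (fun s => sum_n (fun j => i j s) N));
        [exact HI|exact HA].
    + apply is_derive_scal. apply (is_derive_Rminus);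
        [exact HG1|exact HG2].
  - unfold plus, minus, mult, opp, plus; simpl.
    rewrite (bilinear_sum_sym (dd m) (fun j => (2 * hh m j + q) * b j t)) by apply dd_sym.
    rewrite (bilinear_sum_sym (dd m) (fun j => - 2 * nn j * a j t - _)) by apply dd_sym.
    unfold remainder.
    set (X1 := bilinear_sum (dd m) (fun j => a j t) (fun j => b j t) N).
    set (X2 := bilinear_sum (dd m) (fun j => b j t)
                 (fun k => nn k / hh m k * (i k t + a k t)) N).
    pose proof (bilinear_sum_resonance m (fun j => a j t) (fun j => b j t) N Hm) as HR.
    assert (E1 : bilinear_sum (dd m) (fun j => a j t) (fun j => (2 * hh m j + q) * b j t) N
      = 2 * bilinear_sum (dd m) (fun j => a j t) (fun k => hh m k * b k t) N + q * X1).
    { unfold X1. rewrite <- !bilinear_sum_scal_r, <- bilinear_sum_plus_r. unfold bilinear_sum.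
      apply sum_n_Rext; intros j. apply sum_n_Rext; intros k. ring. }
    assert (E2 : bilinear_sum (dd m) (fun j => b j t)
        (fun j => - 2 * nn j * a j t - q * (nn j / hh m j) * (i j t + a j t)) N
      = - 2 * bilinear_sum (dd m) (fun j => b j t) (fun k => nn k * a k t) N + - q * X2).
    { unfold X2. rewrite <- !bilinear_sum_scal_r, <- bilinear_sum_plus_r. unfold bilinear_sum.
      apply sum_n_Rext; intros j. apply sum_n_Rext; intros k. ring. }
    assert (E3 : sum_n (fun j => (i j t + a j t) / 2) N
      = (sum_n (fun j => i j t) N + sum_n (fun j => a j t) N) / 2).
    { unfold Rdiv. now rewrite sum_n_Rmult_r, sum_n_Rplus. }
    rewrite E1, E2, E3.
    (* The sum of a times the sum of b produced here cancels the oscillating part of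
       the quartic term. *)
    replace (bilinear_sum (dd m) (fun j => a j t) (fun k => hh m k * b k t) N)
      with (sum_n (fun j => a j t) N * sum_n (fun j => b j t) N
            - bilinear_sum (dd m) (fun j => b j t) (fun k => nn k * a k t) N) by lra.
    unfold Rdiv. set (Z := bilinear_sum (dd m) (fun j => b j t) (fun k => nn k * a k t) N).
    field.
Qed.

Lemma weighted_sum_le (m : R) (x X : nat -> R) (N : nat) :
  m >= - (1 / 2) -> (forall k, Rabs (x k) <= X k) ->
  Rabs (sum_n (fun k => x k / hh m k) N) <= / (1 + m) * sum_n X N.
Proof.
  intros Hm HX. rewrite <- sum_n_Rmult_l. apply sum_n_Rabs_le. intros k _.
  unfold Rdiv. rewrite Rabs_mult, Rmult_comm.
  pose proof (hh_ge m k Hm). rewrite (Rabs_pos_eq (/ hh m k)).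
  2: { left. apply Rinv_0_lt_compat. lra. }
  apply Rmult_le_compat; auto using Rabs_pos.
  - left. apply Rinv_0_lt_compat. lra.
  - apply Rinv_le_contravar; lra.
Qed.

Lemma dd_abs_le (m : R) (j k : nat) : m >= - (1 / 2) -> Rabs (dd m j k) <= / (1 + m).
Proof. intros Hm. pose proof (dd_bound m j k Hm). rewrite Rabs_pos_eq; lra. Qed.

Lemma correction_le (m : R) (i a b : nat -> R) (N : nat) :
  m >= - (1 / 2) -> (forall j, 0 <= i j) ->
  (forall j, Rabs (a j) <= i j) -> (forall j, Rabs (b j) <= 2 * i j) ->
  Rabs (correction m i a b N) <= / 6 * (sum_n i N ^ 2 / (1 + m)).
Proof.
  intros Hm Hi Ha Hb.
  assert (Hh : 0 < / (1 + m)) by (apply Rinv_0_lt_compat; lra).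
  assert (Hd : forall j k, Rabs (dd m j k) <= / (1 + m)) by (intros; now apply dd_abs_le).
  pose proof (bilinear_sum_le (dd m) a a i i _ N (Rlt_le _ _ Hh) Hd Ha Ha) as H1.
  pose proof (bilinear_sum_le (dd m) b b (fun j => 2 * i j) (fun j => 2 * i j) _ N
    (Rlt_le _ _ Hh) Hd Hb Hb) as H2.
  pose proof (weighted_sum_le m a i N Hm Ha) as H3.
  rewrite sum_n_Rmult_l in H2.
  pose proof (sum_n_Rge0 i N Hi) as HS.
  set (S := sum_n i N) in *. set (A := sum_n (fun k => a k / hh m k) N) in *.
  assert (H4 : Rabs (S * A) <= / (1 + m) * (S * S)).
  { rewrite Rabs_mult, (Rabs_pos_eq S) by auto.
    apply Rle_trans with (S * (/ (1 + m) * S)); [|right; ring].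
    now apply Rmult_le_compat_l. }
  unfold correction. fold S A.
  pose proof cc_bound as Hc.
  replace (S ^ 2) with (S * S) by ring.
  set (w := / (1 + m) * (S * S)) in *.
  replace (S * S / (1 + m)) with w by (unfold w; field; lra).
  replace (/ (1 + m) * (2 * S * (2 * S))) with (4 * w) in H2 by (unfold w; ring).
  assert (0 <= w) by (unfold w; apply Rmult_le_pos; [lra|nra]).
  apply Rabs_le_between in H1. apply Rabs_le_between in H2. apply Rabs_le_between in H4.
  rewrite Rabs_mult, (Rabs_pos_eq (cc / 2)) by lra.
  apply Rle_trans with (1 / 12 * (2 * w)); [|lra].
  apply Rmult_le_compat; try lra; [apply Rabs_pos|].
  apply Rabs_le. lra.
Qed.

Lemma remainder_le (m : R) (i a b : nat -> R) (N : nat) :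
  m >= - (1 / 2) -> (forall j, 0 <= i j) ->
  (forall j, Rabs (a j) <= i j) -> (forall j, Rabs (b j) <= 2 * i j) ->
  Rabs (remainder m i a b N) <= 14 * (sum_n i N ^ 2 / (1 + m)).
Proof.
  intros Hm Hi Ha Hb.
  assert (Hh : 0 < / (1 + m)) by (apply Rinv_0_lt_compat; lra).
  assert (Hd : forall j k, Rabs (dd m j k) <= / (1 + m)) by (intros; now apply dd_abs_le).
  assert (Hc : forall k, Rabs (nn k / hh m k * (i k + a k)) <= 4 * i k).
  { intros k. pose proof (nn_le_hh m k Hm). pose proof (hh_pos m k Hm).
    pose proof (nn_ge1 k). specialize (Hi k). specialize (Ha k).
    rewrite Rabs_mult.
    assert (0 <= nn k / hh m k <= 2).
    { split; [apply Rdiv_le_0_compat; lra|].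
      apply Rmult_le_reg_r with (hh m k); auto. field_simplify; lra. }
    rewrite (Rabs_pos_eq (nn k / hh m k)) by lra.
    apply Rabs_le_between in Ha.
    rewrite Rabs_pos_eq by lra. nra. }
  pose proof (bilinear_sum_le (dd m) a b _ _ _ N (Rlt_le _ _ Hh) Hd Ha Hb) as H1.
  pose proof (bilinear_sum_le (dd m) b _ _ _ _ N (Rlt_le _ _ Hh) Hd Hb Hc) as H2.
  pose proof (weighted_sum_le m a _ N Hm Ha) as H3. pose proof (weighted_sum_le m b _ N Hm Hb) as H4.
  assert (H5 : Rabs (sum_n b N) <= 2 * sum_n i N).
  { rewrite <- sum_n_Rmult_l. apply sum_n_Rabs_le. auto. }
  rewrite sum_n_Rmult_l in H1, H2, H4. rewrite sum_n_Rmult_l in H2.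
  pose proof (sum_n_Rge0 i N Hi) as HS.
  unfold remainder.
  set (S := sum_n i N) in *.
  set (A := sum_n (fun k => a k / hh m k) N) in *.
  set (B := sum_n (fun k => b k / hh m k) N) in *.
  set (C := sum_n b N) in *.
  replace (S ^ 2) with (S * S) by ring.
  set (w := / (1 + m) * (S * S)) in *.
  replace (S * S / (1 + m)) with w by (unfold w; field; lra).
  assert (H6 : Rabs (C * A) <= 2 * w).
  { rewrite Rabs_mult. apply Rle_trans with ((2 * S) * (/ (1 + m) * S)); [|right; unfold w; ring].
    apply Rmult_le_compat; auto using Rabs_pos. }
  assert (H7 : Rabs (S * B) <= 2 * w).
  { rewrite Rabs_mult, (Rabs_pos_eq S) by auto.
    apply Rle_trans with (S * (/ (1 + m) * (2 * S))); [|right; unfold w; ring].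
    now apply Rmult_le_compat_l. }
  replace (/ (1 + m) * (S * (2 * S))) with (2 * w) in H1 by (unfold w; ring).
  replace (/ (1 + m) * (2 * S * (4 * S))) with (8 * w) in H2 by (unfold w; ring).
  apply Rabs_le_between in H1. apply Rabs_le_between in H2.
  apply Rabs_le_between in H6. apply Rabs_le_between in H7.
  apply Rabs_le. lra.
Qed.

(** * Bootstrap for the action *)

(** The supremum of the times up to which [Q] holds is reached and cannot be
    smaller than [T]. *)
Lemma continuous_induction (T : R) (Q : R -> Prop) :
  Q 0 ->
  (forall t, 0 < t <= T -> (forall s, 0 <= s < t -> Q s) -> Q t) ->
  (forall t, 0 <= t < T -> (forall s, 0 <= s <= t -> Q s) ->
     exists d, 0 < d /\ forall s, t < s < t + d -> Q s) ->
  forall t, 0 <= t <= T -> Q t.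
Proof.
  intros H0 Hclosed Hopen t0 Ht0.
  set (E := fun t => 0 <= t <= T /\ forall s, 0 <= s <= t -> Q s).
  assert (HE0 : E 0).
  { split; [lra|]. intros s Hs. now replace s with 0 by lra. }
  destruct (completeness E) as [tau [Hub Hlub]].
  - exists T. intros t [Ht _]. lra.
  - now exists 0.
  - assert (Htau0 : 0 <= tau) by now apply Hub.
    assert (HtauT : tau <= T).
    { apply Hlub. intros t [Ht _]. lra. }
    assert (Hlt : forall s, 0 <= s < tau -> Q s).
    { intros s Hs.
      destruct (Classical_Prop.classic (Q s)) as [|HnQ]; auto. exfalso.
      assert (tau <= s); [|lra]. apply Hlub. intros t [Ht HQ].
      destruct (Rle_lt_dec t s); auto. exfalso. apply HnQ, HQ. lra. }
    assert (Htau : forall s, 0 <= s <= tau -> Q s).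
    { intros s Hs. destruct (Rle_lt_or_eq_dec s tau) as [Hs'|Hs']; [lra|apply Hlt; lra|].
      subst s. destruct (Rle_lt_or_eq_dec 0 tau Htau0) as [H'|H'].
      - apply Hclosed; auto.
      - now rewrite <- H'. }
    destruct (Rle_lt_or_eq_dec tau T HtauT) as [Hl|He].
    + exfalso. destruct (Hopen tau ltac:(lra) Htau) as [d [Hd HQ]].
      set (t := Rmin T (tau + d / 2)).
      assert (Ht : tau < t) by (unfold t; apply Rmin_glb_lt; lra).
      assert (t <= T) by apply Rmin_l.
      assert (t <= tau + d / 2) by apply Rmin_r.
      assert (t <= tau); [|lra]. apply Hub. split; [lra|].
      intros s Hs. destruct (Rle_lt_dec s tau); [apply Htau; lra|apply HQ; lra].
    + apply Htau. lra.
Qed.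

Lemma nearby_le (f : R -> R) (t l : R) (B : R) :
  is_derive f t l -> f t < B ->
  exists d, 0 < d /\ forall s, Rabs (s - t) < d -> f s <= B.
Proof.
  intros Hf HB.
  assert (Hc : continuous f t) by (apply (ex_derive_continuous f t); now exists l).
  pose proof (filterlim_R_elim Hc (B - f t) ltac:(lra))
    as [d Hd].
  exists d. split; [apply cond_pos|]. intros s Hs.
  specialize (Hd s Hs). apply Rabs_def2 in Hd. lra.
Qed.

Lemma stretch_term_le_action (m : R) (j : nat) (x y : R) : m >= - (1 / 2) ->
  nn j * x ^ 2 <= action m j x y.
Proof.
  intros H. unfold action. pose proof (hh_pos m j H).
  assert (0 <= y ^ 2 / hh m j).
  { apply Rdiv_le_0_compat; auto. apply pow2_ge_0. }
  lra.
Qed.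

(** As long as the action of the first modes is at most [29/10 e^2], the modified
    action moves by at most [2/10 e^2] and the correction is at most
    [3/100 e^2], so the action stays below [5/2 e^2]; continuity then prevents it
    from ever reaching [29/10 e^2].  Working with finitely many modes keeps every
    derivative elementary; [D] bounds the tails of [P].  The identification of [Q]
    is only required while [P <= 3 e^2], which lets the same statement serve for
    the equation with a clamped nonlinearity. *)
Lemma action_bound (m e mu T D : R) (U V : nat -> R -> R) (P Q : R -> R) :
  m >= - (1 / 2) -> 0 < e -> 0 < mu <= 3 * (1 + m) -> e ^ 2 <= 64 / 10000 * mu ->
  0 <= T -> T * e ^ 4 <= 1 / 100 * mu ->
  (forall j t, 0 <= t <= T -> is_derive (U j) t (V j t)) ->
  (forall j t, 0 <= t <= T ->
     is_derive (V j) t (- (nn j * hh m j + Q t * nn j) * U j t)) ->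
  (forall t, 0 <= t <= T -> P t <= 3 * e ^ 2 -> Q t = cc * P t) ->
  (forall t N, 0 <= t <= T ->
     0 <= P t - sum_n (fun j => nn j * U j t ^ 2) N <= D / (INR N + 1)) ->
  (forall N, sum_n (fun j => action m j (U j 0) (V j 0)) N <= 2 * e ^ 2) ->
  forall t, 0 <= t <= T -> P t <= 3 * e ^ 2.
Proof.
  intros Hm He Hmu Hemu HT HTe HU HV HQ HP H0.
  assert (He2 : 0 < e ^ 2) by nra.
  (* Size allowed for the neglected modes: the first bound keeps P below 3 e^2 when
     the action is below 29/10 e^2, the second makes their contribution to the
     modified action, del * e^2 * T, at most e^2 / 10. *)
  set (del := Rmin (e ^ 2 / 20) (1 / (10 * (T + 1)))).
  assert (Hdel : 0 < del).
  { unfold del. apply Rmin_glb_lt; [lra|]. apply Rdiv_lt_0_compat; lra. }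
  assert (Hdel1 : del <= e ^ 2 / 20) by apply Rmin_l.
  assert (Hdel2 : del * T <= 1 / 10).
  { assert (del <= 1 / (10 * (T + 1))) by apply Rmin_r.
    apply Rle_trans with (1 / (10 * (T + 1)) * (T + 1)); [nra|].
    right. field. lra. }
  assert (HN : exists N, D / (INR N + 1) <= del).
  { destruct (INR_unbounded (D / del)) as [N HN]. exists N.
    pose proof (pos_INR N). apply Rmult_le_reg_r with (INR N + 1); [lra|].
    unfold Rdiv at 1. rewrite Rmult_assoc, Rinv_l by lra.
    assert (D / del * del <= INR N * del) by nra.
    replace (D / del * del) with D in * by (field; lra). nra. }
  destruct HN as [N HN].
  set (i := fun j t => action m j (U j t) (V j t)).
  set (a := fun j t => re_square m j (U j t) (V j t)).
  set (b := fun j t => im_square m j (U j t) (V j t)).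
  set (IN := fun t => sum_n (fun j => i j t) N).
  set (F := fun t => correction m (fun j => i j t) (fun j => a j t) (fun j => b j t) N).
  assert (Hi0 : forall j t, 0 <= i j t) by (intros; now apply action_ge0).
  assert (Ha : forall j t, Rabs (a j t) <= i j t) by (intros; now apply re_square_le).
  assert (Hb : forall j t, Rabs (b j t) <= 2 * i j t) by (intros; now apply im_square_le).
  assert (HIN0 : forall t, 0 <= IN t) by (intros t; now apply sum_n_Rge0).
  set (PN := fun t => sum_n (fun j => nn j * U j t ^ 2) N).
  assert (HPN : forall t, PN t <= IN t).
  { intros t. apply sum_n_Rle. intros k _. now apply stretch_term_le_action. }
  assert (HPN' : forall t, sum_n (fun j => (i j t + a j t) / 2) N = PN t).
  { intros t. apply sum_n_Rext. intros k. unfold i, a, action, re_square. field.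
    pose proof (hh_pos m k Hm). lra. }
  assert (HdI : forall t, 0 <= t <= T -> is_derive IN t (sum_n (fun j => - Q t * b j t) N)).
  { intros t Ht.
    apply (is_derive_Rsum (fun j s => i j s)).
    intros k. apply action_derive; auto. }
  assert (HPle : forall t, 0 <= t <= T -> IN t <= 29 / 10 * e ^ 2 -> P t <= 3 * e ^ 2).
  { intros t Ht HI. pose proof (HP t N Ht) as HPt. specialize (HPN t).
    fold (PN t) in HPt. lra. }
  (* From e^2 <= 64/10000 mu <= 192/10000 (1 + m). *)
  assert (HF : forall t, IN t <= 29 / 10 * e ^ 2 -> Rabs (F t) <= 3 / 100 * e ^ 2).
  { intros t HI. pose proof (correction_le m (fun j => i j t) (fun j => a j t)
      (fun j => b j t) N Hm (fun j => Hi0 j t) (fun j => Ha j t) (fun j => Hb j t)) as H.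
    fold (F t) in H. fold (IN t) in H. eapply Rle_trans; [exact H|].
    specialize (HIN0 t).
    assert (IN t ^ 2 <= 841 / 100 * (e ^ 2) ^ 2) by nra.
    apply Rmult_le_reg_r with (6 * (1 + m)); [lra|].
    replace (/ 6 * (IN t ^ 2 / (1 + m)) * (6 * (1 + m))) with (IN t ^ 2) by (field; lra).
    nra. }
  assert (Himp : forall t, 0 <= t <= T ->
    (forall s, 0 <= s <= t -> IN s <= 29 / 10 * e ^ 2) -> IN t <= 5 / 2 * e ^ 2).
  { intros t Ht HI.
    pose proof (HF t (HI t ltac:(lra))) as HFt.
    pose proof (HF 0 (HI 0 ltac:(lra))) as HF0.
    set (J' := fun s => - (Q s - cc * PN s) * sum_n (fun j => b j s) N
      + cc * Q s / 4
        * remainder m (fun j => i j s) (fun j => a j s) (fun j => b j s) N).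
    (* The constant 5/2 bounds (1/36) (3/4) 14 (29/10)^2, with cc <= 1/6. *)
    assert (Hinc : Rabs ((IN t + F t) - (IN 0 + F 0))
      <= (del * e ^ 2 + 5 / 2 * e ^ 6 / (1 + m)) * Rabs (t - 0)).
    { apply (increment_le (fun s => IN s + F s) J').
      - intros s Hs. rewrite Rmin_left, Rmax_right in Hs by lra.
        unfold J'. rewrite <- HPN'.
        apply modified_action_derive; auto.
        + intros j. apply action_derive; auto; [apply HU|apply HV]; lra.
        + intros j. apply re_square_derive; auto; [apply HU|apply HV]; lra.
        + intros j. apply im_square_derive; auto; [apply HU|apply HV]; lra.
      - intros s Hs. rewrite Rmin_left, Rmax_right in Hs by lra.
        pose proof (HI s Hs) as HIs. pose proof (HIN0 s) as HIs0.
        assert (HPs : P s <= 3 * e ^ 2) by (apply HPle; auto; lra).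
        pose proof (HP s N ltac:(lra)) as HPs'. fold (PN s) in HPs'.
        assert (HP0 : 0 <= PN s).
        { apply sum_n_Rge0. intros k. apply nn_sqr_ge0. }
        pose proof cc_bound as Hc.
        pose proof (remainder_le m (fun j => i j s) (fun j => a j s)
          (fun j => b j s) N Hm (fun j => Hi0 j s) (fun j => Ha j s) (fun j => Hb j s)) as HR.
        fold (IN s) in HR.
        assert (HB : Rabs (sum_n (fun j => b j s) N) <= 2 * IN s).
        { unfold IN. rewrite <- sum_n_Rmult_l. apply sum_n_Rabs_le. intros k _. apply Hb. }
        unfold J'. rewrite (HQ s) by (auto; lra).
        eapply Rle_trans; [apply Rabs_triang|]. rewrite !Rabs_mult. apply Rplus_le_compat.
        + replace (- (cc * P s - cc * PN s)) with (- (cc * (P s - PN s))) by ring.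
          rewrite Rabs_Ropp, Rabs_pos_eq by nra.
          apply Rle_trans with (1 / 6 * del * (2 * (29 / 10 * e ^ 2))); [|nra].
          apply Rmult_le_compat; [nra|apply Rabs_pos| |lra].
          apply Rmult_le_compat; lra.
        + rewrite Rabs_pos_eq by nra.
          apply Rle_trans with (3 * e ^ 2 / 144 * (14 * ((841 / 100 * (e ^ 2) ^ 2) / (1 + m)))).
          * apply Rmult_le_compat; [nra|apply Rabs_pos| |].
            -- apply Rle_trans with (1 / 6 * (1 / 6 * (3 * e ^ 2)) / 4); [|lra].
               apply Rmult_le_compat_r; [lra|].
               apply Rmult_le_compat; [lra|nra|lra|]. apply Rmult_le_compat; lra.
            -- eapply Rle_trans; [exact HR|]. apply Rmult_le_compat_l; [lra|].
               apply Rmult_le_compat_r; [left; apply Rinv_0_lt_compat; lra|]. nra.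
          * apply Rmult_le_reg_r with (1 + m); [lra|].
            replace (3 * e ^ 2 / 144 * (14 * (841 / 100 * (e ^ 2) ^ 2 / (1 + m))) * (1 + m))
              with (3 / 144 * 14 * 841 / 100 * (e ^ 2) ^ 3) by (field; lra).
            replace (5 / 2 * e ^ 6 / (1 + m) * (1 + m)) with (5 / 2 * (e ^ 2) ^ 3)
              by (field; lra).
            assert (0 < (e ^ 2) ^ 3) by (apply pow_lt; lra). lra. }
    rewrite Rminus_0_r, (Rabs_pos_eq t) in Hinc by lra.
    assert (Hsum : (del * e ^ 2 + 5 / 2 * e ^ 6 / (1 + m)) * t <= 2 / 10 * e ^ 2).
    { assert (e ^ 4 * t <= 3 / 100 * (1 + m)).
      { assert (0 < e ^ 4) by (apply pow_lt; lra). nra. }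
      assert (del * t <= 1 / 10) by nra.
      replace ((del * e ^ 2 + 5 / 2 * e ^ 6 / (1 + m)) * t)
        with (del * t * e ^ 2 + 5 / 2 * ((e ^ 4 * t) / (1 + m)) * e ^ 2) by (field; lra).
      assert ((e ^ 4 * t) / (1 + m) <= 3 / 100).
      { apply Rmult_le_reg_r with (1 + m); [lra|]. unfold Rdiv at 1.
        rewrite Rmult_assoc, Rinv_l; lra. }
      nra. }
    specialize (H0 N). fold (IN 0) in H0.
    change (sum_n (fun j => action m j (U j 0) (V j 0)) N) with (IN 0) in H0.
    apply Rabs_le_between in Hinc. apply Rabs_le_between in HFt. apply Rabs_le_between in HF0.
    lra. }
  intros t Ht. apply HPle; auto. revert t Ht.
  apply continuous_induction.
  - specialize (H0 N). change (IN 0 <= 2 * e ^ 2) in H0. lra.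
  - intros t Ht HI. apply Rnot_lt_le. intros Hc.
    assert (Hd : is_derive (fun s => - IN s) t (- sum_n (fun j => - Q t * b j t) N)).
    { apply (is_derive_opp IN). apply HdI. lra. }
    destruct (nearby_le _ _ _ (- ((IN t + 29 / 10 * e ^ 2) / 2)) Hd ltac:(lra)) as [d [Hd0 Hd1]].
    set (s := Rmax 0 (t - d / 2)).
    assert (0 <= s) by apply Rmax_l. assert (t - d / 2 <= s) by apply Rmax_r.
    assert (s < t) by (apply Rmax_lub_lt; lra).
    specialize (Hd1 s). specialize (HI s ltac:(lra)).
    rewrite Rabs_left in Hd1 by lra. specialize (Hd1 ltac:(lra)). lra.
  - intros t Ht HI.
    pose proof (Himp t ltac:(lra) HI) as HI'.
    destruct (nearby_le IN t _ (29 / 10 * e ^ 2) (HdI t ltac:(lra)) ltac:(lra)) as [d [Hd0 Hd1]].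
    exists d. split; auto. intros s Hs. apply Hd1. rewrite Rabs_pos_eq; lra.
Qed.

(** * Smooth bumps and test functions *)

(** The family [exp (-1/x) / x^k], extended by zero to [x <= 0], is closed under
    differentiation up to linear combinations; this gives smoothness for all
    orders at once. *)
Definition flat (k : nat) (x : R) : R :=
  if Rlt_dec 0 x then exp (- / x) * (/ x) ^ k else 0.

Lemma pow_le_fact_exp (y : R) (n : nat) : 0 <= y -> y ^ n <= INR (fact n) * exp y.
Proof.
  intros Hy. pose proof (exp_ge_taylor y n Hy) as H.
  pose proof (INR_fact_lt_0 n) as Hf.
  assert (Hl : y ^ n / INR (fact n) <= sum_f_R0 (fun k => y ^ k / INR (fact k)) n).
  { rewrite <- sum_n_Reals. destruct n as [|n]; [rewrite sum_O; lra|].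
    rewrite sum_n_SR.
    assert (0 <= sum_n (fun k => y ^ k / INR (fact k)) n); [|lra].
    apply sum_n_Rge0. intros k. apply Rdiv_le_0_compat; [now apply pow_le|].
    apply INR_fact_lt_0. }
  apply Rmult_le_reg_r with (/ INR (fact n)); [now apply Rinv_0_lt_compat|].
  replace (INR (fact n) * exp y * / INR (fact n)) with (exp y) by (field; lra).
  unfold Rdiv in Hl. lra.
Qed.

(** The linear bound, from the power series of the exponential at [1/x], makes the
    difference quotients at the origin tend to zero. *)
Lemma flat_le (k : nat) (x : R) : 0 <= flat k x <= INR (fact (S k)) * Rabs x.
Proof.
  unfold flat. destruct (Rlt_dec 0 x) as [Hx|Hx].
  - assert (Hy : 0 < / x) by now apply Rinv_0_lt_compat.
    rewrite (Rabs_pos_eq x) by lra.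
    pose proof (pow_le_fact_exp (/ x) (S k) (Rlt_le _ _ Hy)) as H.
    pose proof (exp_pos (/ x)) as He. rewrite exp_Ropp.
    split.
    + apply Rmult_le_pos; [left; now apply Rinv_0_lt_compat|]. apply pow_le. lra.
    + apply Rmult_le_reg_r with (/ x * exp (/ x)); [nra|].
      replace (/ exp (/ x) * (/ x) ^ k * (/ x * exp (/ x))) with ((/ x) ^ S k).
      2: { simpl. field. split; [lra|]. now apply Rgt_not_eq. }
      replace (INR (fact (S k)) * x * (/ x * exp (/ x)))
        with (INR (fact (S k)) * exp (/ x)) by (field; lra).
      exact H.
  - split; [lra|]. apply Rmult_le_pos; [apply pos_INR|apply Rabs_pos].
Qed.

Lemma flat_derive (k : nat) (x : R) :
  is_derive (flat k) x (flat (S (S k)) x - INR k * flat (S k) x).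
Proof.
  destruct (total_order_T x 0) as [[Hx|Hx]|Hx].
  - assert (E : forall j, flat j x = 0).
    { intros j. unfold flat. destruct (Rlt_dec 0 x); lra. }
    rewrite !E. apply (is_derive_ext_loc (fun _ => 0)).
    + exists (mkposreal (- x) ltac:(lra)). intros y Hy.
      change (Rabs (y - x) < - x) in Hy. apply Rabs_def2 in Hy.
      unfold flat. destruct (Rlt_dec 0 y); lra.
    + replace (0 - INR k * 0) with 0 by ring. apply (is_derive_const 0).
  - subst x. assert (E : forall j, flat j 0 = 0).
    { intros j. unfold flat. destruct (Rlt_dec 0 0); lra. }
    rewrite !E. replace (0 - INR k * 0) with 0 by ring.
    apply is_derive_quotient.
    refine (filterlim_R_intro _ _ _ _).
    intros e He. set (K := INR (fact (S (S k)))).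
    assert (HK : 0 < K) by apply INR_fact_lt_0.
    exists (mkposreal (e / K) ltac:(now apply Rdiv_lt_0_compat)).
    intros h Hh Hh0. change (Rabs (h - 0) < e / K) in Hh. rewrite Rminus_0_r in Hh.
    rewrite Rplus_0_l, E.
    assert (E2 : (flat k h - 0) / h = flat (S k) h).
    { unfold flat. destruct (Rlt_dec 0 h); simpl; field; auto. }
    rewrite E2, Rminus_0_r.
    pose proof (flat_le (S k) h) as [H1 H2]. fold K in H2. rewrite Rabs_pos_eq by auto.
    apply Rle_lt_trans with (1 := H2).
    apply Rlt_le_trans with (K * (e / K)); [now apply Rmult_lt_compat_l|].
    right. field. lra.
  - apply (is_derive_ext_loc (fun y => exp (- / y) * (/ y) ^ k)).
    + exists (mkposreal x Hx). intros y Hy.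
      change (Rabs (y - x) < x) in Hy. apply Rabs_def2 in Hy.
      unfold flat. destruct (Rlt_dec 0 y); lra.
    + evar_last.
      * auto_derive; [lra|reflexivity].
      * unfold flat. destruct (Rlt_dec 0 x); [|lra].
        destruct k as [|k]; simpl; field; lra.
Qed.

Inductive flat_algebra : (R -> R) -> Prop :=
| flat_affine k a b : flat_algebra (fun x => flat k (a + b * x))
| flat_scal c f : flat_algebra f -> flat_algebra (fun x => c * f x)
| flat_plus f g : flat_algebra f -> flat_algebra g -> flat_algebra (fun x => f x + g x)
| flat_mult f g : flat_algebra f -> flat_algebra g -> flat_algebra (fun x => f x * g x).

Lemma flat_algebra_derive (f : R -> R) : flat_algebra f ->
  exists f', flat_algebra f' /\ forall x, is_derive f x (f' x).
Proof.
  induction 1 as [k a b|c f Hf [f' [Hf' Df]]|f g Hf [f' [Hf' Df]] Hg [g' [Hg' Dg]]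
                 |f g Hf [f' [Hf' Df]] Hg [g' [Hg' Dg]]].
  - exists (fun x => b * (flat (S (S k)) (a + b * x) + (- INR k) * flat (S k) (a + b * x))).
    split; [repeat constructor|]. intros x.
    evar_last.
    + apply (is_derive_comp (flat k) (fun x => a + b * x)); [apply flat_derive|].
      auto_derive; auto.
    + unfold scal; simpl; unfold mult; simpl. ring.
  - exists (fun x => c * f' x). split; [now constructor|]. intros x.
    now apply is_derive_scal.
  - exists (fun x => f' x + g' x). split; [now constructor|]. intros x.
    now apply (is_derive_Rplus).
  - exists (fun x => f' x * g x + f x * g' x). split; [repeat constructor; auto|]. intros x.
    apply (is_derive_Rmult f g); auto.
Qed.

Definition smooth (f : R -> R) : Prop := forall n x, ex_derive_n f n x.

Lemma ex_derive_n_derive (f f' : R -> R) (n : nat) (x : R) :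
  (forall x, is_derive f x (f' x)) ->
  ex_derive_n f' n x -> ex_derive_n f (S n) x.
Proof.
  intros Hf Hn. destruct n as [|n].
  - exists (f' x). apply Hf.
  - simpl. simpl in Hn. revert Hn. apply ex_derive_ext. intros y.
    change (Derive (Derive_n f n) y) with (Derive_n f (S n) y).
    replace (S n) with (n + 1)%nat by lia. rewrite <- Derive_n_comp.
    apply Derive_n_ext. intros z. symmetry. apply is_derive_unique. apply Hf.
Qed.

Lemma smooth_derive (f f' : R -> R) :
  (forall x, is_derive f x (f' x)) -> smooth f' -> smooth f.
Proof.
  intros Hf Hs [|n] x; [exact I|]. apply ex_derive_n_derive with f'; auto.
Qed.

Lemma smooth_Derive (f : R -> R) : smooth f -> smooth (Derive f).
Proof.
  intros Hs [|n] x; [exact I|]. generalize (Hs (S (S n)) x). simpl.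
  apply ex_derive_ext. intros y.
  change (Derive (Derive_n f n) y) with (Derive_n f (S n) y).
  replace (S n) with (n + 1)%nat by lia. rewrite <- Derive_n_comp.
  reflexivity.
Qed.

Lemma smooth_is_derive (f : R -> R) (x : R) : smooth f -> is_derive f x (Derive f x).
Proof. intros Hs. apply Derive_correct. exact (Hs 1%nat x). Qed.

Lemma flat_algebra_smooth (f : R -> R) : flat_algebra f -> smooth f.
Proof.
  intros Hf n. revert f Hf. induction n as [|n IH]; intros f Hf x; [exact I|].
  destruct (flat_algebra_derive f Hf) as [f' [Hf' D]].
  apply ex_derive_n_derive with f'; auto.
Qed.

Lemma continuous_derive (f : R -> R) (l x : R) : is_derive f x l -> continuous f x.
Proof. intros H. apply (ex_derive_continuous f x). now exists l. Qed.

Definition bump (x : R) : R := flat 0 (1 + x) * flat 0 (1 - x).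

Lemma bump_outside (x : R) : 1 <= Rabs x -> bump x = 0.
Proof.
  intros Hx. unfold bump, flat. unfold Rabs in Hx.
  destruct (Rcase_abs x), (Rlt_dec 0 (1 + x)), (Rlt_dec 0 (1 - x)); try lra; simpl; ring.
Qed.

Lemma bump_ge0 (x : R) : 0 <= bump x.
Proof. apply Rmult_le_pos; apply flat_le. Qed.

Lemma bump_0_pos : 0 < bump 0.
Proof.
  unfold bump, flat. rewrite Rplus_0_r, Rminus_0_r.
  destruct (Rlt_dec 0 1); [|lra]. simpl. rewrite Rmult_1_r.
  apply Rmult_lt_0_compat; apply exp_pos.
Qed.

Lemma bump_affine (a b : R) : flat_algebra (fun x => bump (a + b * x)).
Proof.
  assert (H : flat_algebra (fun x => flat 0 ((1 + a) + b * x) * flat 0 ((1 - a) + (- b) * x)))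
    by repeat constructor.
  replace (fun x => bump (a + b * x))
    with (fun x => flat 0 ((1 + a) + b * x) * flat 0 ((1 - a) + (- b) * x)); auto.
  apply FunctionalExtensionality.functional_extensionality. intros x.
  unfold bump. do 2 f_equal; ring.
Qed.

Lemma bump_continuous (x : R) : continuous bump x.
Proof.
  destruct (flat_algebra_derive _ (bump_affine 0 1)) as [f' [_ D]].
  apply continuous_derive with (f' x). eapply is_derive_ext; [|apply D].
  intros y. simpl. f_equal. ring.
Qed.

(** [bump1] and [bump2] are successive primitives of the bump that vanish on the left
    of its support; [bump2] is affine on the right. *)
Definition bump1 (x : R) : R := RInt bump (-1) x.
Definition bump2 (x : R) : R := RInt bump1 (-1) x.

Lemma bump1_derive (x : R) : is_derive bump1 x (bump x).
Proof.
  apply (is_derive_RInt bump bump1 (-1)).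
  - apply filter_forall. intros y. apply (RInt_correct bump).
    apply ex_RInt_continuous. intros; apply bump_continuous.
  - apply bump_continuous.
Qed.

Lemma bump2_derive (x : R) : is_derive bump2 x (bump1 x).
Proof.
  apply (is_derive_RInt bump1 bump2 (-1)).
  - apply filter_forall. intros y. apply (RInt_correct bump1).
    apply ex_RInt_continuous. intros z _. apply continuous_derive with (bump z).
    apply bump1_derive.
  - apply continuous_derive with (bump x). apply bump1_derive.
Qed.

Lemma equal_of_zero_derive (f f' : R -> R) (a b : R) :
  (forall x, Rmin a b <= x <= Rmax a b -> is_derive f x (f' x) /\ f' x = 0) -> f b = f a.
Proof.
  intros H. assert (E : Rabs (f b - f a) <= 0 * Rabs (b - a)).
  { apply increment_le with f'; intros x Hx; destruct (H x Hx) as [H1 H2]; auto.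
    rewrite H2, Rabs_R0. lra. }
  rewrite Rmult_0_l in E. pose proof (Rabs_pos (f b - f a)).
  destruct (Req_dec (f b - f a) 0) as [|Hn]; [lra|].
  pose proof (Rabs_pos_lt _ Hn). lra.
Qed.

Lemma bump1_left (x : R) : x <= -1 -> bump1 x = 0.
Proof.
  intros Hx. transitivity (bump1 (-1)).
  - apply equal_of_zero_derive with bump. intros y.
    rewrite Rmin_right, Rmax_left by lra. intros Hy. split; [apply bump1_derive|].
    apply bump_outside. rewrite Rabs_left; lra.
  - exact (RInt_point (-1) bump).
Qed.

Lemma bump1_right (x : R) : 1 <= x -> bump1 x = bump1 1.
Proof.
  intros Hx. apply equal_of_zero_derive with bump. intros y.
  rewrite Rmin_left, Rmax_right by lra. intros Hy. split; [apply bump1_derive|].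
  apply bump_outside. rewrite Rabs_pos_eq; lra.
Qed.

Lemma bump2_left (x : R) : x <= -1 -> bump2 x = 0.
Proof.
  intros Hx. transitivity (bump2 (-1)).
  - apply equal_of_zero_derive with bump1. intros y.
    rewrite Rmin_right, Rmax_left by lra. intros Hy. split; [apply bump2_derive|].
    apply bump1_left. lra.
  - exact (RInt_point (-1) bump1).
Qed.

Lemma bump2_right (x : R) : 1 <= x -> bump2 x = bump2 1 + bump1 1 * (x - 1).
Proof.
  intros Hx.
  assert (E : bump2 x - bump1 1 * (x - 1) = bump2 1 - bump1 1 * (1 - 1)).
  { apply (equal_of_zero_derive (fun x => bump2 x - bump1 1 * (x - 1))
      (fun x => bump1 x - bump1 1)). intros y.
    rewrite Rmin_left, Rmax_right by lra. intros Hy. split.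
    - apply (is_derive_Rminus bump2 (fun x => bump1 1 * (x - 1)));
        [apply bump2_derive|].
      auto_derive; auto. ring.
    - rewrite (bump1_right y); lra. }
  lra.
Qed.

Lemma bump1_1_pos : 0 < bump1 1.
Proof.
  assert (Hinc : forall x y, x <= y -> bump1 x <= bump1 y).
  { intros x y Hxy. destruct (MVT_gen bump1 x y bump) as [c [_ Hc]].
    - intros; apply bump1_derive.
    - intros z _. apply continuity_pt_filterlim. apply continuous_derive with (bump z).
      apply bump1_derive.
    - pose proof (bump_ge0 c). nra. }
  assert (Hge : 0 <= bump1 0).
  { pose proof (bump1_left (-1) ltac:(lra)). pose proof (Hinc (-1) 0 ltac:(lra)). lra. }
  assert (Hge1 : 0 <= bump1 1) by (pose proof (Hinc 0 1 ltac:(lra)); lra).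
  destruct (Rle_lt_or_eq_dec 0 (bump1 1) Hge1) as [|Hz]; auto.
  exfalso.
  assert (Hq : is_derive bump1 0 0).
  { apply (is_derive_ext_loc (fun _ => 0)).
    - exists (mkposreal 1 Rlt_0_1). intros y Hy. change (Rabs (y - 0) < 1) in Hy.
      apply Rabs_def2 in Hy.
      pose proof (Hinc (-1) y ltac:(lra)). pose proof (Hinc y 1 ltac:(lra)).
      pose proof (bump1_left (-1) ltac:(lra)). lra.
    - apply (is_derive_const 0). }
  pose proof (is_derive_unique _ _ _ Hq) as E1.
  pose proof (is_derive_unique _ _ _ (bump1_derive 0)) as E2.
  pose proof bump_0_pos. lra.
Qed.

(** A second difference of translates of [bump2] at the equidistant points [x1],
    [x2], [2 x2 - x1]: the affine parts on the right cancel, hence compact support,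
    while the second derivative is a second difference of bumps of width [d]. *)
Definition probe (d x1 x2 x : R) : R :=
  bump2 (- x1 / d + / d * x) + -2 * bump2 (- x2 / d + / d * x)
  + bump2 (- (2 * x2 - x1) / d + / d * x).

Definition probe_dd (d x1 x2 x : R) : R :=
  / d * / d * ((bump (- x1 / d + / d * x) + -2 * bump (- x2 / d + / d * x))
  + bump (- (2 * x2 - x1) / d + / d * x)).

Lemma affine_comp_derive (f f' : R -> R) (a b x : R) :
  (forall x, is_derive f x (f' x)) ->
  is_derive (fun x => f (a + b * x)) x (b * f' (a + b * x)).
Proof.
  intros H. evar_last.
  - apply (is_derive_comp f (fun x => a + b * x)); [apply H|]. auto_derive; auto.
  - unfold scal; simpl; unfold mult; simpl. ring.
Qed.

Definition probe_d (d x1 x2 x : R) : R :=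
  / d * ((bump1 (- x1 / d + / d * x) + -2 * bump1 (- x2 / d + / d * x))
  + bump1 (- (2 * x2 - x1) / d + / d * x)).

Lemma probe_derive (d x1 x2 x : R) :
  is_derive (probe d x1 x2) x (probe_d d x1 x2 x) /\
  is_derive (probe_d d x1 x2) x (probe_dd d x1 x2 x).
Proof.
  split.
  - unfold probe, probe_d. evar_last.
    + apply (is_derive_Rplus); [apply (is_derive_Rplus)|].
      * apply (affine_comp_derive bump2 bump1). apply bump2_derive.
      * apply is_derive_scal. apply (affine_comp_derive bump2 bump1). apply bump2_derive.
      * apply (affine_comp_derive bump2 bump1). apply bump2_derive.
    + unfold plus; simpl. ring.
  - unfold probe_d, probe_dd. evar_last.
    + apply is_derive_scal.
      apply (is_derive_Rplus); [apply (is_derive_Rplus)|].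
      * apply (affine_comp_derive bump1 bump). apply bump1_derive.
      * apply is_derive_scal. apply (affine_comp_derive bump1 bump). apply bump1_derive.
      * apply (affine_comp_derive bump1 bump). apply bump1_derive.
    + unfold plus; simpl. ring.
Qed.

Lemma probe_test_function (d x1 x2 : R) :
  0 < d -> x1 <= x2 -> 0 < x1 - d -> 2 * x2 - x1 + d < PI ->
  test_function (probe d x1 x2).
Proof.
  intros Hd H12 H1 H3. split.
  - change (smooth (probe d x1 x2)).
    apply smooth_derive with (probe_d d x1 x2); [intros; apply probe_derive|].
    apply smooth_derive with (probe_dd d x1 x2); [intros; apply probe_derive|].
    apply flat_algebra_smooth. unfold probe_dd.
    apply flat_scal, flat_plus; [apply flat_plus|].
    + apply bump_affine.
    + apply flat_scal. apply bump_affine.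
    + apply bump_affine.
  - exists (x1 - d), (2 * x2 - x1 + d). repeat split; auto.
    + apply Rnot_lt_le. intros Hx. apply H. unfold probe.
      assert (Hl : forall y, x1 <= y -> - y / d + / d * x <= -1).
      { intros y Hy. apply Rmult_le_reg_r with d; auto. field_simplify; lra. }
      rewrite (bump2_left (- x1 / d + / d * x)) by (apply Hl; lra).
      rewrite (bump2_left (- x2 / d + / d * x)) by (apply Hl; lra).
      rewrite (bump2_left (- (2 * x2 - x1) / d + / d * x)) by (apply Hl; lra). ring.
    + apply Rnot_lt_le. intros Hx. apply H. unfold probe.
      assert (Hl : forall y, y <= 2 * x2 - x1 -> 1 <= - y / d + / d * x).
      { intros y Hy. apply Rmult_le_reg_r with d; auto. field_simplify; lra. }
      rewrite (bump2_right (- x1 / d + / d * x)) by (apply Hl; lra).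
      rewrite (bump2_right (- x2 / d + / d * x)) by (apply Hl; lra).
      rewrite (bump2_right (- (2 * x2 - x1) / d + / d * x)) by (apply Hl; lra). field. lra.
Qed.

(** * Weakly affine functions vanishing at the ends *)

Lemma continuous_affine (G : R -> R) (a b x : R) :
  (forall x, continuous G x) -> continuous (fun z => G (a + b * z)) x.
Proof.
  intros HG. apply (continuous_comp (fun z => a + b * z) G); [|apply HG].
  apply continuous_derive with b. auto_derive; auto. ring.
Qed.

Lemma continuous_Rmult (f g : R -> R) (x : R) :
  continuous f x -> continuous g x -> continuous (fun y => f y * g y) x.
Proof. exact (continuous_mult f g x). Qed.

Lemma ex_RInt_cont (f : R -> R) (a b : R) : (forall x, continuous f x) -> ex_RInt f a b.
Proof. intros H. apply (ex_RInt_continuous f). auto. Qed.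

Lemma bump_average (G : R -> R) (d y : R) :
  (forall x, continuous G x) -> 0 < d -> 0 <= y - d -> y + d <= PI ->
  RInt (fun x => G x * (/ d * bump (- y / d + / d * x))) 0 PI
  = RInt (fun z => G (y + d * z) * bump z) (-1) 1.
Proof.
  intros HG Hd Hl Hr.
  set (f := fun x => G x * (/ d * bump (- y / d + / d * x))).
  assert (Hf : forall x, continuous f x).
  { intros x. apply continuous_Rmult; [apply HG|].
    apply continuous_Rmult; [apply continuous_const|].
    apply continuous_affine, bump_continuous. }
  assert (Hz : forall a b, a <= b -> b <= y - d \/ y + d <= a -> RInt f a b = 0).
  { intros a b Hab Ho. transitivity (RInt (fun _ => 0) a b).
    - apply RInt_ext. rewrite Rmin_left, Rmax_right by auto. intros x Hx. unfold f.
      rewrite bump_outside; [rring|].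
      destruct Ho as [Ho|Ho].
      + rewrite Rabs_left1.
        * apply Rmult_le_reg_r with d; auto. field_simplify; lra.
        * apply Rmult_le_reg_r with d; auto. field_simplify; lra.
      + rewrite Rabs_pos_eq.
        * apply Rmult_le_reg_r with d; auto. field_simplify; lra.
        * apply Rmult_le_reg_r with d; auto. field_simplify; lra.
    - rewrite RInt_const. unfold scal; simpl; unfold mult; simpl. ring. }
  fold f.
  rewrite <- (RInt_Chasles f 0 (y - d) PI) by now apply ex_RInt_cont.
  rewrite <- (RInt_Chasles f (y - d) (y + d) PI) by now apply ex_RInt_cont.
  rewrite (Hz 0 (y - d)), (Hz (y + d) PI) by lra.
  pose proof (RInt_comp_lin f d y (-1) 1) as HL.
  replace (d * -1 + y) with (y - d) in HL by ring.
  replace (d * 1 + y) with (y + d) in HL by ring.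
  rewrite <- HL by now apply ex_RInt_cont.
  unfold plus; simpl. rewrite Rplus_0_l, Rplus_0_r.
  apply RInt_ext. intros z _. unfold f, scal; simpl; unfold mult; simpl.
  replace (- y / d + / d * (d * z + y)) with z by (field; lra).
  replace (d * z + y) with (y + d * z) by ring.
  field. lra.
Qed.

Lemma RInt_lin3 (f g h : R -> R) (p q r a b : R) :
  (forall x, continuous f x) -> (forall x, continuous g x) -> (forall x, continuous h x) ->
  RInt (fun x => p * f x + q * g x + r * h x) a b
  = p * RInt f a b + q * RInt g a b + r * RInt h a b.
Proof.
  intros Hf Hg Hh.
  apply (is_RInt_unique (V := R_CompleteNormedModule)).
  assert (Hs : forall (p : R) (f : R -> R), (forall x, continuous f x) ->
    is_RInt (fun x => p * f x) a b (p * RInt f a b)).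
  { intros p' f' H. apply (is_RInt_scal (V := R_NormedModule) f').
    apply (RInt_correct f'). now apply ex_RInt_cont. }
  apply (is_RInt_plus (V := R_NormedModule)); auto.
  apply (is_RInt_plus (V := R_NormedModule)); auto.
Qed.

(** Testing with [probe] gives the second difference of [G] averaged against a
    bump; by continuity the average is within half of the second difference at the
    points themselves if the bumps are narrow. *)
Lemma second_difference (G : R -> R) (x1 x2 : R) :
  (forall x, continuous G x) ->
  (forall eta, test_function eta -> RInt (fun x => G x * Derive_n eta 2 x) 0 PI = 0) ->
  0 < x1 -> x1 <= x2 -> 2 * x2 - x1 < PI ->
  G x1 + G (2 * x2 - x1) = 2 * G x2.
Proof.
  intros HG Hweak H1 H12 H3.
  set (x3 := 2 * x2 - x1) in *.
  assert (H23 : x2 <= x3) by (unfold x3; lra).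
  set (D := fun d z => G (x1 + d * z) - 2 * G (x2 + d * z) + G (x3 + d * z)).
  assert (HDc : forall d z, continuous (D d) z).
  { intros d z. unfold D.
    apply (continuous_Rplus (fun z => G (x1 + d * z) - 2 * G (x2 + d * z))).
    - apply (continuous_Rminus (fun z => G (x1 + d * z))).
      + now apply continuous_affine.
      + apply continuous_Rmult; [apply continuous_const|now apply continuous_affine].
    - now apply continuous_affine. }
  assert (Hint : forall d, 0 < d -> 0 < x1 - d -> x3 + d < PI ->
    RInt (fun z => D d z * bump z) (-1) 1 = 0).
  { intros d Hd Hl Hr. pose proof (Hweak _ (probe_test_function d x1 x2 Hd H12 Hl Hr)) as E.
    rewrite (RInt_ext _ (fun x => / d * (G x * (/ d * bump (- x1 / d + / d * x)))
      + -2 * / d * (G x * (/ d * bump (- x2 / d + / d * x)))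
      + / d * (G x * (/ d * bump (- x3 / d + / d * x))))) in E.
    2: { intros x _. simpl.
         rewrite (Derive_ext _ (probe_d d x1 x2))
           by (intros y; apply is_derive_unique, probe_derive).
         rewrite (is_derive_unique _ _ _ (proj2 (probe_derive d x1 x2 x))).
         unfold probe_dd. fold x3. rring. }
    assert (Hc : forall y x, continuous (fun x => G x * (/ d * bump (- y / d + / d * x))) x).
    { intros y x. apply continuous_Rmult; [apply HG|].
      apply continuous_Rmult; [apply continuous_const|].
      apply continuous_affine, bump_continuous. }
    rewrite RInt_lin3 in E by apply Hc.
    rewrite !bump_average in E by (auto; unfold x3 in *; lra).
    assert (Hc' : forall y x, continuous (fun z => G (y + d * z) * bump z) x).
    { intros y x. apply continuous_Rmult; [now apply continuous_affine|apply bump_continuous]. }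
    transitivity (RInt (fun z => 1 * (G (x1 + d * z) * bump z)
      + -2 * (G (x2 + d * z) * bump z) + 1 * (G (x3 + d * z) * bump z)) (-1) 1).
    - apply RInt_ext. intros z _. unfold D. rring.
    - rewrite RInt_lin3 by apply Hc'.
      apply Rmult_eq_reg_l with (/ d); [|apply Rinv_neq_0_compat; lra].
      rewrite Rmult_0_r, <- E. ring. }
  set (g := G x1 - 2 * G x2 + G x3).
  destruct (Req_dec g 0) as [Hg|Hg]; [unfold g in Hg; lra|]. exfalso.
  assert (Hga : 0 < Rabs g) by now apply Rabs_pos_lt.
  assert (Hnear : exists d0, 0 < d0 /\ forall h, Rabs h < d0 ->
    Rabs (G (x1 + h) - 2 * G (x2 + h) + G (x3 + h) - g) < Rabs g / 2).
  { assert (Hc : continuous (D 1) 0) by apply HDc.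
    destruct (filterlim_R_elim Hc (Rabs g / 2) ltac:(lra)) as [d0 Hd0].
    exists d0. split; [apply cond_pos|]. intros h Hh.
    assert (Hb : Rabs (h - 0) < d0) by now rewrite Rminus_0_r.
    specialize (Hd0 h Hb).
    unfold D in Hd0. rewrite !Rmult_0_r, !Rplus_0_r, !Rmult_1_l in Hd0. exact Hd0. }
  destruct Hnear as [d0 [Hd0 Hnear]].
  (* Narrow enough for the continuity estimate and for the bumps to stay in (0, PI). *)
  set (d := Rmin (d0 / 2) (Rmin (x1 / 2) ((PI - x3) / 2))).
  assert (Hd : 0 < d) by (unfold d; repeat apply Rmin_glb_lt; lra).
  assert (Ha : d <= d0 / 2) by apply Rmin_l.
  assert (Hb : d <= x1 / 2) by (eapply Rle_trans; [apply Rmin_r|apply Rmin_l]).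
  assert (Hc : d <= (PI - x3) / 2) by (eapply Rle_trans; [apply Rmin_r|apply Rmin_r]).
  specialize (Hint d Hd ltac:(lra) ltac:(lra)).
  assert (Hbump : RInt bump (-1) 1 = bump1 1) by reflexivity.
  pose proof bump1_1_pos as Hpos.
  assert (Hex : ex_RInt (fun z => D d z * bump z) (-1) 1).
  { apply ex_RInt_cont. intros x. apply continuous_Rmult; [apply HDc|apply bump_continuous]. }
  assert (Hexb : forall c, ex_RInt (fun z => c * bump z) (-1) 1).
  { intros c. apply ex_RInt_cont. intros x.
    apply continuous_Rmult; [apply continuous_const|apply bump_continuous]. }
  assert (Hsc : forall c, RInt (fun z => c * bump z) (-1) 1 = c * bump1 1).
  { intros c. rewrite <- Hbump. apply (RInt_scal (V := R_CompleteNormedModule) bump).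
    apply ex_RInt_cont. apply bump_continuous. }
  assert (Hz : forall z, -1 < z < 1 -> Rabs (D d z - g) < Rabs g / 2).
  { intros z Hz. apply Hnear. rewrite Rabs_mult, (Rabs_pos_eq d) by lra.
    assert (Rabs z < 1) by (apply Rabs_def1; lra). pose proof (Rabs_pos z). nra. }
  assert (H5 : RInt (fun z => (g - Rabs g / 2) * bump z) (-1) 1
    <= RInt (fun z => D d z * bump z) (-1) 1).
  { apply RInt_le; auto; [lra|]. intros z Hz'. specialize (Hz z Hz').
    apply Rabs_def2 in Hz. apply Rmult_le_compat_r; [apply bump_ge0|lra]. }
  assert (H6 : RInt (fun z => D d z * bump z) (-1) 1
    <= RInt (fun z => (g + Rabs g / 2) * bump z) (-1) 1).
  { apply RInt_le; auto; [lra|]. intros z Hz'. specialize (Hz z Hz').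
    apply Rabs_def2 in Hz. apply Rmult_le_compat_r; [apply bump_ge0|lra]. }
  rewrite Hsc, Hint in H5. rewrite Hsc, Hint in H6.
  unfold Rabs in *. destruct (Rcase_abs g); nra.
Qed.

Lemma right_limit_zero (h : R -> R) (d : R) :
  continuous h 0 -> 0 < d -> (forall x, 0 < x < d -> h x = 0) -> h 0 = 0.
Proof.
  intros Hc Hd Hz. destruct (Req_dec (h 0) 0) as [|Hn]; auto. exfalso.
  pose proof (Rabs_pos_lt _ Hn) as Hp.
  destruct (filterlim_R_elim Hc (Rabs (h 0)) Hp) as [d0 Hd0].
  pose proof (cond_pos d0).
  set (x := Rmin (d0 / 2) (d / 2)).
  assert (0 < x) by (apply Rmin_glb_lt; lra).
  assert (x <= d0 / 2) by apply Rmin_l. assert (x <= d / 2) by apply Rmin_r.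
  assert (Hb : Rabs (x - 0) < d0) by (rewrite Rminus_0_r, Rabs_pos_eq; lra).
  specialize (Hd0 x Hb). rewrite (Hz x) in Hd0 by lra.
  replace (0 - h 0) with (- h 0) in Hd0 by ring. rewrite Rabs_Ropp in Hd0. lra.
Qed.

(** Vanishing second differences together with the zero at the nearest end say that
    doubling the distance to that end doubles the value.  So any bound for [|G|] may
    be halved, and [G] is zero. *)
Lemma weakly_affine_zero (G : R -> R) (M : R) :
  (forall x, continuous G x) -> (forall x, Rabs (G x) <= M) -> G 0 = 0 -> G PI = 0 ->
  (forall eta, test_function eta -> RInt (fun x => G x * Derive_n eta 2 x) 0 PI = 0) ->
  forall x, 0 <= x <= PI -> G x = 0.
Proof.
  intros HG HM G0 Gpi Hweak.
  assert (Hleft : forall x, 0 < x <= PI / 2 -> G (2 * x) = 2 * G x).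
  { intros x Hx.
    assert (E : (fun y => G (0 + 1 * y) + G (2 * x + -1 * y) - 2 * G x) 0 = 0).
    { apply (right_limit_zero (fun y => G (0 + 1 * y) + G (2 * x + -1 * y) - 2 * G x) x); [|lra|].
      - apply (continuous_Rminus (fun y => G (0 + 1 * y) + G (2 * x + -1 * y)));
          [|apply continuous_const].
        apply (continuous_Rplus (fun y => G (0 + 1 * y)));
          now apply continuous_affine.
      - intros y Hy. pose proof (second_difference G y x HG Hweak ltac:(lra) ltac:(lra) ltac:(lra)) as E.
        replace (0 + 1 * y) with y by ring. replace (2 * x + -1 * y) with (2 * x - y) by ring.
        lra. }
    simpl in E. rewrite !Rmult_0_r, !Rplus_0_r, G0 in E. lra. }
  assert (Hright : forall x, PI / 2 <= x < PI -> G (2 * x - PI) = 2 * G x).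
  { intros x Hx.
    assert (E : (fun y => G (PI + -1 * y) + G ((2 * x - PI) + 1 * y) - 2 * G x) 0 = 0).
    { apply (right_limit_zero
        (fun y => G (PI + -1 * y) + G ((2 * x - PI) + 1 * y) - 2 * G x) (PI - x)); [|lra|].
      - apply (continuous_Rminus
          (fun y => G (PI + -1 * y) + G ((2 * x - PI) + 1 * y))); [|apply continuous_const].
        apply (continuous_Rplus (fun y => G (PI + -1 * y)));
          now apply continuous_affine.
      - intros y Hy.
        pose proof (second_difference G (2 * x - PI + y) x HG Hweak ltac:(lra) ltac:(lra) ltac:(lra)) as E.
        replace (2 * x - (2 * x - PI + y)) with (PI + -1 * y) in E by ring.
        replace (2 * x - PI + 1 * y) with (2 * x - PI + y) by ring. lra. }
    simpl in E. rewrite !Rmult_0_r, !Rplus_0_r, Gpi in E. lra. }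
  assert (Hb : forall n x, 0 <= x <= PI -> Rabs (G x) <= M * (1 / 2) ^ n).
  { induction n as [|n IH]; intros x Hx; [rewrite Rmult_1_r; apply HM|].
    simpl.
    assert (H2 : Rabs (2 * G x) <= M * (1 / 2) ^ n).
    { destruct (Rle_lt_or_eq_dec 0 x) as [H0|H0]; [lra| |].
      2: { specialize (IH x Hx). rewrite <- H0, G0 in *. now rewrite Rmult_0_r. }
      destruct (Rle_lt_or_eq_dec x PI) as [Hp|Hp]; [lra| |].
      2: { specialize (IH x Hx). rewrite Hp, Gpi in *. now rewrite Rmult_0_r. }
      destruct (Rle_lt_dec x (PI / 2)).
      - rewrite <- Hleft by lra. apply IH. lra.
      - rewrite <- Hright by lra. apply IH. lra. }
    rewrite Rabs_mult, (Rabs_pos_eq 2) in H2 by lra. lra. }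
  intros x Hx. apply zero_of_geometric with M; auto.
  eapply Rle_trans; [apply Rabs_pos|apply (HM x)].
Qed.

(** * Sine series *)

(** The cosines that occur in the derivatives of [phi], with the same normalisation. *)
Definition psi (j : nat) (x : R) : R := sqrt (2 / PI) * cos (INR j * x).

Lemma sqrt_2_PI : 0 < sqrt (2 / PI) <= 1.
Proof.
  pose proof PI2_3_2. pose proof PI_RGT_0. unfold PI2 in *. split.
  - apply sqrt_lt_R0. apply Rdiv_lt_0_compat; lra.
  - rewrite <- sqrt_1. apply sqrt_le_1_alt.
    apply Rmult_le_reg_r with PI; auto. field_simplify; lra.
Qed.

Lemma sqrt_2_PI_sqr : sqrt (2 / PI) * sqrt (2 / PI) = 2 / PI.
Proof. apply sqrt_def. pose proof PI_RGT_0. left. apply Rdiv_lt_0_compat; lra. Qed.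

Lemma phi_le1 (j : nat) (x : R) : Rabs (phi j x) <= 1.
Proof.
  unfold phi. pose proof sqrt_2_PI. pose proof (SIN_bound (INR j * x)).
  rewrite Rabs_mult, Rabs_pos_eq by lra.
  assert (Rabs (sin (INR j * x)) <= 1) by (apply Rabs_le; lra).
  pose proof (Rabs_pos (sin (INR j * x))). nra.
Qed.

Lemma psi_le1 (j : nat) (x : R) : Rabs (psi j x) <= 1.
Proof.
  unfold psi. pose proof sqrt_2_PI. pose proof (COS_bound (INR j * x)).
  rewrite Rabs_mult, Rabs_pos_eq by lra.
  assert (Rabs (cos (INR j * x)) <= 1) by (apply Rabs_le; lra).
  pose proof (Rabs_pos (cos (INR j * x))). nra.
Qed.

Lemma phi_derive (j : nat) (x : R) : is_derive (phi j) x (INR j * psi j x).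
Proof. unfold phi, psi. auto_derive; auto. ring. Qed.

Lemma psi_derive (j : nat) (x : R) : is_derive (psi j) x (- INR j * phi j x).
Proof. unfold phi, psi. auto_derive; auto. ring. Qed.

Lemma phi_cont (j : nat) (x : R) : continuous (phi j) x.
Proof. exact (continuous_derive _ _ _ (phi_derive j x)). Qed.

Lemma psi_cont (j : nat) (x : R) : continuous (psi j) x.
Proof. exact (continuous_derive _ _ _ (psi_derive j x)). Qed.

Lemma phi_at_0 (j : nat) : phi j 0 = 0.
Proof. unfold phi. rewrite Rmult_0_r, sin_0. ring. Qed.

Lemma sin_INR_PI (j : nat) : sin (INR j * PI) = 0.
Proof.
  apply sin_eq_0_1. exists (Z.of_nat j). now rewrite <- INR_IZR_INZ.
Qed.

Lemma phi_at_PI (j : nat) : phi j PI = 0.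
Proof. unfold phi. rewrite sin_INR_PI. ring. Qed.

Lemma Rabs_term_le (a : nat -> R) (e : nat -> R -> R) (x : R) :
  (forall n x, Rabs (e n x) <= 1) -> forall n, Rabs (a n * e n x) <= Rabs (a n).
Proof.
  intros He n. rewrite Rabs_mult. pose proof (He n x). pose proof (Rabs_pos (a n)). nra.
Qed.

Lemma ex_series_fun (a : nat -> R) (e : nat -> R -> R) (x : R) :
  (forall n x, Rabs (e n x) <= 1) -> ex_series (fun n => Rabs (a n)) ->
  ex_series (fun n => a n * e n x).
Proof.
  intros He Ha. apply ex_series_dom with (fun n => Rabs (a n)); auto.
  intros n. now apply (Rabs_term_le a e x).
Qed.

Lemma Series_fun_continuous (a : nat -> R) (e : nat -> R -> R) (x : R) :
  (forall n x, Rabs (e n x) <= 1) -> (forall n x, continuous (e n) x) ->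
  ex_series (fun n => Rabs (a n)) ->
  continuous (fun x => Series (fun n => a n * e n x)) x.
Proof.
  intros He Hc Ha.
  apply (tannery (locally x) (fun n x => a n * e n x) (fun n => a n * e n x)
    (fun n => Rabs (a n))); auto.
  - apply filter_forall. intros y n. now apply (Rabs_term_le a e y).
  - intros n. apply (continuous_Rmult (fun _ => a n) (e n) x); [apply continuous_const|apply Hc].
Qed.

Lemma Series_fun_derive (a w : nat -> R) (e e' : nat -> R -> R) (x : R) :
  (forall n x, Rabs (e n x) <= 1) -> (forall n x, Rabs (e' n x) <= 1) ->
  (forall n x, is_derive (e n) x (w n * e' n x)) ->
  ex_series (fun n => Rabs (a n)) -> ex_series (fun n => Rabs (a n * w n)) ->
  is_derive (fun x => Series (fun n => a n * e n x)) x
    (Series (fun n => a n * w n * e' n x)).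
Proof.
  intros He He' Hd Ha Haw.
  apply (is_derive_Series (fun n x => a n * e n x) (fun n x => a n * w n * e' n x)
    (fun n => Rabs (a n * w n)) x 1); auto; try lra.
  - intros y _. now apply ex_series_fun.
  - intros n y _. evar_last; [apply is_derive_scal, Hd|]. simpl. ring.
  - intros n y _. now apply (Rabs_term_le (fun n => a n * w n) e' y).
Qed.

(** Uniform convergence of the partial sums on [[0, PI]]. *)
Lemma RInt_Series (a : nat -> R) (e : nat -> R -> R) (g : R -> R) (K : R) :
  (forall n x, Rabs (e n x) <= 1) -> (forall n x, continuous (e n) x) ->
  ex_series (fun n => Rabs (a n)) ->
  (forall x, continuous g x) -> (forall x, 0 <= x <= PI -> Rabs (g x) <= K) ->
  is_series (fun n => a n * RInt (fun x => e n x * g x) 0 PI)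
    (RInt (fun x => Series (fun n => a n * e n x) * g x) 0 PI).
Proof.
  intros He Hec Ha Hg HK. pose proof PI_RGT_0 as Hpi.
  assert (HK0 : 0 <= K).
  { eapply Rle_trans; [apply Rabs_pos|apply (HK 0)]. lra. }
  set (F := fun x => Series (fun n => a n * e n x)).
  assert (HF : forall x, continuous F x) by (intros; now apply Series_fun_continuous).
  assert (Hexe : forall n, ex_RInt (fun x => e n x * g x) 0 PI).
  { intros n. apply ex_RInt_cont. intros. now apply continuous_Rmult. }
  assert (HN : forall N, is_RInt (fun x => sum_n (fun n => a n * e n x) N * g x) 0 PI
    (sum_n (fun n => a n * RInt (fun x => e n x * g x) 0 PI) N)).
  { assert (H1 : forall n, is_RInt (fun x => a n * (e n x * g x)) 0 PI
      (a n * RInt (fun x => e n x * g x) 0 PI)).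
    { intros n. apply (is_RInt_scal (V := R_NormedModule) (fun x => e n x * g x)).
      apply (RInt_correct (fun x => e n x * g x)). apply Hexe. }
    induction N as [|N IH].
    - rewrite sum_O. eapply is_RInt_ext; [|apply H1]. intros x _. simpl.
      rewrite sum_O. rring.
    - rewrite sum_n_SR. eapply is_RInt_ext.
      2: { apply (is_RInt_plus (V := R_NormedModule)); [exact IH|apply (H1 (S N))]. }
      intros x _. rewrite sum_n_SR. unfold plus; simpl. ring. }
  refine (filterlim_R_intro _ _ _ _). intros eps Heps.
  assert (Ht : exists N0, forall N, (N0 <= N)%nat ->
    Series (fun k => Rabs (a (S N + k)%nat)) < eps / (PI * (K + 1))).
  { destruct Ha as [l Hl].
    assert (Hp : 0 < eps / (PI * (K + 1))) by (apply Rdiv_lt_0_compat; nra).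
    destruct (filterlim_R_elim Hl _ Hp) as [N0 HN0].
    exists N0. intros N HN'.
    assert (HN1 : Rabs (sum_n (fun n => Rabs (a n)) N - l) < eps / (PI * (K + 1)))
      by exact (HN0 N HN').
    apply Rabs_def2 in HN1.
    pose proof (Series_tail _ N (ex_intro _ l Hl)) as E.
    rewrite (is_series_unique _ _ Hl) in E. cbv beta in E.
    match type of E with @eq _ ?u ?v => change (@eq R u v) in E end. lra. }
  destruct Ht as [N0 Ht]. exists N0. intros N HN0. specialize (Ht N HN0).
  change (Rabs (sum_n (fun n => a n * RInt (fun x => e n x * g x) 0 PI) N
    - RInt (fun x => F x * g x) 0 PI) < eps).
  rewrite <- (is_RInt_unique _ _ _ _ (HN N)).
  assert (HexN : ex_RInt (fun x => sum_n (fun n => a n * e n x) N * g x) 0 PI)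
    by (eexists; apply HN).
  assert (HexF : ex_RInt (fun x => F x * g x) 0 PI).
  { apply ex_RInt_cont. intros. now apply continuous_Rmult. }
  rewrite Rabs_minus_sym.
  replace (RInt (fun x => F x * g x) 0 PI
    - RInt (fun x => sum_n (fun n => a n * e n x) N * g x) 0 PI)
    with (RInt (fun x => F x * g x - sum_n (fun n => a n * e n x) N * g x) 0 PI).
  2: { apply (RInt_minus (V := R_CompleteNormedModule) (fun x => F x * g x)); auto. }
  eapply Rle_lt_trans.
  - apply abs_RInt_le_const with (M := Series (fun k => Rabs (a (S N + k)%nat)) * K); [lra| |].
    + apply (ex_RInt_minus (V := R_NormedModule) (fun x => F x * g x)); auto.
    + intros x Hx. unfold F. rewrite (Series_tail _ N) by now apply ex_series_fun.
      match goal with |- Rabs (?u) <= _ =>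
        replace u with (Series (fun k => a (S N + k)%nat * e (S N + k)%nat x) * g x) by rring end.
      rewrite Rabs_mult. apply Rmult_le_compat; auto using Rabs_pos.
      apply Series_abs_le.
      * intros n. apply (Rabs_term_le a e x); auto.
      * now apply (ex_series_tail (fun n => Rabs (a n))).
  - rewrite Rminus_0_r.
    set (tl := Series (fun k => Rabs (a (S N + k)%nat))) in *.
    assert (Htl : 0 <= tl).
    { apply Series_ge0; [intros; apply Rabs_pos|].
      now apply (ex_series_tail (fun n => Rabs (a n))). }
    assert (E : PI * (K + 1) * tl < PI * (K + 1) * (eps / (PI * (K + 1)))).
    { apply Rmult_lt_compat_l; nra. }
    replace (PI * (K + 1) * (eps / (PI * (K + 1)))) with eps in E by (field; lra).
    nra.
Qed.

Lemma RInt_FTC (f f' : R -> R) (a b : R) :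
  (forall x, is_derive f x (f' x)) -> (forall x, continuous f' x) ->
  RInt f' a b = f b - f a.
Proof.
  intros Hd Hc. apply (is_RInt_unique (V := R_CompleteNormedModule)).
  apply (is_RInt_derive f f'); auto.
Qed.

Lemma RInt_parts (f f' g g' : R -> R) (a b : R) :
  (forall x, is_derive f x (f' x)) -> (forall x, is_derive g x (g' x)) ->
  (forall x, continuous f' x) -> (forall x, continuous g' x) ->
  RInt (fun x => f x * g' x) a b
  = f b * g b - f a * g a - RInt (fun x => f' x * g x) a b.
Proof.
  intros Hf Hg Hf' Hg'.
  assert (Cf : forall x, continuous f x) by (intros; eapply continuous_derive; apply Hf).
  assert (Cg : forall x, continuous g x) by (intros; eapply continuous_derive; apply Hg).
  assert (C1 : forall x, continuous (fun x => f' x * g x) x)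
    by (intros; now apply continuous_Rmult).
  assert (C2 : forall x, continuous (fun x => f x * g' x) x)
    by (intros; now apply continuous_Rmult).
  assert (E : RInt (fun x => f' x * g x + f x * g' x) a b = f b * g b - f a * g a).
  { apply (RInt_FTC (fun x => f x * g x)).
    - intros x. apply (is_derive_Rmult f g); auto.
    - intros x. apply (continuous_Rplus (fun x => f' x * g x)); auto. }
  assert (E2 : RInt (fun x => f' x * g x + f x * g' x) a b
    = RInt (fun x => f' x * g x) a b + RInt (fun x => f x * g' x) a b).
  { apply (RInt_plus (V := R_CompleteNormedModule) (fun x => f' x * g x));
      now apply ex_RInt_cont. }
  lra.
Qed.

Lemma phi_orthonormal (i j : nat) :
  RInt (fun x => phi (S i) x * phi (S j) x) 0 PI = (if Nat.eqb i j then 1 else 0) :> R.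
Proof.
  pose proof PI_RGT_0 as Hpi. pose proof (INR_S_ge1 i) as Hi. pose proof (INR_S_ge1 j) as Hj.
  destruct (Nat.eqb_spec i j) as [->|Hij].
  - rewrite (RInt_FTC (fun x => / PI * (x - sin (INR (S j) * x) * cos (INR (S j) * x) / INR (S j)))).
    + rewrite sin_INR_PI, !Rmult_0_r, sin_0. field. lra.
    + intros x. unfold phi. revert Hj. clear Hi. generalize (INR (S j)) as y.
      intros y Hy. auto_derive; [lra|].
      replace (sqrt (2 / PI) * sin (y * x) * (sqrt (2 / PI) * sin (y * x)))
        with ((sqrt (2 / PI) * sqrt (2 / PI)) * (sin (y * x) * sin (y * x))) by ring.
      rewrite sqrt_2_PI_sqr. pose proof (sin2_cos2 (y * x)) as E. unfold Rsqr in E.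
      set (s := sin (y * x)) in *. set (c := cos (y * x)) in *.
      replace (2 / PI * (s * s)) with (/ PI * ((s * s + c * c) + s * s - c * c)) by (field; lra).
      rewrite E. field. lra.
    + intros x. apply continuous_Rmult; apply phi_cont.
  - assert (Hne : INR (S i) * INR (S i) - INR (S j) * INR (S j) <> 0).
    { intros E. apply Hij. apply INR_eq. rewrite !S_INR in *. nra. }
    rewrite (RInt_FTC (fun x => / (INR (S i) * INR (S i) - INR (S j) * INR (S j))
      * (INR (S j) * phi (S i) x * psi (S j) x - INR (S i) * psi (S i) x * phi (S j) x))).
    + rewrite !phi_at_0, !phi_at_PI. ring.
    + intros x. evar_last.
      * apply is_derive_scal.
        apply (is_derive_Rminus
          (fun x => INR (S j) * phi (S i) x * psi (S j) x)).
        -- apply (is_derive_Rmult (fun x => INR (S j) * phi (S i) x)).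
           ++ apply is_derive_scal, phi_derive.
           ++ apply psi_derive.
        -- apply (is_derive_Rmult (fun x => INR (S i) * psi (S i) x)).
           ++ apply is_derive_scal, psi_derive.
           ++ apply phi_derive.
      * unfold minus, plus, opp, mult; simpl. unfold mult; simpl. field. exact Hne.
    + intros x. apply continuous_Rmult; apply phi_cont.
Qed.

Lemma is_series_single (a : nat -> R) (k : nat) :
  (forall n, n <> k -> a n = 0) -> is_series a (a k).
Proof.
  intros H. assert (E : forall N, (k <= N)%nat -> sum_n a N = a k :> R).
  { assert (Z : forall N, (N < k)%nat -> sum_n a N = 0 :> R).
    { induction N as [|N IH]; intros HN; [rewrite sum_O; apply H; lia|].
      rewrite sum_n_SR, IH, H by lia. ring. }
    induction N as [|N IH]; intros HN.
    - replace k with 0%nat by lia. apply sum_O.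
    - destruct (Nat.eq_dec k (S N)) as [->|Hk].
      + rewrite sum_n_SR, Z by lia. ring.
      + rewrite sum_n_SR, IH, (H (S N)) by lia. ring. }
  apply (filterlim_ext_loc (fun _ => a k)).
  - exists k. intros N HN. symmetry. now apply E.
  - apply filterlim_const.
Qed.

(** Integration term by term, then orthonormality. *)
Lemma coef_unique (f : R -> R) (a : nat -> R) (k : nat) :
  ex_series (fun n => Rabs (a n)) ->
  (forall x, 0 <= x <= PI -> f x = Series (fun n => a n * phi (S n) x)) ->
  coef f k = a k.
Proof.
  intros Ha Hf. unfold coef. pose proof PI_RGT_0 as Hpi.
  rewrite (RInt_ext _ (fun x => Series (fun n => a n * phi (S n) x) * phi (S k) x)).
  2: { intros x. rewrite Rmin_left, Rmax_right by lra. intros Hx. rewrite Hf by lra. reflexivity. }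
  pose proof (RInt_Series a (fun n => phi (S n)) (phi (S k)) 1
    (fun n => phi_le1 (S n)) (fun n => phi_cont (S n)) Ha (phi_cont (S k))
    (fun x _ => phi_le1 (S k) x)) as H.
  rewrite <- (is_series_unique _ _ H).
  apply is_series_unique.
  replace (a k) with (a k * RInt (fun x => phi (S k) x * phi (S k) x) 0 PI).
  2: { rewrite phi_orthonormal, Nat.eqb_refl. ring. }
  apply (is_series_single (fun n => a n * RInt (fun x => phi (S n) x * phi (S k) x) 0 PI)).
  intros n Hn. rewrite phi_orthonormal. apply Nat.eqb_neq in Hn. rewrite Hn. ring.
Qed.

(** * The scale of weighted sequence spaces *)

Lemma INR_S_pos (n : nat) : 0 < INR (S n).
Proof. apply lt_0_INR. lia. Qed.

Lemma h_term_succ (r : R) (a : nat -> R) (n : nat) :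
  h_term (r + 1) a n = nn n * h_term r a n.
Proof.
  unfold h_term, nn. replace (2 * (r + 1)) with (2 * r + INR 2) by (simpl; ring).
  rewrite Rpower_plus, Rpower_pow by apply INR_S_pos. ring.
Qed.

Lemma h_term_0 (a : nat -> R) (n : nat) : h_term 0 a n = a n ^ 2.
Proof. unfold h_term. rewrite Rmult_0_r, Rpower_O by apply INR_S_pos. ring. Qed.

Lemma h_term_1 (a : nat -> R) (n : nat) : h_term 1 a n = nn n * a n ^ 2.
Proof. replace 1 with (0 + 1) by ring. now rewrite h_term_succ, h_term_0. Qed.

Lemma h_term_plus2 (s : R) (a : nat -> R) (n : nat) :
  h_term (s + 2) a n = nn n * nn n * h_term s a n.
Proof.
  replace (s + 2) with (s + 1 + 1) by ring. rewrite !h_term_succ. ring.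
Qed.

Lemma h_term_minus2 (s : R) (a : nat -> R) (n : nat) :
  h_term s a n = nn n * nn n * h_term (s - 2) a n.
Proof. rewrite <- h_term_plus2. f_equal. ring. Qed.

Lemma h_term_ge0 (r : R) (a : nat -> R) (n : nat) : 0 <= h_term r a n.
Proof.
  unfold h_term. apply Rmult_le_pos; [apply pow2_ge_0|]. left. apply exp_pos.
Qed.

Lemma Rpower_pos (x y : R) : 0 < Rpower x y.
Proof. apply exp_pos. Qed.

Lemma Series_le_of_h_norm (r : R) (a : nat -> R) (e : R) :
  in_h r a -> h_norm r a <= e -> Series (h_term r a) <= e ^ 2.
Proof.
  intros Ha Hn.
  assert (H0 : 0 <= Series (h_term r a)) by (apply Series_ge0; auto; apply h_term_ge0).
  unfold h_norm in Hn. rewrite <- (sqrt_sqrt (Series (h_term r a))) by auto.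
  pose proof (sqrt_pos (Series (h_term r a))). nra.
Qed.

(** By the mean value theorem a term is at most a difference of consecutive values
    of [x^(1-p) / (p-1)]. *)
Lemma ex_series_Rpower (p : R) : 1 < p -> ex_series (fun n => Rpower (INR (S n)) (- p)).
Proof.
  intros Hp. apply ex_series_bounded with (1 + / (p - 1)).
  - intros n. left. apply Rpower_pos.
  - intros N.
    cut (sum_n (fun n => Rpower (INR (S n)) (- p)) N
         <= 1 + / (p - 1) * (1 - Rpower (INR (S N)) (1 - p))).
    { intros H. eapply Rle_trans; [exact H|].
      assert (0 < / (p - 1)) by (apply Rinv_0_lt_compat; lra).
      pose proof (Rpower_pos (INR (S N)) (1 - p)). nra. }
    induction N as [|N IH].
    + rewrite sum_O. simpl INR. unfold Rpower. rewrite ln_1, !Rmult_0_r, exp_0. lra.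
    + rewrite sum_n_SR.
      set (x := INR (S N)) in *. replace (INR (S (S N))) with (x + 1) by (unfold x; now rewrite (S_INR (S N))).
      assert (Hx : 0 < x) by apply INR_S_pos.
      destruct (MVT_gen (fun y => Rpower y (1 - p)) x (x + 1)
        (fun y => (1 - p) * Rpower y (- p))) as [c [Hc E]].
      * intros y. rewrite Rmin_left by lra. intros Hy.
        unfold Rpower. auto_derive; [lra|].
        replace ((1 - p) * ln y) with (- p * ln y + ln y) by ring.
        rewrite exp_plus, exp_ln by lra. field. lra.
      * intros y. rewrite Rmin_left by lra. intros Hy. apply continuity_pt_filterlim.
        apply (continuous_derive (fun y => Rpower y (1 - p)) ((1 - p) * / y * Rpower y (1 - p)) y).
        unfold Rpower. auto_derive; [lra|]. ring.
      * rewrite Rmin_left, Rmax_right in Hc by lra.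
        assert (Hdec : Rpower (x + 1) (- p) <= Rpower c (- p)).
        { unfold Rpower.
          assert (Hl : ln c <= ln (x + 1)).
          { destruct (Rle_lt_or_eq_dec c (x + 1)) as [Hlt|Heq]; [lra| |rewrite Heq; lra].
            left. apply ln_increasing; lra. }
          destruct (Rle_lt_or_eq_dec (- p * ln (x + 1)) (- p * ln c)) as [Hlt|Heq]; [nra| |rewrite Heq; lra].
          left. now apply exp_increasing. }
        set (A := Rpower x (1 - p)) in *. set (B := Rpower (x + 1) (1 - p)) in *.
        set (C := Rpower (x + 1) (- p)) in *. set (C' := Rpower c (- p)) in *.
        assert (Hi : 0 < / (p - 1)) by (apply Rinv_0_lt_compat; lra).
        assert (Hd : C <= / (p - 1) * (A - B)).
        { replace (A - B) with ((p - 1) * C') by lra.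
          replace (/ (p - 1) * ((p - 1) * C')) with C' by (field; lra). exact Hdec. }
        lra.
Qed.

(** Cauchy-Schwarz in the form [2 |a| <= w a^2 + 1 / w]; the inverse weights
    [(n + 1)^(-2 s)] are summable exactly because [s > 1/2]. *)
Lemma in_h_l1 (s : R) (a : nat -> R) :
  s > 1 / 2 -> in_h s a -> ex_series (fun n => Rabs (a n)).
Proof.
  intros Hs Ha.
  apply ex_series_dom with (fun n => h_term s a n + Rpower (INR (S n)) (- (2 * s))).
  - intros n. rewrite Rabs_Rabsolu. unfold h_term.
    set (w := Rpower (INR (S n)) (2 * s)).
    rewrite Rpower_Ropp. fold w. assert (Hw : 0 < w) by apply Rpower_pos.
    assert (Hi : 0 < / w) by now apply Rinv_0_lt_compat.
    assert (Ew : w * / w = 1) by (field; lra).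
    rewrite <- (pow2_abs (a n)). set (y := Rabs (a n)). assert (0 <= y) by apply Rabs_pos.
    assert (0 <= (w * y - 1) ^ 2 * / w) by (apply Rmult_le_pos; [apply pow2_ge_0|lra]).
    replace ((w * y - 1) ^ 2 * / w) with (y ^ 2 * w - 2 * y + / w) in * by (field; lra). lra.
  - apply (ex_series_Rplus); auto. apply ex_series_Rpower. lra.
Qed.

Lemma in_h_ext (r : R) (a b : nat -> R) : (forall n, a n = b n) -> in_h r a -> in_h r b.
Proof.
  intros H. apply ex_series_ext. intros n. unfold h_term. now rewrite H.
Qed.

Lemma in_h_dom (r : R) (a b : nat -> R) (C : R) :
  (forall n, Rabs (a n) <= C * Rabs (b n)) -> in_h r b -> in_h r a.
Proof.
  intros H Hb. apply ex_series_pos_dom with (fun n => C ^ 2 * h_term r b n).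
  - intros n. split; [apply h_term_ge0|]. unfold h_term. rewrite <- Rmult_assoc.
    apply Rmult_le_compat_r; [left; apply Rpower_pos|].
    rewrite <- (pow2_abs (a n)), <- (pow2_abs (b n)), <- Rpow_mult_distr.
    apply pow_incr. split; [apply Rabs_pos|apply H].
  - now apply (ex_series_Rscal (C ^ 2)).
Qed.

Lemma in_h_plus (r : R) (a b : nat -> R) :
  in_h r a -> in_h r b -> in_h r (fun n => a n + b n).
Proof.
  intros Ha Hb. apply ex_series_pos_dom with (fun n => 2 * (h_term r a n + h_term r b n)).
  - intros n. split; [apply h_term_ge0|]. unfold h_term.
    pose proof (Rpower_pos (INR (S n)) (2 * r)). pose proof (pow2_ge_0 (a n - b n)). nra.
  - apply (ex_series_Rscal 2).
    now apply (ex_series_Rplus).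
Qed.

Lemma in_h_minus (r : R) (a b : nat -> R) :
  in_h r a -> in_h r b -> in_h r (fun n => a n - b n).
Proof.
  intros Ha Hb. apply (in_h_plus r a (fun n => - b n)); auto.
  apply in_h_dom with b 1; auto. intros n. rewrite Rabs_Ropp. lra.
Qed.

Lemma in_h_scal (r c : R) (a : nat -> R) : in_h r a -> in_h r (fun n => c * a n).
Proof.
  apply in_h_dom with (Rabs c). intros n. rewrite Rabs_mult. lra.
Qed.

Lemma in_h_nn (s : R) (a : nat -> R) : in_h (s + 2) a <-> in_h s (fun n => nn n * a n).
Proof.
  assert (E : forall n, h_term (s + 2) a n = h_term s (fun n => nn n * a n) n).
  { intros n. rewrite h_term_plus2. unfold h_term. ring. }
  split; apply ex_series_ext; intros n; [now rewrite E|now rewrite E].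
Qed.

Lemma in_h_minus2_nn (s : R) (a : nat -> R) : in_h (s - 2) a <-> in_h s (fun n => a n / nn n).
Proof.
  assert (E : forall n, h_term (s - 2) a n = h_term s (fun n => a n / nn n) n).
  { intros n. rewrite (h_term_minus2 s). unfold h_term. pose proof (nn_ge1 n). field. lra. }
  split; apply ex_series_ext; intros n; [now rewrite E|now rewrite E].
Qed.

Lemma in_h_weaken (s : R) (a : nat -> R) : in_h s a -> in_h (s - 2) a.
Proof.
  apply ex_series_pos_dom. intros n. split; [apply h_term_ge0|].
  rewrite (h_term_minus2 s). pose proof (nn_ge1 n). pose proof (h_term_ge0 (s - 2) a n).
  assert (1 <= nn n * nn n) by nra. nra.
Qed.

Lemma in_h_weaken2 (s : R) (a : nat -> R) : in_h (s + 2) a -> in_h s a.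
Proof. intros H. apply in_h_weaken in H. replace (s + 2 - 2) with s in H by ring. exact H. Qed.

(** * Derivatives of sine series and the weak pairing *)

Definition sine_series (a : nat -> R) (x : R) : R := Series (fun n => a n * phi (S n) x).
Definition sine_series' (a : nat -> R) (x : R) : R :=
  Series (fun n => a n * INR (S n) * psi (S n) x).
Definition sine_series'' (a : nat -> R) (x : R) : R :=
  Series (fun n => a n * INR (S n) * - INR (S n) * phi (S n) x).

Lemma l1_weights (a : nat -> R) : ex_series (fun n => nn n * Rabs (a n)) ->
  ex_series (fun n => Rabs (a n)) /\ ex_series (fun n => Rabs (a n * INR (S n))) /\
  ex_series (fun n => Rabs (a n * INR (S n) * - INR (S n))).
Proof.
  intros H.
  assert (Hb : forall n, 1 <= INR (S n) /\ 0 <= Rabs (a n))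
    by (intros n; split; [apply INR_S_ge1|apply Rabs_pos]).
  assert (Hp : forall n, Rabs (INR (S n)) = INR (S n))
    by (intros n; apply Rabs_pos_eq; destruct (Hb n); lra).
  split; [|split]; apply ex_series_pos_dom with (2 := H); intros n; destruct (Hb n);
    (split; [apply Rabs_pos|]); rewrite ?Rabs_mult, ?Rabs_Ropp, ?Hp; pose proof (nn_ge1 n);
    assert (INR (S n) <= nn n) by (unfold nn; nra);
    replace (INR (S n) * INR (S n)) with (nn n) by (unfold nn; ring); unfold nn in *; nra.
Qed.

Lemma sine_series_derive (a : nat -> R) (x : R) : ex_series (fun n => nn n * Rabs (a n)) ->
  is_derive (sine_series a) x (sine_series' a x).
Proof.
  intros H. destruct (l1_weights a H) as [H0 [H1 H2]].
  apply (Series_fun_derive a (fun n => INR (S n)) (fun n => phi (S n)) (fun n => psi (S n)));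
    auto using phi_le1, psi_le1, phi_derive.
Qed.

Lemma sine_series'_derive (a : nat -> R) (x : R) : ex_series (fun n => nn n * Rabs (a n)) ->
  is_derive (sine_series' a) x (sine_series'' a x).
Proof.
  intros H. destruct (l1_weights a H) as [H0 [H1 H2]].
  apply (Series_fun_derive (fun n => a n * INR (S n)) (fun n => - INR (S n))
    (fun n => psi (S n)) (fun n => phi (S n)));
    auto using phi_le1, psi_le1, psi_derive.
Qed.

Lemma sine_series'_cont (a : nat -> R) (x : R) : ex_series (fun n => nn n * Rabs (a n)) ->
  continuous (sine_series' a) x.
Proof. intros H. eapply continuous_derive. now apply sine_series'_derive. Qed.

Lemma Series_zero (a : nat -> R) : (forall n, a n = 0) -> Series a = 0.
Proof.
  intros H. rewrite (Series_ext a (fun n => 0 * 0)) by (intros; rewrite H; ring).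
  rewrite Series_scal_l. ring.
Qed.

Lemma sine_series_at_0 (a : nat -> R) : sine_series a 0 = 0.
Proof. apply Series_zero. intros n. rewrite phi_at_0. ring. Qed.

Lemma sine_series_at_PI (a : nat -> R) : sine_series a PI = 0.
Proof. apply Series_zero. intros n. rewrite phi_at_PI. ring. Qed.

Lemma bounded_on_0_PI (f : R -> R) : (forall x, continuous f x) ->
  exists K, forall x, 0 <= x <= PI -> Rabs (f x) <= K.
Proof.
  intros Hf. pose proof PI_RGT_0 as Hpi.
  destruct (continuity_ab_maj (fun x => Rabs (f x)) 0 PI) as [M [HM _]]; [lra| |].
  - intros x _. apply continuity_pt_filterlim.
    apply (continuous_comp f Rabs); [apply Hf|apply continuous_Rabs].
  - exists (Rabs (f M)). exact HM.
Qed.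

Lemma RInt_psi_parts (n : nat) (g g' : R -> R) :
  (forall x, is_derive g x (g' x)) -> (forall x, continuous g' x) -> g 0 = 0 -> g PI = 0 ->
  RInt (fun x => psi n x * g' x) 0 PI = INR n * RInt (fun x => g x * phi n x) 0 PI :> R.
Proof.
  intros Hg Hc H0 Hpi.
  rewrite (RInt_parts (psi n) (fun x => - INR n * phi n x) g g'); auto.
  - rewrite H0, Hpi.
    rewrite (RInt_ext (fun x => - INR n * phi n x * g x) (fun x => - INR n * (g x * phi n x)))
      by (intros; rring).
    rewrite (RInt_scal (V := R_CompleteNormedModule) (fun x => g x * phi n x)).
    + unfold scal; simpl; unfold mult; simpl. ring.
    + apply ex_RInt_cont. intros x. apply continuous_Rmult; [|apply phi_cont].
      eapply continuous_derive; apply Hg.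
  - apply psi_derive.
  - intros x. apply continuous_Rmult; [apply continuous_const|apply phi_cont].
Qed.

Lemma RInt_phi_parts (n : nat) (g g' : R -> R) :
  (forall x, is_derive g x (g' x)) -> (forall x, continuous g' x) ->
  RInt (fun x => phi n x * g' x) 0 PI = - INR n * RInt (fun x => psi n x * g x) 0 PI :> R.
Proof.
  intros Hg Hc.
  rewrite (RInt_parts (phi n) (fun x => INR n * psi n x) g g'); auto.
  - rewrite phi_at_0, phi_at_PI.
    rewrite (RInt_ext (fun x => INR n * psi n x * g x) (fun x => INR n * (psi n x * g x)))
      by (intros; rring).
    rewrite (RInt_scal (V := R_CompleteNormedModule) (fun x => psi n x * g x)).
    + unfold scal; simpl; unfold mult; simpl. ring.
    + apply ex_RInt_cont. intros x. apply continuous_Rmult; [apply psi_cont|].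
      eapply continuous_derive; apply Hg.
  - apply phi_derive.
  - intros x. apply continuous_Rmult; [apply continuous_const|apply psi_cont].
Qed.

(** Integrating the cosine series of the derivative against itself and moving the
    derivative back to [phi] reduces the identity to the definition of [coef]. *)
Lemma sine_series_parseval (a : nat -> R) : ex_series (fun n => nn n * Rabs (a n)) ->
  is_series (fun n => nn n * a n ^ 2) (RInt (fun x => sine_series' a x ^ 2) 0 PI).
Proof.
  intros H. destruct (l1_weights a H) as [H0 [H1 H2]].
  destruct (bounded_on_0_PI (sine_series' a)) as [K HK].
  { intros. now apply sine_series'_cont. }
  pose proof (RInt_Series (fun n => a n * INR (S n)) (fun n => psi (S n)) (sine_series' a) K
    (fun n => psi_le1 (S n)) (fun n => psi_cont (S n)) H1
    (fun x => sine_series'_cont a x H) HK) as E.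
  eapply is_series_ext in E.
  - rewrite (RInt_ext _ (fun x => sine_series' a x * sine_series' a x)); [exact E|].
    intros x _. rring.
  - intros n. cbv beta.
    rewrite (RInt_psi_parts (S n) (sine_series a) (sine_series' a)).
    + change (RInt (fun x => sine_series a x * phi (S n) x) 0 PI) with (coef (sine_series a) n).
      rewrite (coef_unique (sine_series a) a n); auto. unfold nn. rring.
    + intros. now apply sine_series_derive.
    + intros. now apply sine_series'_cont.
    + apply sine_series_at_0.
    + apply sine_series_at_PI.
Qed.

Lemma test_function_at_ends (eta : R -> R) : test_function eta ->
  smooth eta /\ eta 0 = 0 /\ eta PI = 0 /\ Derive eta 0 = 0 /\ Derive eta PI = 0.
Proof.
  intros [Hs [c [d [Hc [Hd Hsup]]]]]. split; [exact Hs|].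
  assert (Hz : forall x, x < c \/ d < x -> eta x = 0).
  { intros x Hx. destruct (Req_dec (eta x) 0) as [|Hn]; auto. apply Hsup in Hn. lra. }
  repeat split; try (apply Hz; lra).
  - rewrite (Derive_ext_loc eta (fun _ => 0)); [apply Derive_const|].
    exists (mkposreal c Hc). intros y Hy. change (Rabs (y - 0) < c) in Hy.
    apply Hz. apply Rabs_def2 in Hy. lra.
  - rewrite (Derive_ext_loc eta (fun _ => 0)); [apply Derive_const|].
    exists (mkposreal (PI - d) ltac:(lra)). intros y Hy. change (Rabs (y - PI) < PI - d) in Hy.
    apply Hz. apply Rabs_def2 in Hy. lra.
Qed.

Lemma smooth_cont (f : R -> R) (x : R) : smooth f -> continuous f x.
Proof. intros H. eapply continuous_derive. now apply smooth_is_derive. Qed.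

Lemma coef_test_derive2 (eta : R -> R) (n : nat) : test_function eta ->
  RInt (fun x => phi (S n) x * Derive_n eta 2 x) 0 PI = - nn n * coef eta n :> R.
Proof.
  intros He. destruct (test_function_at_ends eta He) as [Hs [H0 [H1 [D0 D1]]]].
  pose proof (smooth_Derive _ Hs) as Hs1. pose proof (smooth_Derive _ Hs1) as Hs2.
  change (Derive_n eta 2) with (Derive (Derive eta)).
  rewrite (RInt_phi_parts (S n) (Derive eta) (Derive (Derive eta))).
  - rewrite (RInt_psi_parts (S n) eta (Derive eta)); auto.
    + unfold coef, nn. rring.
    + intros; now apply smooth_is_derive.
    + intros; now apply smooth_cont.
  - intros; now apply smooth_is_derive.
  - intros; now apply smooth_cont.
Qed.

(** Both derivatives fall on the test function, so absolute summability of [a]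
    suffices.  Applied to [g n / nn n] it makes sense of the pairing with
    coefficients [g] that grow. *)
Lemma pairing_derive2 (a : nat -> R) (eta : R -> R) :
  ex_series (fun n => Rabs (a n)) -> test_function eta ->
  is_series (fun n => - (nn n * a n * coef eta n))
    (RInt (fun x => sine_series a x * Derive_n eta 2 x) 0 PI).
Proof.
  intros Ha He. destruct (test_function_at_ends eta He) as [Hs _].
  pose proof (smooth_Derive _ (smooth_Derive _ Hs)) as Hs2.
  destruct (bounded_on_0_PI (Derive_n eta 2)) as [K HK].
  { intros x. now apply (smooth_cont (Derive (Derive eta))). }
  pose proof (RInt_Series a (fun n => phi (S n)) (Derive_n eta 2) K
    (fun n => phi_le1 (S n)) (fun n => phi_cont (S n)) Ha
    (fun x => smooth_cont (Derive (Derive eta)) x Hs2) HK) as E.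
  revert E. apply is_series_ext. intros n. rewrite coef_test_derive2 by auto. rring.
Qed.

Lemma pairing_derive1 (a : nat -> R) (eta : R -> R) :
  ex_series (fun n => nn n * Rabs (a n)) -> test_function eta ->
  is_series (fun n => nn n * a n * coef eta n)
    (RInt (fun x => sine_series' a x * Derive eta x) 0 PI).
Proof.
  intros Ha He. destruct (test_function_at_ends eta He) as [Hs [H0 [H1 _]]].
  pose proof (smooth_Derive _ Hs) as Hs1.
  destruct (bounded_on_0_PI (Derive eta)) as [K HK].
  { intros x. now apply smooth_cont. }
  destruct (l1_weights a Ha) as [_ [Ha1 _]].
  pose proof (RInt_Series (fun n => a n * INR (S n)) (fun n => psi (S n)) (Derive eta) K
    (fun n => psi_le1 (S n)) (fun n => psi_cont (S n)) Ha1
    (fun x => smooth_cont (Derive eta) x Hs1) HK) as E.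
  revert E. apply is_series_ext. intros n.
  rewrite (RInt_psi_parts (S n) eta (Derive eta)); auto.
  - unfold coef, nn. rring.
  - intros; now apply smooth_is_derive.
  - intros; now apply smooth_cont.
Qed.

Lemma sine_series''_eq (a : nat -> R) (x : R) :
  sine_series'' a x = sine_series (fun n => - (nn n * a n)) x.
Proof. apply Series_ext. intros n. unfold nn. ring. Qed.

(** A distribution whose coefficients, divided by [nn], are summable and which
    vanishes on test functions is zero: the function with the divided coefficients
    is weakly affine on the interval and zero at both ends. *)
Lemma pairing_vanishes (g : nat -> R) :
  ex_series (fun n => Rabs (g n / nn n)) ->
  (forall eta, test_function eta -> Series (fun n => g n * coef eta n) = 0) ->
  forall n, g n = 0.
Proof.
  intros Hg Hz n. set (b := fun n => g n / nn n).
  assert (HG : forall x, 0 <= x <= PI -> sine_series b x = 0).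
  { apply weakly_affine_zero with (Series (fun n => Rabs (b n))).
    - intros x. apply (Series_fun_continuous b (fun n => phi (S n)));
        auto using phi_le1, phi_cont.
    - intros x. apply Series_abs_le; auto. apply (Rabs_term_le b (fun n => phi (S n)) x).
      auto using phi_le1.
    - apply sine_series_at_0.
    - apply sine_series_at_PI.
    - intros eta He. rewrite <- (is_series_unique _ _ (pairing_derive2 b eta Hg He)).
      rewrite Series_opp. rewrite (Series_ext _ (fun n => g n * coef eta n)).
      + rewrite Hz by auto. rring.
      + intros k. unfold b. pose proof (nn_ge1 k). field. lra. }
  pose proof (coef_unique (fun _ => 0) b n Hg (fun x Hx => eq_sym (HG x Hx))) as E1.
  assert (E0 : coef (fun _ => 0) n = 0).
  { apply (coef_unique (fun _ => 0) (fun _ => 0)).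
    - exists 0. apply (is_series_ext (fun n => (fun _ => 0) n)).
      + intros k. now rewrite Rabs_R0.
      + apply (is_series_single (fun _ => 0) 0%nat). auto.
    - intros x _. symmetry. apply Series_zero. intros; ring. }
  rewrite E0 in E1. unfold b in E1. pose proof (nn_ge1 n).
  assert (E2 : g n / nn n * nn n = 0) by (rewrite <- E1; ring).
  replace (g n / nn n * nn n) with (g n) in E2 by (field; lra). exact E2.
Qed.

(** * Picard-Lindelof in a weighted sup norm *)

(** Integration gains the factor [1 / K] on the weight [exp (K |t|)]. *)
Lemma RInt_exp_bound (g : R -> R) (C K t : R) :
  (forall x, continuous g x) ->
  (forall x, Rabs x <= Rabs t -> Rabs (g x) <= C * K * exp (K * Rabs x)) ->
  Rabs (RInt g 0 t) <= C * (exp (K * Rabs t) - 1).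
Proof.
  intros Hg Hb.
  assert (Hder : forall e x, is_derive (fun x => C * exp (e * K * x)) x (e * (C * K * exp (e * K * x)))).
  { intros e x. auto_derive; auto. ring. }
  assert (Hc : forall e x, continuous (fun x => e * (C * K * exp (e * K * x))) x).
  { intros e x. apply (continuous_derive _ (e * (C * K * (e * K * exp (e * K * x)))) x).
    auto_derive; auto. ring. }
  destruct (Rle_lt_dec 0 t) as [Ht|Ht].
  - replace (C * (exp (K * Rabs t) - 1))
      with (RInt (fun x => 1 * (C * K * exp (1 * K * x))) 0 t).
    2: { rewrite (RInt_FTC (fun x => C * exp (1 * K * x))) by auto.
         rewrite Rmult_0_r, exp_0, Rmult_1_l, Rabs_pos_eq by auto. rring. }
    apply (norm_RInt_le (V := R_NormedModule) g (fun x => 1 * (C * K * exp (1 * K * x))) 0 t); auto.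
    + intros x Hx. specialize (Hb x). rewrite !Rabs_pos_eq in Hb by lra.
      rewrite !Rmult_1_l. apply Hb. lra.
    + apply (RInt_correct g). now apply ex_RInt_cont.
    + apply (RInt_correct (V := R_CompleteNormedModule)). now apply ex_RInt_cont.
  - replace (C * (exp (K * Rabs t) - 1))
      with (RInt (fun x => -(1) * (-(1) * (C * K * exp (-(1) * K * x)))) t 0).
    2: { rewrite (RInt_FTC (fun x => -(1) * (C * exp (-(1) * K * x)))).
         - rewrite Rmult_0_r, exp_0, Rabs_left by auto.
           replace (- (1) * K * t) with (K * - t) by ring. rring.
         - intros x. now apply is_derive_scal.
         - intros x. apply continuous_Rmult; [apply continuous_const|apply Hc]. }
    rewrite <- (opp_RInt_swap g) by now apply ex_RInt_cont.
    unfold opp; simpl. rewrite Rabs_Ropp.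
    apply (norm_RInt_le (V := R_NormedModule) g
      (fun x => -(1) * (-(1) * (C * K * exp (-(1) * K * x)))) t 0); [lra| | |].
    + intros x Hx. specialize (Hb x). rewrite !Rabs_left1 in Hb by lra.
      replace (- (1) * K * x) with (K * - x) by ring.
      replace (-(1) * (-(1) * (C * K * exp (K * - x)))) with (C * K * exp (K * - x)) by ring.
      apply Hb. lra.
    + apply (RInt_correct g). now apply ex_RInt_cont.
    + apply (RInt_correct (V := R_CompleteNormedModule)). apply ex_RInt_cont.
      intros x. apply continuous_Rmult; [apply continuous_const|apply Hc].
Qed.

Lemma exp_mul_Rabs_le (K x T : R) : 0 <= K -> Rabs x <= T -> exp (K * Rabs x) <= exp (K * T).
Proof.
  intros HK Hx. destruct (Rle_lt_or_eq_dec (K * Rabs x) (K * T)) as [H|H].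
  - now apply Rmult_le_compat_l.
  - left. now apply exp_increasing.
  - rewrite H. lra.
Qed.

Lemma exp_Rabs_ge1 (K x : R) : 0 <= K -> 1 <= exp (K * Rabs x).
Proof.
  intros HK. rewrite <- exp_0.
  assert (H0 : 0 <= K * Rabs x) by (apply Rmult_le_pos; auto using Rabs_pos).
  destruct H0 as [H0|H0]; [left; now apply exp_increasing|rewrite <- H0; lra].
Qed.

Fixpoint picard_iter {I : Type} (f : R -> (I -> R) -> I -> R) (x0 : I -> R) (k : nat)
  (t : R) (i : I) : R :=
  match k with
  | O => x0 i
  | S k => x0 i + RInt (fun tau => f tau (picard_iter f x0 k tau) i) 0 t
  end.

Lemma continuous_plus_const (c : R) (f : R -> R) (x : R) :
  continuous f x -> continuous (fun x => c + f x) x.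
Proof.
  intros H. apply (continuous_Rplus (fun _ => c) f); auto.
  apply continuous_const.
Qed.

Lemma RInt_primitive_derive (g : R -> R) (t : R) : (forall x, continuous g x) ->
  is_derive (fun t => RInt g 0 t) t (g t).
Proof.
  intros Hg. apply (is_derive_RInt g (fun t => RInt g 0 t) 0).
  - apply filter_forall. intros y. apply (RInt_correct g). now apply ex_RInt_cont.
  - apply Hg.
Qed.

(** Differential equation for a family of scalars indexed by an arbitrary type,
    where [x] has size [r] if [|x i| <= M i * r] for every [i].  Linear growth makes
    the iterates global; the Lipschitz constant may depend on [r].  The pointwise
    weights [M] are what propagates regularity: each component stays comparable to
    its own weight.  Continuity of the field is only required along paths that obey
    the growth bound. *)
Lemma picard_lindelof {I : Type} (f : R -> (I -> R) -> I -> R) (M x0 : I -> R) (K : R) :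
  0 <= K -> (forall i, Rabs (x0 i) <= M i) ->
  (forall t x r, 0 <= r -> (forall i, Rabs (x i) <= M i * r) ->
     forall i, Rabs (f t x i) <= M i * r * K) ->
  (forall r, 0 <= r -> exists L, 0 <= L /\ forall t x y d, 0 <= d ->
     (forall i, Rabs (x i) <= M i * r) -> (forall i, Rabs (y i) <= M i * r) ->
     (forall i, Rabs (x i - y i) <= M i * d) ->
     forall i, Rabs (f t x i - f t y i) <= M i * d * L) ->
  (forall y : R -> I -> R, (forall i t, continuous (fun t => y t i) t) ->
     (forall t i, Rabs (y t i) <= M i * exp (K * Rabs t)) ->
     forall i t, continuous (fun t => f t (y t) i) t) ->
  exists y : R -> I -> R,
    (forall i, y 0 i = x0 i) /\
    (forall t i, Rabs (y t i) <= M i * exp (K * Rabs t)) /\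
    (forall t i, is_derive (fun t => y t i) t (f t (y t) i)).
Proof.
  intros HK Hx0 Hgrowth Hlip Hcont.
  assert (HM : forall i, 0 <= M i).
  { intros i. eapply Rle_trans; [apply Rabs_pos|apply Hx0]. }
  set (z := picard_iter f x0).
  assert (Hz : forall k, (forall i t, continuous (fun t => z k t i) t) /\
    (forall t i, Rabs (z k t i) <= M i * exp (K * Rabs t))).
  { induction k as [|k [IHc IHb]]; split.
    - intros i t. apply continuous_const.
    - intros t i. simpl. eapply Rle_trans; [apply Hx0|].
      rewrite <- (Rmult_1_r (M i)) at 1. apply Rmult_le_compat_l; auto.
      now apply exp_Rabs_ge1.
    - intros i t. simpl. apply continuous_plus_const.
      apply (continuous_derive _ (f t (z k t) i)).
      apply (RInt_primitive_derive (fun tau => f tau (z k tau) i)). now apply Hcont.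
    - intros t i. change (z (S k) t i) with (x0 i + RInt (fun tau => f tau (z k tau) i) 0 t).
      assert (Rabs (RInt (fun tau => f tau (z k tau) i) 0 t) <= M i * (exp (K * Rabs t) - 1)).
      { apply RInt_exp_bound; [now apply Hcont|]. intros x _.
        eapply Rle_trans; [apply (Hgrowth x (z k x) (exp (K * Rabs x)))|].
        - left; apply exp_pos.
        - apply IHb.
        - right. ring. }
      eapply Rle_trans; [apply Rabs_triang|]. specialize (Hx0 i).
      lra. }
  assert (Hzc : forall k i t, continuous (fun t => f t (z k t) i) t).
  { intros k. apply Hcont; apply Hz. }
  assert (Hcontr : forall T, 0 <= T -> exists A, 0 <= A /\ forall k t i, Rabs t <= T ->
    Rabs (z (S k) t i - z k t i) <= M i * A * (1 / 2) ^ k).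
  { intros T HT. destruct (Hlip (exp (K * T)) ltac:(left; apply exp_pos)) as [L [HL Hl]].
    (* With the weight exp (2 L |t|) each iteration halves the distance; D bounds the
       distance of the first two iterates on [-T, T]. *)
    set (D := 2 * exp (K * T)).
    assert (HD : 0 < D) by (pose proof (exp_pos (K * T)); unfold D; lra).
    assert (HT' : forall t k i, Rabs t <= T -> Rabs (z k t i) <= M i * exp (K * T)).
    { intros t k i Ht. eapply Rle_trans; [apply Hz|]. apply Rmult_le_compat_l; auto.
      now apply exp_mul_Rabs_le. }
    assert (Hk : forall k t i, Rabs t <= T ->
      Rabs (z (S k) t i - z k t i) <= M i * (D * (1 / 2) ^ k * exp (2 * L * Rabs t))).
    { induction k as [|k IH]; intros t i Ht.
      - eapply Rle_trans; [apply Rabs_triang|]. rewrite Rabs_Ropp.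
        pose proof (HT' t 1%nat i Ht). pose proof (HT' t 0%nat i Ht).
        pose proof (exp_Rabs_ge1 (2 * L) t ltac:(lra)) as H1.
        apply Rle_trans with (M i * (D * 1)); [unfold D; lra|].
        apply Rmult_le_compat_l; auto. simpl. nra.
      - set (C := M i * (D * (1 / 2) ^ S k)).
        assert (HC : 0 <= C).
        { apply Rmult_le_pos; auto. apply Rmult_le_pos; [lra|]. apply pow_le. lra. }
        assert (E : z (S (S k)) t i - z (S k) t i
          = RInt (fun tau => f tau (z (S k) tau) i - f tau (z k tau) i) 0 t).
        { rewrite (RInt_minus (V := R_CompleteNormedModule) (fun tau => f tau (z (S k) tau) i))
            by (apply ex_RInt_cont; auto).
          unfold z. unfold minus, plus, opp; simpl. ring. }
        rewrite E.
        eapply Rle_trans.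
        + apply (RInt_exp_bound _ C (2 * L)).
          * intros x. apply (continuous_Rminus
              (fun tau => f tau (z (S k) tau) i)); auto.
          * intros x Hx. assert (Hx' : Rabs x <= T) by lra.
            eapply Rle_trans.
            -- apply (Hl x (z (S k) x) (z k x) (D * (1 / 2) ^ k * exp (2 * L * Rabs x))).
               ++ pose proof (exp_pos (2 * L * Rabs x)).
                  assert (0 <= (1 / 2) ^ k) by (apply pow_le; lra).
                  apply Rmult_le_pos; [apply Rmult_le_pos|]; lra.
               ++ intros j. now apply HT'.
               ++ intros j. now apply HT'.
               ++ intros j. now apply IH.
            -- right. unfold C. simpl. field.
        + replace (M i * (D * (1 / 2) ^ S k * exp (2 * L * Rabs t)))
            with (C * exp (2 * L * Rabs t)) by (unfold C; ring). lra. }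
    exists (D * exp (2 * L * T)). split.
    { pose proof (exp_pos (2 * L * T)). nra. }
    intros k t i Ht. eapply Rle_trans; [now apply Hk|].
    rewrite (Rmult_assoc (M i) (D * exp (2 * L * T))). apply Rmult_le_compat_l; auto.
    pose proof (exp_mul_Rabs_le (2 * L) t T ltac:(lra) Ht) as He.
    assert (0 <= (1 / 2) ^ k) by (apply pow_le; lra).
    replace (D * exp (2 * L * T) * (1 / 2) ^ k) with (D * (1 / 2) ^ k * exp (2 * L * T)) by ring.
    apply Rmult_le_compat_l; auto. apply Rmult_le_pos; lra. }
  set (y := fun t i => real (Lim_seq (fun k => z k t i))).
  assert (Hy : forall t i T, Rabs t <= T -> forall A,
    (forall k t i, Rabs t <= T -> Rabs (z (S k) t i - z k t i) <= M i * A * (1 / 2) ^ k) ->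
    forall k, Rabs (z k t i - y t i) <= 2 * (M i * A) * (1 / 2) ^ k).
  { intros t i T HT A HA. apply (geometric_limit (fun k => z k t i)). intros k. now apply HA. }
  assert (Hyb : forall t i, Rabs (y t i) <= M i * exp (K * Rabs t)).
  { intros t i. destruct (Hcontr (Rabs t) (Rabs_pos t)) as [A [HA H0]].
    apply Rle_of_geometric with (2 * (M i * A)).
    { specialize (HM i). nra. }
    intros k. pose proof (Hy t i (Rabs t) (Rle_refl _) A H0 k) as H1.
    destruct (Hz k) as [_ H2]. specialize (H2 t i).
    replace (y t i) with (z k t i - (z k t i - y t i)) by ring.
    eapply Rle_trans; [apply Rabs_triang|]. rewrite Rabs_Ropp. lra. }
  assert (Hyc : forall i t, continuous (fun t => y t i) t).
  { intros i t. refine (filterlim_R_intro _ _ _ _). intros e He.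
    destruct (Hcontr (Rabs t + 1) ltac:(pose proof (Rabs_pos t); lra)) as [A [HA H0]].
    destruct (geometric_small (2 * (M i * A)) (e / 3)) as [k Hk]; [specialize (HM i); nra|lra|].
    specialize (Hk k (le_n k)).
    destruct (filterlim_R_elim (proj1 (Hz k) i t) (e / 3) ltac:(lra))
      as [d Hd].
    exists (mkposreal (Rmin d 1) ltac:(apply Rmin_glb_lt; [apply cond_pos|lra])).
    intros s Hs. change (Rabs (s - t) < Rmin d 1) in Hs.
    assert (Hs1 : Rabs (s - t) < d) by (eapply Rlt_le_trans; [exact Hs|apply Rmin_l]).
    assert (Hs2 : Rabs (s - t) < 1) by (eapply Rlt_le_trans; [exact Hs|apply Rmin_r]).
    specialize (Hd s Hs1). cbv beta in Hd.
    assert (HsT : Rabs s <= Rabs t + 1).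
    { replace s with (t + (s - t)) by ring. eapply Rle_trans; [apply Rabs_triang|]. lra. }
    pose proof (Hy s i _ HsT A H0 k) as E1.
    pose proof (Hy t i (Rabs t + 1) ltac:(lra) A H0 k) as E2.
    apply Rabs_le_between in E1. apply Rabs_le_between in E2. apply Rabs_def2 in Hd.
    apply Rabs_def1; lra. }
  assert (Hyf : forall i t, continuous (fun t => f t (y t) i) t) by now apply Hcont.
  assert (Hint : forall t i, y t i = x0 i + RInt (fun tau => f tau (y tau) i) 0 t).
  { intros t i. destruct (Hcontr (Rabs t) (Rabs_pos t)) as [A [HA H0]].
    destruct (Hlip (exp (K * Rabs t)) ltac:(left; apply exp_pos)) as [L [HL Hl]].
    assert (E : y t i - (x0 i + RInt (fun tau => f tau (y tau) i) 0 t) = 0); [|lra].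
    assert (HMA : 0 <= M i * A) by (apply Rmult_le_pos; auto).
    assert (He1 : 0 <= exp (1 * Rabs t) - 1) by (pose proof (exp_Rabs_ge1 1 t ltac:(lra)); lra).
    apply zero_of_geometric with
      (2 * (M i * A) + M i * (2 * A) * L * (exp (1 * Rabs t) - 1)).
    { assert (0 <= M i * (2 * A) * L) by (apply Rmult_le_pos; auto; lra).
      apply Rplus_le_le_0_compat; [lra|]. now apply Rmult_le_pos. }
    intros k.
    pose proof (Hy t i (Rabs t) (Rle_refl _) A H0 (S k)) as E1.
    assert (E2 : Rabs (RInt (fun tau => f tau (z k tau) i) 0 t
      - RInt (fun tau => f tau (y tau) i) 0 t)
      <= (M i * (2 * A * (1 / 2) ^ k) * L) * (exp (1 * Rabs t) - 1)).
    { replace (RInt (fun tau => f tau (z k tau) i) 0 t - RInt (fun tau => f tau (y tau) i) 0 t)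
        with (RInt (fun tau => f tau (z k tau) i - f tau (y tau) i) 0 t).
      2: { apply (RInt_minus (V := R_CompleteNormedModule) (fun tau => f tau (z k tau) i));
           apply ex_RInt_cont; auto. }
      assert (H2k : 0 <= 2 * A * (1 / 2) ^ k).
      { apply Rmult_le_pos; [lra|]. apply pow_le. lra. }
      apply RInt_exp_bound.
      - intros x. apply (continuous_Rminus (fun tau => f tau (z k tau) i)); auto.
      - intros x Hx.
        apply Rle_trans with (M i * (2 * A * (1 / 2) ^ k) * L).
        + apply Hl; auto.
          * intros j. eapply Rle_trans; [apply Hz|]. apply Rmult_le_compat_l; auto.
            now apply exp_mul_Rabs_le.
          * intros j. eapply Rle_trans; [apply Hyb|]. apply Rmult_le_compat_l; auto.
            now apply exp_mul_Rabs_le.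
          * intros j. eapply Rle_trans; [apply (Hy x j (Rabs t) Hx A H0 k)|]. right; ring.
        + rewrite Rmult_1_r.
          pose proof (exp_Rabs_ge1 1 x ltac:(lra)).
          assert (0 <= M i * (2 * A * (1 / 2) ^ k) * L).
          { apply Rmult_le_pos; auto. apply Rmult_le_pos; auto. }
          nra. }
    replace (y t i - (x0 i + RInt (fun tau => f tau (y tau) i) 0 t))
      with (- (z (S k) t i - y t i) + (RInt (fun tau => f tau (z k tau) i) 0 t
        - RInt (fun tau => f tau (y tau) i) 0 t)) by (unfold z; simpl; ring).
    eapply Rle_trans; [apply Rabs_triang|]. rewrite Rabs_Ropp.
    assert (0 <= (1 / 2) ^ k) by (apply pow_le; lra). simpl in E1.
    assert (2 * (M i * A) * (1 / 2 * (1 / 2) ^ k) <= 2 * (M i * A) * (1 / 2) ^ k) by nra.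
    replace ((2 * (M i * A) + M i * (2 * A) * L * (exp (1 * Rabs t) - 1)) * (1 / 2) ^ k)
      with (2 * (M i * A) * (1 / 2) ^ k
        + M i * (2 * A * (1 / 2) ^ k) * L * (exp (1 * Rabs t) - 1)) by ring.
    lra. }
  exists y. split; [|split]; auto.
  - intros i. rewrite Hint. rewrite (RInt_point (V := R_CompleteNormedModule)). apply Rplus_0_r.
  - intros t i. apply (is_derive_ext (fun t => x0 i + RInt (fun tau => f tau (y tau) i) 0 t)).
    + intros s. symmetry. apply Hint.
    + evar_last.
      * apply (is_derive_Rplus (fun _ => x0 i));
          [apply is_derive_const|].
        apply (RInt_primitive_derive (fun tau => f tau (y tau) i)). auto.
      * apply Rplus_0_l.
Qed.

(** * From weak solutions to modes *)

Lemma Hstar_l1 (s : R) (a : nat -> R) : s > 1 / 2 -> in_h (s + 2) a ->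
  ex_series (fun n => nn n * Rabs (a n)).
Proof.
  intros Hs Ha. apply in_h_nn in Ha. apply (in_h_l1 s) in Ha; auto.
  revert Ha. apply ex_series_ext. intros n. rewrite Rabs_mult, (Rabs_pos_eq (nn n)); auto.
  pose proof (nn_ge1 n). lra.
Qed.

Lemma Hstar_sine_series (s : R) (f : R -> R) (x : R) :
  in_Hstar s f -> 0 <= x <= PI -> f x = sine_series (coef f) x.
Proof. intros [_ H] Hx. symmetry. apply is_series_unique. now apply H. Qed.

Lemma locally_interior (x : R) : 0 < x < PI -> locally x (fun y => 0 <= y <= PI).
Proof.
  intros Hx. exists (mkposreal (Rmin x (PI - x)) ltac:(apply Rmin_glb_lt; lra)).
  intros y Hy. change (Rabs (y - x) < Rmin x (PI - x)) in Hy.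
  pose proof (Rmin_l x (PI - x)). pose proof (Rmin_r x (PI - x)).
  apply Rabs_def2 in Hy. lra.
Qed.

(** The values of [f] outside [[0, PI]] are arbitrary, so its derivatives are
    known in the open interval only. *)
Lemma interior_derivatives (f : R -> R) (a : nat -> R) (x : R) :
  ex_series (fun n => nn n * Rabs (a n)) ->
  (forall x, 0 <= x <= PI -> f x = sine_series a x) -> 0 < x < PI ->
  Derive f x = sine_series' a x /\ Derive_n f 2 x = sine_series'' a x.
Proof.
  intros Ha Hf Hx.
  assert (Hl : locally x (fun y => f y = sine_series a y)).
  { generalize (locally_interior x Hx). apply filter_imp. auto. }
  split.
  - rewrite (Derive_ext_loc _ _ _ Hl). apply is_derive_unique. now apply sine_series_derive.
  - rewrite (Derive_n_ext_loc _ _ 2 _ Hl). simpl.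
    rewrite (Derive_ext (Derive (sine_series a)) (sine_series' a)).
    + apply is_derive_unique. now apply sine_series'_derive.
    + intros y. apply is_derive_unique. now apply sine_series_derive.
Qed.

Lemma RInt_Derive_sqr (f : R -> R) (a : nat -> R) :
  ex_series (fun n => nn n * Rabs (a n)) ->
  (forall x, 0 <= x <= PI -> f x = sine_series a x) ->
  is_series (fun n => nn n * a n ^ 2) (RInt (fun y => Derive f y ^ 2) 0 PI).
Proof.
  intros Ha Hf. pose proof PI_RGT_0.
  rewrite (RInt_ext _ (fun x => sine_series' a x ^ 2)); [now apply sine_series_parseval|].
  intros x. rewrite Rmin_left, Rmax_right by lra. intros Hx.
  now rewrite (proj1 (interior_derivatives f a x Ha Hf Hx)).
Qed.

Lemma weak_form (f : R -> R) (a g : nat -> R) (kappa : R) (eta : R -> R) :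
  ex_series (fun n => nn n * Rabs (a n)) ->
  ex_series (fun n => Rabs (g n / nn n)) ->
  (forall x, 0 <= x <= PI -> f x = sine_series a x) ->
  test_function eta ->
  Series (fun n => g n * coef eta n)
  + RInt (fun x => Derive_n f 2 x * Derive_n eta 2 x + kappa * Derive f x * Derive eta x) 0 PI
  = Series (fun n => (g n + (nn n * nn n + kappa * nn n) * a n) * coef eta n).
Proof.
  intros Ha Hg Hf He. pose proof PI_RGT_0.
  destruct (test_function_at_ends eta He) as [Hs _].
  pose proof (smooth_Derive _ Hs) as Hs1. pose proof (smooth_Derive _ Hs1) as Hs2.
  assert (Hna : ex_series (fun n => Rabs (- (nn n * a n)))).
  { revert Ha. apply ex_series_ext. intros n.
    rewrite Rabs_Ropp, Rabs_mult, (Rabs_pos_eq (nn n)); auto. pose proof (nn_ge1 n). lra. }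
  pose proof (pairing_derive2 _ eta Hna He) as S2.
  pose proof (pairing_derive1 a eta Ha He) as S1.
  pose proof (pairing_derive2 _ eta Hg He) as S0.
  assert (E : RInt (fun x => Derive_n f 2 x * Derive_n eta 2 x + kappa * Derive f x * Derive eta x) 0 PI
    = RInt (fun x => sine_series (fun n => - (nn n * a n)) x * Derive_n eta 2 x) 0 PI
      + kappa * RInt (fun x => sine_series' a x * Derive eta x) 0 PI :> R).
  { assert (C1 : forall x, continuous (fun x => sine_series' a x * Derive eta x) x).
    { intros x. apply continuous_Rmult; [now apply sine_series'_cont|now apply smooth_cont]. }
    assert (C2 : forall x, continuous
      (fun x => sine_series (fun n => - (nn n * a n)) x * Derive_n eta 2 x) x).
    { intros x. apply continuous_Rmult.
      - apply (Series_fun_continuous _ (fun n => phi (S n))); auto using phi_le1, phi_cont.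
      - now apply (smooth_cont (Derive (Derive eta))). }
    rewrite <- (RInt_scal (V := R_CompleteNormedModule) (fun x => sine_series' a x * Derive eta x))
      by now apply ex_RInt_cont.
    rewrite <- (RInt_plus (V := R_CompleteNormedModule)
      (fun x => sine_series (fun n => - (nn n * a n)) x * Derive_n eta 2 x)).
    - apply RInt_ext. intros x. rewrite Rmin_left, Rmax_right by lra. intros Hx.
      destruct (interior_derivatives f a x Ha Hf Hx) as [E1 E2].
      rewrite E1, E2, sine_series''_eq. unfold plus, scal; simpl; unfold mult; simpl. ring.
    - now apply ex_RInt_cont.
    - apply ex_RInt_cont. intros x. now apply continuous_Rmult; [apply continuous_const|]. }
  rewrite E.
  assert (X0 : ex_series (fun n => g n * coef eta n)).
  { apply ex_series_ext with (fun n => (-1) * - (nn n * (g n / nn n) * coef eta n)).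
    - intros n. pose proof (nn_ge1 n). as_R.
      field. lra.
    - apply (ex_series_Rscal (-1)). eexists; exact S0. }
  rewrite <- (is_series_unique _ _ S2), <- (is_series_unique _ _ S1).
  rewrite <- Series_scal_l, <- Series_plus, <- Series_plus.
  - apply Series_ext. intros n. ring.
  - exact X0.
  - apply (ex_series_Rplus); [eexists; exact S2|].
    apply (ex_series_Rscal kappa). eexists; exact S1.
  - eexists; exact S2.
  - apply (ex_series_Rscal kappa). eexists; exact S1.
Qed.

Lemma Rbar_interval_locally (a b : Rbar) (t : R) : Rbar_lt a t -> Rbar_lt t b ->
  locally t (fun y : R => Rbar_lt a y /\ Rbar_lt y b).
Proof.
  intros Ha Hb. apply filter_and; [now apply open_Rbar_gt|now apply open_Rbar_lt].
Qed.

(** Convergence in the norm forces convergence of each coefficient. *)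
Lemma h_norm_coordinate (r : R) (a : nat -> R) (n : nat) (e : R) :
  in_h r a -> 0 <= e -> h_norm r a < e * sqrt (Rpower (INR (S n)) (2 * r)) -> Rabs (a n) < e.
Proof.
  intros Ha He Hn. apply Rnot_le_lt. intros Hle.
  assert (Hp := Rpower_pos (INR (S n)) (2 * r)).
  assert (H : e * sqrt (Rpower (INR (S n)) (2 * r)) <= h_norm r a); [|lra].
  unfold h_norm. rewrite <- (sqrt_Rsqr e) at 1 by auto.
  rewrite <- sqrt_mult_alt by apply Rle_0_sqr. apply sqrt_le_1_alt.
  apply Rle_trans with (h_term r a n).
  - unfold h_term. apply Rmult_le_compat_r; [lra|]. rewrite <- (pow2_abs (a n)).
    unfold Rsqr. nra.
  - apply Series_term_le; auto. apply h_term_ge0.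
Qed.

Lemma derive_h_coordinate (r : R) (a b : Rbar) (w w' : R -> nat -> R) :
  (forall t : R, Rbar_lt a t -> Rbar_lt t b -> in_h r (w t)) ->
  (forall t : R, Rbar_lt a t -> Rbar_lt t b -> in_h r (w' t)) ->
  derive_h r a b w w' ->
  forall (t : R) n, Rbar_lt a t -> Rbar_lt t b -> is_derive (fun t => w t n) t (w' t n).
Proof.
  intros Hw Hw' Hd t n Ha Hb. apply is_derive_quotient.
  refine (filterlim_R_intro _ _ _ _).
  intros e He. set (rho := sqrt (Rpower (INR (S n)) (2 * r))).
  assert (Hrho : 0 < rho) by apply sqrt_lt_R0, Rpower_pos.
  destruct (filterlim_R_elim (Hd t Ha Hb) (e * rho) ltac:(nra)) as [d1 H1].
  destruct (Rbar_interval_locally a b t Ha Hb) as [d2 H2].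
  exists (mkposreal (Rmin d1 d2) ltac:(apply Rmin_glb_lt; apply cond_pos)).
  intros k Hk Hk0. change (Rabs (k - 0) < Rmin d1 d2) in Hk.
  pose proof (Rmin_l d1 d2). pose proof (Rmin_r d1 d2).
  assert (Hk2 : Rabs (t + k - t) < d2) by (replace (t + k - t) with (k - 0) by ring; lra).
  specialize (H1 k ltac:(apply Rlt_le_trans with (1 := Hk); lra) Hk0).
  specialize (H2 (t + k) Hk2). rewrite Rminus_0_r in H1.
  apply (h_norm_coordinate r (fun n => (w (t + k) n - w t n) / k - w' t n)); [|lra|].
  - apply in_h_minus; [|now apply Hw'].
    apply in_h_ext with (fun n => / k * (w (t + k) n - w t n)).
    { intros j. unfold Rdiv. ring. }
    apply in_h_scal, in_h_minus; apply Hw; tauto.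
  - fold rho. rewrite Rabs_pos_eq in H1 by apply sqrt_pos. exact H1.
Qed.

Lemma l1_le_h_norm (s : R) (a : nat -> R) (e : R) :
  s > 1 / 2 -> in_h s a -> 0 < e -> h_norm s a <= e ->
  Series (fun n => Rabs (a n))
  <= e * (1 + Series (fun n => Rpower (INR (S n)) (- (2 * s)))).
Proof.
  intros Hs Ha He Hn.
  assert (Hz : ex_series (fun n => Rpower (INR (S n)) (- (2 * s)))) by (apply ex_series_Rpower; lra).
  pose proof (Series_le_of_h_norm s a e Ha Hn) as HS.
  (* Young's inequality with parameter e on each term. *)
  apply Rle_trans with (Series (fun n => / e * h_term s a n + e * Rpower (INR (S n)) (- (2 * s)))).
  - apply Series_le.
    + intros n. split; [apply Rabs_pos|]. unfold h_term.
      set (w := Rpower (INR (S n)) (2 * s)). rewrite Rpower_Ropp. fold w.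
      assert (Hw : 0 < w) by apply Rpower_pos. assert (Hi : 0 < / w) by now apply Rinv_0_lt_compat.
      assert (Hie : 0 < / e) by now apply Rinv_0_lt_compat.
      rewrite <- (pow2_abs (a n)). set (y := Rabs (a n)). assert (Hy : 0 <= y) by apply Rabs_pos.
      assert (Hq : 0 <= (w * y - e) ^ 2 * (/ w * / e)).
      { apply Rmult_le_pos; [apply pow2_ge_0|]. nra. }
      replace ((w * y - e) ^ 2 * (/ w * / e)) with (/ e * (y ^ 2 * w) - 2 * y + e * / w) in Hq
        by (field; lra).
      lra.
    + apply (ex_series_Rplus).
      * now apply (ex_series_Rscal (/ e)).
      * now apply (ex_series_Rscal e).
  - rewrite Series_plus.
    + rewrite !Series_scal_l.
      assert (/ e * Series (h_term s a) <= / e * e ^ 2).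
      { apply Rmult_le_compat_l; auto. left. now apply Rinv_0_lt_compat. }
      replace (/ e * e ^ 2) with e in * by (field; lra). lra.
    + now apply (ex_series_Rscal (/ e)).
    + now apply (ex_series_Rscal e).
Qed.

Lemma coef_ext (f g : R -> R) (n : nat) :
  (forall x, 0 <= x <= PI -> f x = g x) -> coef f n = coef g n.
Proof.
  intros H. unfold coef. apply RInt_ext. pose proof PI_RGT_0. intros x.
  rewrite Rmin_left, Rmax_right by lra. intros Hx. rewrite H by lra. reflexivity.
Qed.

(** The velocity is prescribed pointwise in [x], while [ut] is a derivative in the norm
    of [H^s].  For [s > 1/2] the latter dominates uniform convergence, so both
    give the same function, and [coef_unique] applies. *)
Lemma velocity_coef (s : R) (a b : Rbar) (u : R -> R -> R) (ut : R -> nat -> R) (v0 : R -> R) :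
  s > 1 / 2 -> Rbar_lt a 0 -> Rbar_lt 0 b ->
  (forall t : R, Rbar_lt a t -> Rbar_lt t b -> in_Hstar (s + 2) (u t)) ->
  in_h s (ut 0) ->
  derive_h s a b (fun t => coef (u t)) ut ->
  (forall x, 0 <= x <= PI -> is_derive (fun t => u t x) 0 (v0 x)) ->
  forall n, coef v0 n = ut 0 n.
Proof.
  intros Hs Ha Hb Hu Hut Hd Hv n.
  assert (Hl : ex_series (fun n => Rabs (ut 0 n))) by now apply (in_h_l1 s).
  apply coef_unique; auto. intros x Hx.
  rewrite <- (is_derive_unique _ _ _ (Hv x Hx)).
  apply is_derive_unique. apply is_derive_quotient.
  refine (filterlim_R_intro _ _ _ _).
  intros e He.
  assert (Hz : 0 <= Series (fun n => Rpower (INR (S n)) (- (2 * s)))).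
  { apply Series_ge0; [intros; left; apply Rpower_pos|]. apply ex_series_Rpower; lra. }
  set (Z := Series (fun n => Rpower (INR (S n)) (- (2 * s)))) in *.
  set (d := e / (2 * (1 + Z))).
  assert (Hd0 : 0 < d) by (apply Rdiv_lt_0_compat; lra).
  pose proof (filterlim_R_elim
    (Hd 0 Ha Hb) d Hd0) as [d1 H1].
  destruct (Rbar_interval_locally a b 0 Ha Hb) as [d2 H2].
  exists (mkposreal (Rmin d1 d2) ltac:(apply Rmin_glb_lt; apply cond_pos)).
  intros k Hk Hk0. change (Rabs (k - 0) < Rmin d1 d2) in Hk.
  assert (Hk1 : Rabs (k - 0) < d1) by (eapply Rlt_le_trans; [exact Hk|apply Rmin_l]).
  assert (Hk2 : Rabs (k - 0) < d2) by (eapply Rlt_le_trans; [exact Hk|apply Rmin_r]).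
  specialize (H1 k Hk1 Hk0). specialize (H2 k Hk2). rewrite Rminus_0_r in H1.
  rewrite Rplus_0_l in *.
  set (q := fun n => (coef (u k) n - coef (u 0) n) / k - ut 0 n) in *.
  pose proof (Hu k (proj1 H2) (proj2 H2)) as Huk. pose proof (Hu 0 Ha Hb) as Hu0.
  pose proof (in_h_weaken2 s) as Hw.
  assert (Hq : in_h s q).
  { apply in_h_minus; auto.
    apply in_h_ext with (fun n => / k * (coef (u k) n - coef (u 0) n)).
    { intros j. unfold Rdiv. ring. }
    apply in_h_scal, in_h_minus; apply Hw; [apply Huk|apply Hu0]. }
  rewrite Rabs_pos_eq in H1 by apply sqrt_pos.
  pose proof (l1_le_h_norm s q d Hs Hq Hd0 (Rlt_le _ _ H1)) as HL. fold Z in HL.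
  rewrite (Hstar_sine_series _ _ x Huk Hx), (Hstar_sine_series _ _ x Hu0 Hx).
  assert (Lk : ex_series (fun n => Rabs (coef (u k) n))) by (apply (in_h_l1 s); auto; apply Hw, Huk).
  assert (L0 : ex_series (fun n => Rabs (coef (u 0) n))) by (apply (in_h_l1 s); auto; apply Hw, Hu0).
  assert (Hphi : forall n x, Rabs (phi (S n) x) <= 1) by (intros; apply phi_le1).
  pose proof (ex_series_fun _ (fun n => phi (S n)) x Hphi Lk) as Ek.
  pose proof (ex_series_fun _ (fun n => phi (S n)) x Hphi L0) as E0.
  pose proof (ex_series_fun _ (fun n => phi (S n)) x Hphi Hl) as El.
  assert (E : (sine_series (coef (u k)) x - sine_series (coef (u 0)) x) / k
    - Series (fun n => ut 0 n * phi (S n) x) = Series (fun n => q n * phi (S n) x)).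
  { unfold sine_series, Rdiv. rewrite <- Series_minus by auto. rewrite <- Series_scal_r.
    rewrite <- Series_minus.
    - apply Series_ext. intros j. unfold q, Rdiv. ring.
    - apply (ex_series_scal_r (/ k)). now apply (ex_series_Rminus).
    - exact El. }
  rewrite E.
  apply Rle_lt_trans with (Series (fun n => Rabs (q n))).
  - apply Series_abs_le; [|now apply (in_h_l1 s)].
    apply (Rabs_term_le q (fun n => phi (S n)) x Hphi).
  - apply Rle_lt_trans with (1 := HL).
    replace (d * (1 + Z)) with (e / 2) by (unfold d; field; lra). lra.
Qed.

(** A continuous path is locally bounded, hence bounded on a compact interval; [sg]
    is a sign, which covers both directions of time. *)
Lemma C0_h_bounded (r : R) (a b : Rbar) (w : R -> nat -> R) (sg T : R) :
  Rabs sg = 1 -> C0_h r a b w ->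
  (forall t, 0 <= t <= T -> Rbar_lt a (sg * t) /\ Rbar_lt (sg * t) b) ->
  0 <= T ->
  exists D, forall t, 0 <= t <= T -> Series (h_term r (w (sg * t))) <= D.
Proof.
  intros Hsg HC Hin HT.
  set (N := fun t => Series (h_term r (w (sg * t)))).
  assert (Hloc : forall t, 0 <= t <= T -> exists d, 0 < d /\ forall x, 0 <= x <= T ->
    Rabs (x - t) < d -> N x <= 2 + 2 * N t).
  { intros t Ht. destruct (Hin t Ht) as [Ha Hb]. destruct (HC (sg * t) Ha Hb) as [Hw Hl].
    assert (HN0 : 0 <= N t) by (apply Series_ge0; auto; apply h_term_ge0).
    destruct (filterlim_R_elim
      Hl 1 Rlt_0_1) as [d Hd].
    exists d. split; [apply cond_pos|]. intros x Hx Hxt.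
    destruct (Req_dec x t) as [->|Hne]; [lra|].
    assert (Hb1 : Rabs (sg * x - sg * t) < d).
    { replace (sg * x - sg * t) with (sg * (x - t)) by ring. now rewrite Rabs_mult, Hsg, Rmult_1_l. }
    assert (Hne' : sg * x <> sg * t).
    { intros E. apply Hne. apply Rmult_eq_reg_l with sg; auto. intros H0. rewrite H0, Rabs_R0 in Hsg. lra. }
    specialize (Hd (sg * x) Hb1 Hne'). rewrite Rminus_0_r in Hd.
    set (dlt := fun n => w (sg * x) n - w (sg * t) n) in *.
    assert (Hwx : in_h r (w (sg * x))) by (apply HC; apply Hin; auto).
    assert (Hdl : in_h r dlt) by (apply in_h_minus; auto).
    assert (HS : Series (h_term r dlt) <= 1).
    { rewrite Rabs_pos_eq in Hd by apply sqrt_pos. rewrite <- (pow1 2).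
      apply Series_le_of_h_norm; auto. lra. }
    apply Rle_trans with (Series (fun n => 2 * h_term r dlt n + 2 * h_term r (w (sg * t)) n)).
    - apply Series_le.
      + intros n. split; [apply h_term_ge0|]. unfold h_term, dlt.
        pose proof (Rpower_pos (INR (S n)) (2 * r)).
        assert (w (sg * x) n ^ 2 <= 2 * (w (sg * x) n - w (sg * t) n) ^ 2 + 2 * w (sg * t) n ^ 2).
        { pose proof (pow2_ge_0 (w (sg * x) n - 2 * w (sg * t) n)). nra. }
        nra.
      + apply (ex_series_Rplus); now apply (ex_series_Rscal 2).
    - rewrite Series_plus by now apply (ex_series_Rscal 2).
      rewrite !Series_scal_l. unfold N. lra. }
  assert (Hpos : forall t, 0 <= t <= T -> 0 <= N t).
  { intros t Ht. apply Series_ge0; [apply h_term_ge0|]. apply HC; now apply Hin. }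
  cut (exists D, forall t, 0 <= t <= T -> N t <= D); [auto|].
  apply (continuous_induction T (fun t => exists D, forall x, 0 <= x <= t -> N x <= D)); [| | |lra].
  - exists (N 0). intros x Hx. replace x with 0 by lra. lra.
  - intros t Ht HQ. destruct (Hloc t ltac:(lra)) as [d [Hd Hdx]].
    set (t' := Rmax 0 (t - d / 2)).
    assert (0 <= t') by apply Rmax_l. assert (t - d / 2 <= t') by apply Rmax_r.
    assert (t' < t) by (apply Rmax_lub_lt; lra).
    destruct (HQ t' ltac:(lra)) as [D HD].
    exists (Rmax D (2 + 2 * N t)). intros x Hx. destruct (Rle_lt_dec x t').
    + eapply Rle_trans; [apply HD; lra|apply Rmax_l].
    + eapply Rle_trans; [apply Hdx; [lra|apply Rabs_def1; lra]|apply Rmax_r].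
  - intros t Ht HQ. destruct (Hloc t ltac:(lra)) as [d [Hd Hdx]].
    destruct (HQ t ltac:(lra)) as [D HD].
    exists (Rmin d (T - t)). split; [apply Rmin_glb_lt; lra|]. intros y Hy.
    assert (Rmin d (T - t) <= d) by apply Rmin_l. assert (Rmin d (T - t) <= T - t) by apply Rmin_r.
    exists (Rmax D (2 + 2 * N t)). intros x Hx. destruct (Rle_lt_dec x t).
    + eapply Rle_trans; [apply HD; lra|apply Rmax_l].
    + eapply Rle_trans; [apply Hdx; [lra|apply Rabs_def1; lra]|apply Rmax_r].
Qed.

(** One power of the weight controls the tail, as [nn] exceeds [N + 1] beyond
    index [N]. *)
Lemma Series_tail_weighted (b : nat -> R) (D : R) (N : nat) :
  (forall n, 0 <= b n) -> ex_series (fun n => nn n * b n) -> Series (fun n => nn n * b n) <= D ->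
  0 <= Series b - sum_n b N <= D / (INR N + 1).
Proof.
  intros Hb He HD.
  assert (Hp : forall n, 0 <= nn n * b n).
  { intros n. pose proof (nn_ge1 n). specialize (Hb n). nra. }
  assert (Hex : ex_series b).
  { apply ex_series_pos_dom with (2 := He). intros n. pose proof (nn_ge1 n). specialize (Hb n). nra. }
  rewrite (Series_tail b N Hex). split.
  - assert (0 <= Series (fun k => b (S N + k)%nat)); [|lra].
    apply Series_ge0; auto. now apply ex_series_tail.
  - replace (sum_n b N + Series (fun k => b (S N + k)%nat) - sum_n b N)
      with (Series (fun k => b (S N + k)%nat)) by ring.
    pose proof (pos_INR N) as HN.
    apply Rle_trans with (Series (fun k => / (INR N + 1) * (nn (S N + k) * b (S N + k)%nat))).
    + apply Series_le.
      * intros k. split; auto. specialize (Hb (S N + k)%nat).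
        set (y := b (S N + k)%nat) in *.
        assert (INR N + 1 <= nn (S N + k)).
        { unfold nn. replace (INR (S (S N + k))) with (INR N + INR k + 2).
          - pose proof (pos_INR k). nra.
          - rewrite S_INR, plus_INR, S_INR. ring. }
        apply Rmult_le_reg_l with (INR N + 1); [lra|].
        rewrite <- Rmult_assoc, Rinv_r, Rmult_1_l by lra. nra.
      * apply (ex_series_Rscal (/ (INR N + 1))).
        now apply (ex_series_tail (fun n => nn n * b n)).
    + rewrite Series_scal_l. unfold Rdiv. rewrite Rmult_comm.
      apply Rmult_le_compat_r; [left; apply Rinv_0_lt_compat; lra|].
      apply Rle_trans with (2 := HD).
      rewrite (Series_tail (fun n => nn n * b n) N He).
      pose proof (sum_n_Rge0 _ N Hp). lra.
Qed.

Lemma h_term_ge (s : R) (a : nat -> R) (n : nat) : 0 <= s -> a n ^ 2 <= h_term s a n.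
Proof.
  intros Hs. unfold h_term. pose proof (pow2_ge_0 (a n)).
  assert (1 <= Rpower (INR (S n)) (2 * s)); [|nra].
  rewrite <- (Rpower_O (INR (S n))) by apply INR_S_pos.
  apply Rle_Rpower; [apply INR_S_ge1|lra].
Qed.

Lemma nn2_le_h_term (s : R) (a : nat -> R) (n : nat) : 0 <= s ->
  nn n * (nn n * a n ^ 2) <= h_term (s + 2) a n.
Proof.
  intros Hs. rewrite h_term_plus2. pose proof (h_term_ge s a n Hs). pose proof (nn_ge1 n).
  rewrite <- Rmult_assoc. apply Rmult_le_compat_l; nra.
Qed.

(** Cauchy-Schwarz for the splitting [|a| = (k |a|) (1 / k)], with the sum of
    [1 / k^2] at most [7/4]. *)
Lemma l1_le_h1 (a : nat -> R) (e : R) : 0 < e ->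
  ex_series (fun n => nn n * a n ^ 2) -> Series (fun n => nn n * a n ^ 2) <= 3 * e ^ 2 ->
  forall N, sum_n (fun n => Rabs (a n)) N <= 55 / 24 * e.
Proof.
  intros He Hex HS N.
  assert (Hinv : forall N, sum_n (fun n => / nn n) (S N) <= 7 / 4 - / INR (S (S N))).
  { induction N0 as [|k IH].
    - rewrite sum_n_SR, sum_O. unfold nn. simpl. lra.
    - rewrite sum_n_SR. unfold nn at 2. rewrite (S_INR (S (S k))).
      set (x := INR (S (S k))) in *. assert (Hx : 1 <= x) by apply INR_S_ge1.
      assert (/ (x + 1) ^ 2 + / (x + 1) <= / x).
      { apply Rmult_le_reg_r with (x * (x + 1) ^ 2); [nra|].
        replace ((/ (x + 1) ^ 2 + / (x + 1)) * (x * (x + 1) ^ 2)) with (x + x * (x + 1)) by (field; lra).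
        replace (/ x * (x * (x + 1) ^ 2)) with ((x + 1) ^ 2) by (field; lra). nra. }
      lra. }
  assert (Hsum : sum_n (fun n => nn n * a n ^ 2) N <= 3 * e ^ 2).
  { eapply Rle_trans; [|exact HS]. apply sum_n_le_Series; auto.
    intros n. apply nn_sqr_ge0. }
  assert (Hi2 : sum_n (fun n => / nn n) N <= 7 / 4).
  { destruct N as [|k]; [rewrite sum_O; unfold nn; simpl; lra|].
    pose proof (Hinv k). assert (0 < / INR (S (S k))) by apply Rinv_0_lt_compat, INR_S_pos. lra. }
  (* Young's inequality with a parameter close to the optimal one for the bounds
     3 e^2 and 7/4. *)
  apply Rle_trans with (sum_n (fun n => 3 / (8 * e) * (nn n * a n ^ 2) + 2 * e / 3 * / nn n) N).
  - apply sum_n_Rle. intros n _. pose proof (nn_ge1 n) as Hn.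
    rewrite <- (pow2_abs (a n)). set (y := Rabs (a n)). set (x := nn n) in *.
    assert (Hq : 0 <= (3 * x * y - 4 * e) ^ 2 * / (24 * e * x)).
    { apply Rmult_le_pos; [apply pow2_ge_0|]. left. apply Rinv_0_lt_compat. nra. }
    replace ((3 * x * y - 4 * e) ^ 2 * / (24 * e * x))
      with (3 / (8 * e) * (x * y ^ 2) - y + 2 * e / 3 * / x) in Hq by (field; lra).
    lra.
  - rewrite sum_n_Rplus, !sum_n_Rmult_l.
    apply Rle_trans with (3 / (8 * e) * (3 * e ^ 2) + 2 * e / 3 * (7 / 4)).
    + apply Rplus_le_compat; apply Rmult_le_compat_l; auto.
      * left. apply Rdiv_lt_0_compat; lra.
      * lra.
    + right. field. lra.
Qed.

Lemma sine_series_sup (a : nat -> R) (e x : R) : 0 < e ->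
  ex_series (fun n => Rabs (a n)) ->
  ex_series (fun n => nn n * a n ^ 2) -> Series (fun n => nn n * a n ^ 2) <= 3 * e ^ 2 ->
  Rabs (sine_series a x) <= 2 * e.
Proof.
  intros He Hl Hex HS.
  pose proof (Series_le_bound _ _ (l1_le_h1 a e He Hex HS) Hl) as HL.
  pose proof sqrt_2_PI as Hs.
  assert (Hk : sqrt (2 / PI) <= 5 / 6).
  { apply Rnot_lt_le. intros Hlt. pose proof sqrt_2_PI_sqr as E.
    pose proof PI2_3_2. unfold PI2 in *.
    assert (2 / PI <= 2 / 3) by (apply Rmult_le_compat_l; [lra|]; apply Rinv_le_contravar; lra).
    nra. }
  apply Rle_trans with (Series (fun n => 5 / 6 * Rabs (a n))).
  - apply Series_abs_le; [|now apply (ex_series_Rscal (5 / 6))].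
    intros n. unfold phi. rewrite !Rabs_mult, (Rabs_pos_eq (sqrt _)) by lra.
    assert (Rabs (sin (INR (S n) * x)) <= 1) by (apply Rabs_le, SIN_bound).
    pose proof (Rabs_pos (a n)). pose proof (Rabs_pos (sin (INR (S n) * x))).
    assert (sqrt (2 / PI) * Rabs (sin (INR (S n) * x)) <= 5 / 6) by nra. nra.
  - rewrite Series_scal_l. lra.
Qed.

(** [|u|_1^2], which is also the integral of [u_x^2]. *)
Definition stretch (a : nat -> R) : R := Series (fun n => nn n * a n ^ 2).

Lemma stretch_ex (s : R) (a : nat -> R) : 0 <= s -> in_h (s + 2) a ->
  ex_series (fun n => nn n * (nn n * a n ^ 2)).
Proof.
  intros Hs. apply ex_series_pos_dom. intros n. split; [|now apply nn2_le_h_term].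
  pose proof (nn_ge1 n). apply Rmult_le_pos; [lra|apply nn_sqr_ge0].
Qed.

Lemma stretch_ex1 (s : R) (a : nat -> R) : 0 <= s -> in_h (s + 2) a ->
  ex_series (fun n => nn n * a n ^ 2).
Proof.
  intros Hs Ha. apply ex_series_pos_dom with (2 := stretch_ex s a Hs Ha).
  intros n. pose proof (nn_ge1 n). pose proof (nn_sqr_ge0 n (a n)). nra.
Qed.

Lemma in_h_quotient_l1 (s : R) (a : nat -> R) : s > 1 / 2 -> in_h (s - 2) a ->
  ex_series (fun n => Rabs (a n / nn n)).
Proof. intros Hs Ha. apply (in_h_l1 s); auto. now apply in_h_minus2_nn. Qed.

(** The residual [utt + (nn^2 + kappa nn) u] of the mode equations lies in
    [H^{s-2}] and pairs to zero with all test functions, so [pairing_vanishes]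
    applies to it. *)
Lemma modes_of_weak_solution (m s : R) (a b : Rbar) (u0 v0 : R -> R) (u : R -> R -> R) :
  s > 1 / 2 -> weak_solution m s a b u0 v0 u ->
  exists ut : R -> nat -> R,
    C0_h (s + 2) a b (fun t => coef (u t)) /\
    (forall n, coef (u 0) n = coef u0 n) /\ (forall n, ut 0 n = coef v0 n) /\
    (forall (t : R) n, Rbar_lt a t -> Rbar_lt t b ->
       is_derive (fun t => coef (u t) n) t (ut t n)) /\
    (forall (t : R) n, Rbar_lt a t -> Rbar_lt t b ->
       is_derive (fun t => ut t n) t
         (- (nn n * hh m n + cc * stretch (coef (u t)) * nn n) * coef (u t) n)).
Proof.
  intros Hs [Ha [Hb [Hu [Hu0 [Hv0 [ut [utt [CU [CV [CW [DU [DV Hweak]]]]]]]]]]]].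
  assert (Hut : forall t : R, Rbar_lt a t -> Rbar_lt t b -> in_h s (ut t))
    by (intros t H1 H2; now apply CV).
  assert (Hutt : forall t : R, Rbar_lt a t -> Rbar_lt t b -> in_h (s - 2) (utt t))
    by (intros t H1 H2; now apply CW).
  pose proof (in_h_weaken2 s) as Hw.
  exists ut. split; [exact CU|]. split; [|split; [|split]].
  - intros n. now apply coef_ext.
  - intros n. symmetry. apply (velocity_coef s a b u ut v0); auto.
  - intros t n H1 H2.
    apply (derive_h_coordinate s a b (fun t => coef (u t)) ut); auto.
    intros t' H1' H2'. apply Hw. now apply Hu.
  - intros t n H1 H2.
    assert (E : utt t n = - (nn n * hh m n + cc * stretch (coef (u t)) * nn n) * coef (u t) n).
    { pose proof (Hu t H1 H2) as Hut'.
      set (A := coef (u t)) in *.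
      assert (HA : ex_series (fun n => nn n * Rabs (A n))) by (apply (Hstar_l1 s); auto; apply Hut').
      assert (Hf : forall x, 0 <= x <= PI -> u t x = sine_series A x)
        by (intros; now apply (Hstar_sine_series (s + 2))).
      pose proof (RInt_Derive_sqr (u t) A HA Hf) as HP.
      assert (EP : RInt (fun y => Derive (u t) y ^ 2) 0 PI = stretch A)
        by (symmetry; now apply is_series_unique).
      set (kappa := m + cc * stretch A).
      assert (Hg : forall k, utt t k + (nn k * nn k + kappa * nn k) * A k = 0).
      { apply (pairing_vanishes (fun k => utt t k + (nn k * nn k + kappa * nn k) * A k)).
        - apply (in_h_quotient_l1 s); auto. apply in_h_plus; [now apply Hutt|].
          apply in_h_dom with (fun n => nn n * (nn n * A n)) (1 + Rabs kappa).
          + intros k. rewrite <- Rmult_assoc, !Rabs_mult.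
            pose proof (nn_ge1 k). rewrite <- Rmult_assoc. apply Rmult_le_compat_r; [apply Rabs_pos|].
            rewrite !(Rabs_pos_eq (nn k)) by lra.
            eapply Rle_trans; [apply Rabs_triang|]. rewrite !Rabs_mult, !(Rabs_pos_eq (nn k)) by lra.
            pose proof (Rabs_pos kappa). assert (nn k <= nn k * nn k) by nra. nra.
          + apply (in_h_nn (s - 2)). replace (s - 2 + 2) with s by ring. apply in_h_nn. apply Hut'.
        - intros eta He.
          rewrite <- (weak_form (u t) A (utt t) kappa eta HA
            (in_h_quotient_l1 s _ Hs (Hutt t H1 H2)) Hf He).
          specialize (Hweak eta He t H1 H2). rewrite EP in Hweak. exact Hweak. }
      specialize (Hg n). unfold kappa in Hg. unfold hh. lra. }
    rewrite <- E. apply (derive_h_coordinate (s - 2) a b ut utt); auto.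
    intros t' H1' H2'. apply in_h_weaken. auto.
Qed.

(** * The a priori bound *)

(** Compares [mu] with [1 + m], the lower bound of all the denominators [hh m j]. *)
Lemma mu_bounds (m : R) : m >= - (1 / 2) -> 0 < mu m <= 3 * (1 + m).
Proof.
  intros Hm. unfold mu.
  assert (H1 : 0 < sqrt (1 + m)) by (apply sqrt_lt_R0; lra).
  assert (H2 : 0 < sqrt (4 + m)) by (apply sqrt_lt_R0; lra).
  split; [apply Rmin_glb_lt; lra|].
  apply Rle_trans with (1 := Rmin_l _ _).
  pose proof (sqrt_sqrt (1 + m) ltac:(lra)) as E.
  set (w := sqrt (1 + m)) in *.
  assert (2 / 3 <= w) by (apply Rnot_lt_le; intros Hl; nra). nra.
Qed.

Lemma epsilon_ge0 (m : R) (u0 v0 : R -> R) : 0 <= epsilon m u0 v0.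
Proof. eapply Rle_trans; [|apply Rmax_l]. apply sqrt_pos. Qed.

Lemma epsilon_sqr (m : R) (u0 v0 : R -> R) : m >= - (1 / 2) ->
  epsilon m u0 v0 <= 8 / 100 * sqrt (mu m) -> epsilon m u0 v0 ^ 2 <= 64 / 10000 * mu m.
Proof.
  intros Hm He. pose proof (epsilon_ge0 m u0 v0). pose proof (mu_bounds m Hm).
  rewrite <- (sqrt_sqrt (mu m)) by lra. nra.
Qed.

Lemma initial_action (m s : R) (u0 v0 : R -> R) (N : nat) :
  m >= - (1 / 2) -> s > 1 / 2 -> in_Hstar (s + 2) u0 -> in_Hstar s v0 ->
  sum_n (fun j => action m j (coef u0 j) (coef v0 j)) N <= 2 * epsilon m u0 v0 ^ 2.
Proof.
  intros Hm Hs [Hu _] [Hv _].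
  set (e := epsilon m u0 v0). pose proof (epsilon_ge0 m u0 v0) as He. fold e in He.
  assert (Hu1 : Hstar_norm 1 u0 <= e) by apply Rmax_l.
  assert (Hv1 : Hstar_norm 0 v0 / sqrt (1 + m) <= e) by apply Rmax_r.
  assert (Hw : 0 < sqrt (1 + m)) by (apply sqrt_lt_R0; lra).
  pose proof (sqrt_sqrt (1 + m) ltac:(lra)) as Ew.
  assert (Xu : ex_series (h_term 1 (coef u0))).
  { apply ex_series_ext with (fun n => nn n * coef u0 n ^ 2); [intros; now rewrite h_term_1|].
    apply (stretch_ex1 s); auto. lra. }
  assert (Xv : ex_series (h_term 0 (coef v0))).
  { apply ex_series_pos_dom with (h_term s (coef v0)); auto.
    intros n. split; [apply h_term_ge0|]. rewrite h_term_0. apply h_term_ge. lra. }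
  assert (Su : Series (h_term 1 (coef u0)) <= e ^ 2) by now apply Series_le_of_h_norm.
  assert (Sv : Series (h_term 0 (coef v0)) <= e ^ 2 * (1 + m)).
  { rewrite <- Ew. replace (e ^ 2 * (sqrt (1 + m) * sqrt (1 + m))) with ((e * sqrt (1 + m)) ^ 2) by ring.
    apply Series_le_of_h_norm; auto.
    apply Rmult_le_compat_r with (r := sqrt (1 + m)) in Hv1; [|lra].
    unfold Rdiv in Hv1. rewrite Rmult_assoc, Rinv_l, Rmult_1_r in Hv1 by lra. exact Hv1. }
  apply Rle_trans with (sum_n (fun n => h_term 1 (coef u0) n + / (1 + m) * h_term 0 (coef v0) n) N).
  - apply sum_n_Rle. intros n _. rewrite h_term_1, h_term_0. unfold action.
    apply Rplus_le_compat_l. unfold Rdiv. rewrite Rmult_comm.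
    apply Rmult_le_compat_r; [apply pow2_ge_0|].
    apply Rinv_le_contravar; [lra|]. now apply hh_ge.
  - rewrite sum_n_Rplus, sum_n_Rmult_l.
    pose proof (sum_n_le_Series _ N (h_term_ge0 1 (coef u0)) Xu).
    pose proof (sum_n_le_Series _ N (h_term_ge0 0 (coef v0)) Xv).
    assert (/ (1 + m) * sum_n (h_term 0 (coef v0)) N <= / (1 + m) * (e ^ 2 * (1 + m))).
    { apply Rmult_le_compat_l; [left; apply Rinv_0_lt_compat; lra|lra]. }
    replace (/ (1 + m) * (e ^ 2 * (1 + m))) with (e ^ 2) in * by (field; lra). lra.
Qed.

(** [action_bound] needs a positive amplitude.  If [ep = 0] the window is the whole
    line, and any fixed time lies in the window of a small positive [e]. *)
Lemma bound_by_margin (ep M T delta : R) : 0 <= ep -> 0 < M -> ep ^ 2 <= 64 / 10000 * M ->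
  0 <= T -> T * ep ^ 4 <= 1 / 100 * M -> 0 < delta ->
  exists e, 0 < e /\ ep <= e <= ep + delta /\ e ^ 2 <= 64 / 10000 * M /\ T * e ^ 4 <= 1 / 100 * M.
Proof.
  intros H0 HM H2 HT H4 Hd. destruct H0 as [H0|H0].
  - exists ep. repeat split; auto; lra.
  - subst ep. set (e := Rmin (Rmin delta 1) (Rmin (64 / 10000 * M) (1 / 100 * M / (T + 1)))).
    assert (Hp : 0 < 1 / 100 * M / (T + 1)) by (apply Rdiv_lt_0_compat; lra).
    assert (He : 0 < e) by (unfold e; repeat apply Rmin_glb_lt; lra).
    assert (e <= delta) by (eapply Rle_trans; [apply Rmin_l|apply Rmin_l]).
    assert (E1 : e <= 1) by (eapply Rle_trans; [apply Rmin_l|apply Rmin_r]).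
    assert (E2 : e <= 64 / 10000 * M) by (eapply Rle_trans; [apply Rmin_r|apply Rmin_l]).
    assert (E3 : e <= 1 / 100 * M / (T + 1)) by (eapply Rle_trans; [apply Rmin_r|apply Rmin_r]).
    exists e. repeat split; try lra; [nra|].
    apply Rmult_le_compat_r with (r := T + 1) in E3; [|lra].
    replace (1 / 100 * M / (T + 1) * (T + 1)) with (1 / 100 * M) in E3 by (field; lra).
    assert (Q2 : e ^ 2 <= e) by nra. assert (Q4 : e ^ 4 <= e).
    { replace (e ^ 4) with (e ^ 2 * e ^ 2) by ring. assert (0 <= e ^ 2) by apply pow2_ge_0. nra. }
    nra.
Qed.

(** Backward times are reached by the symmetry [t -> - t], [V -> - V]. *)
Lemma stretch_bound (m s e : R) (u0 v0 : R -> R) (U V : R -> nat -> R) (Q : R -> R) (t D : R) :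
  m >= - (1 / 2) -> s > 1 / 2 -> in_Hstar (s + 2) u0 -> in_Hstar s v0 ->
  0 < e -> epsilon m u0 v0 <= e -> e ^ 2 <= 64 / 10000 * mu m -> Rabs t * e ^ 4 <= 1 / 100 * mu m ->
  (forall n, U 0 n = coef u0 n) -> (forall n, V 0 n = coef v0 n) ->
  (forall x n, Rmin 0 t <= x <= Rmax 0 t -> is_derive (fun x => U x n) x (V x n)) ->
  (forall x n, Rmin 0 t <= x <= Rmax 0 t ->
     is_derive (fun x => V x n) x (- (nn n * hh m n + Q x * nn n) * U x n)) ->
  (forall x, Rmin 0 t <= x <= Rmax 0 t -> stretch (U x) <= 3 * e ^ 2 -> Q x = cc * stretch (U x)) ->
  (forall x, Rmin 0 t <= x <= Rmax 0 t -> in_h (s + 2) (U x) /\ Series (h_term (s + 2) (U x)) <= D) ->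
  stretch (U t) <= 3 * e ^ 2.
Proof.
  intros Hm Hs Hu0 Hv0 He Hep He2 HT HU0 HV0 HU HV HQ HD.
  assert (Hsg : exists sg, sg * sg = 1 /\ sg * Rabs t = t /\
    forall x, 0 <= x <= Rabs t -> Rmin 0 t <= sg * x <= Rmax 0 t).
  { destruct (Rle_lt_dec 0 t) as [Ht|Ht].
    - exists 1. rewrite Rabs_pos_eq, Rmin_left, Rmax_right by lra. repeat split; lra.
    - exists (-1). rewrite Rabs_left, Rmin_right, Rmax_left by lra. repeat split; lra. }
  destruct Hsg as [sg [Hsq [Hst Hsx]]].
  pose proof (Rabs_pos t) as Ht0.
  pose proof (action_bound m e (mu m) (Rabs t) D
    (fun j x => U (sg * x) j) (fun j x => sg * V (sg * x) j)
    (fun x => stretch (U (sg * x))) (fun x => Q (sg * x)) Hm He (mu_bounds m Hm) He2 Ht0 HT) as HB.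
  rewrite <- Hst. apply HB; [| | | | |lra].
  - intros j x Hx. evar_last.
    + apply (is_derive_comp (fun y => U y j) (fun x => sg * x)); [apply HU; auto|].
      auto_derive; auto.
    + unfold scal; simpl; unfold mult; simpl. ring.
  - intros j x Hx. evar_last.
    + apply is_derive_scal.
      apply (is_derive_comp (fun y => V y j) (fun x => sg * x)); [apply HV; auto|].
      auto_derive; auto.
    + unfold scal; simpl; unfold mult; simpl.
      transitivity ((sg * sg) * (- (nn j * hh m j + Q (sg * x) * nn j) * U (sg * x) j)); [ring|].
      rewrite Hsq. ring.
  - intros x Hx. apply HQ. auto.
  - intros x N Hx. destruct (HD (sg * x) (Hsx x Hx)) as [Hin HDx].
    apply (Series_tail_weighted (fun j => nn j * U (sg * x) j ^ 2)).
    + intros n. apply nn_sqr_ge0.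
    + apply (stretch_ex s); auto. lra.
    + eapply Rle_trans; [|exact HDx]. apply Series_le; auto.
      intros n. split; [|apply nn2_le_h_term; lra].
      pose proof (nn_ge1 n). apply Rmult_le_pos; [lra|apply nn_sqr_ge0].
  - intros N. rewrite Rmult_0_r.
    apply Rle_trans with (2 * epsilon m u0 v0 ^ 2).
    + rewrite (sum_n_Rext _ (fun j => action m j (coef u0 j) (coef v0 j))).
      * now apply (initial_action m s).
      * intros j. rewrite HU0, HV0. unfold action.
        replace ((sg * coef v0 j) ^ 2) with ((sg * sg) * coef v0 j ^ 2) by ring.
        now rewrite Hsq, Rmult_1_l.
    + pose proof (epsilon_ge0 m u0 v0). nra.
Qed.

Lemma weak_solution_bound (m s : R) (a b : Rbar) (u0 v0 : R -> R) (u : R -> R -> R) (t x : R) :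
  m >= - (1 / 2) -> s > 1 / 2 -> in_Hstar (s + 2) u0 -> in_Hstar s v0 ->
  epsilon m u0 v0 <= 8 / 100 * sqrt (mu m) ->
  weak_solution m s a b u0 v0 u -> Rbar_lt a t -> Rbar_lt t b ->
  Rabs t * epsilon m u0 v0 ^ 4 <= 1 / 100 * mu m -> 0 <= x <= PI ->
  Rabs (u t x) <= 2 * epsilon m u0 v0.
Proof.
  intros Hm Hs Hu0 Hv0 Heps Hw Ha Hb HT Hx.
  destruct (modes_of_weak_solution m s a b u0 v0 u Hs Hw) as [ut [CU [HU0 [HV0 [DU DV]]]]].
  destruct Hw as [Ha0 [Hb0 [Hu _]]].
  assert (Hin : forall y, Rmin 0 t <= y <= Rmax 0 t -> Rbar_lt a y /\ Rbar_lt y b).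
  { intros y [Hy1 Hy2]. split.
    - apply Rbar_lt_le_trans with (Finite (Rmin 0 t)); [|exact Hy1].
      unfold Rmin. destruct (Rle_dec 0 t); assumption.
    - apply Rbar_le_lt_trans with (Finite (Rmax 0 t)); [exact Hy2|].
      unfold Rmax. destruct (Rle_dec 0 t); assumption. }
  assert (HD : exists D, forall y, Rmin 0 t <= y <= Rmax 0 t ->
    Series (h_term (s + 2) (coef (u y))) <= D).
  { destruct (Rle_lt_dec 0 t) as [Ht|Ht].
    - destruct (C0_h_bounded (s + 2) a b (fun t => coef (u t)) 1 t) as [D HD]; auto.
      + apply Rabs_R1.
      + intros y Hy. rewrite Rmult_1_l. apply Hin. rewrite Rmin_left, Rmax_right; lra.
      + exists D. intros y. rewrite Rmin_left, Rmax_right by lra. intros Hy.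
        specialize (HD y Hy). now rewrite Rmult_1_l in HD.
    - destruct (C0_h_bounded (s + 2) a b (fun t => coef (u t)) (-1) (- t)) as [D HD]; auto.
      + rewrite Rabs_left; lra.
      + intros y Hy. apply Hin. rewrite Rmin_right, Rmax_left; lra.
      + lra.
      + exists D. intros y. rewrite Rmin_right, Rmax_left by lra. intros Hy.
        specialize (HD (- y) ltac:(lra)). now replace (-1 * - y) with y in HD by ring. }
  destruct HD as [D HD].
  apply le_epsilon. intros delta Hdelta.
  destruct (bound_by_margin (epsilon m u0 v0) (mu m) (Rabs t) (delta / 2)) as [e [He [Hee [He2 He4]]]];
    auto using epsilon_ge0, epsilon_sqr, Rabs_pos; [apply mu_bounds; auto|lra|].
  assert (HS : stretch (coef (u t)) <= 3 * e ^ 2).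
  { apply (stretch_bound m s e u0 v0 (fun t => coef (u t)) ut
      (fun t => cc * stretch (coef (u t))) t D); auto; try lra.
    - intros y n Hy. apply DU; now apply Hin.
    - intros y n Hy. apply DV; now apply Hin.
    - intros y Hy. split; [|now apply HD]. apply Hu; now apply Hin. }
  pose proof (Hu t Ha Hb) as Hut.
  rewrite (Hstar_sine_series _ _ x Hut Hx).
  apply Rle_trans with (2 * e); [|lra].
  assert (H1 : ex_series (fun n => nn n * Rabs (coef (u t) n))) by (apply (Hstar_l1 s); auto; apply Hut).
  apply sine_series_sup; auto.
  - now apply l1_weights.
  - apply (stretch_ex1 s); [lra|apply Hut].
Qed.

(** * Paths in the scale built from their modes *)

Lemma h_norm_tendsto_0 {T} (F : (T -> Prop) -> Prop) {FF : ProperFilter F} (r : R)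
  (w : T -> nat -> R) (X : nat -> R) :
  in_h r X -> F (fun k => forall n, Rabs (w k n) <= X n) ->
  (forall n, filterlim (fun k => w k n) F (locally 0)) ->
  filterlim (fun k => h_norm r (w k)) F (locally 0).
Proof.
  intros HX Hd Hl.
  assert (H : filterlim (fun k => Series (fun n => h_term r (w k) n)) F
    (locally (Series (fun n => 0)))).
  { apply (tannery F (fun n k => h_term r (w k) n) (fun _ => 0) (h_term r X)); auto.
    - revert Hd. apply filter_imp. intros k Hk n. specialize (Hk n).
      rewrite Rabs_pos_eq by apply h_term_ge0. unfold h_term.
      apply Rmult_le_compat_r; [left; apply Rpower_pos|].
      rewrite <- (pow2_abs (w k n)). apply pow_incr. split; [apply Rabs_pos|exact Hk].
    - intros n. refine (filterlim_R_intro _ _ _ _). intros e He.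
      set (rho := Rpower (INR (S n)) (2 * r)).
      assert (Hrho : 0 < rho) by apply Rpower_pos.
      assert (Hs : 0 < sqrt (e / rho)) by (apply sqrt_lt_R0, Rdiv_lt_0_compat; lra).
      generalize (filterlim_R_elim (Hl n) _ Hs). apply filter_imp.
      intros k Hk. rewrite Rminus_0_r in *. rewrite Rabs_pos_eq by apply h_term_ge0.
      unfold h_term. fold rho. rewrite <- (pow2_abs (w k n)).
      set (y := Rabs (w k n)) in *. assert (0 <= y) by apply Rabs_pos.
      apply Rlt_le_trans with (sqrt (e / rho) ^ 2 * rho).
      + apply Rmult_lt_compat_r; auto. nra.
      + rewrite pow2_sqrt by (left; apply Rdiv_lt_0_compat; lra). right. field. lra. }
  rewrite (Series_zero (fun _ => 0)) in H by auto.
  refine (filterlim_R_intro _ _ _ _). intros e He.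
  generalize (filterlim_R_elim H (e * e) ltac:(nra)). apply filter_imp.
  intros k Hk. rewrite Rminus_0_r in *. unfold h_norm. rewrite Rabs_pos_eq by apply sqrt_pos.
  apply Rle_lt_trans with (sqrt (Rabs (Series (h_term r (w k))))).
  - apply sqrt_le_1_alt, Rle_abs.
  - rewrite <- (sqrt_Rsqr e) by lra. apply sqrt_lt_1_alt. split; [apply Rabs_pos|exact Hk].
Qed.

Lemma dominated_nonneg (w : R -> nat -> R) (K : R) (X : nat -> R) :
  (forall t n, Rabs (w t n) <= exp (K * Rabs t) * X n) -> forall n, 0 <= X n.
Proof.
  intros Hb n. specialize (Hb 0 n). rewrite Rabs_R0, Rmult_0_r, exp_0, Rmult_1_l in Hb.
  eapply Rle_trans; [apply Rabs_pos|exact Hb].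
Qed.

Lemma exp_near (K t x : R) : 0 <= K -> Rabs (x - t) < 1 ->
  exp (K * Rabs x) <= exp (K * (Rabs t + 1)).
Proof.
  intros HK Hx. apply exp_mul_Rabs_le; auto.
  replace x with (t + (x - t)) by ring. eapply Rle_trans; [apply Rabs_triang|]. lra.
Qed.

Lemma C0_h_of_modes (r K : R) (a b : Rbar) (w : R -> nat -> R) (X : nat -> R) :
  0 <= K -> in_h r X -> (forall n t, continuous (fun t => w t n) t) ->
  (forall t n, Rabs (w t n) <= exp (K * Rabs t) * X n) ->
  C0_h r a b w.
Proof.
  intros HK HX Hc Hb t _ _.
  pose proof (dominated_nonneg _ _ _ Hb) as HX0.
  split.
  - apply in_h_dom with X (exp (K * Rabs t)); auto. intros n.
    rewrite (Rabs_pos_eq (X n)); auto.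
  - apply (h_norm_tendsto_0 (locally' t) (FF := Rbar_locally'_filter t) r
      (fun tau n => w tau n - w t n) (fun n => 2 * exp (K * (Rabs t + 1)) * X n)).
    + now apply in_h_scal.
    + exists (mkposreal 1 Rlt_0_1). intros x Hx _ n. change (Rabs (x - t) < 1) in Hx.
      pose proof (exp_near K t x HK Hx) as E1.
      assert (E2 : exp (K * Rabs t) <= exp (K * (Rabs t + 1))).
      { apply exp_near; auto. rewrite Rminus_diag, Rabs_R0. lra. }
      pose proof (Hb x n) as B1. pose proof (Hb t n) as B2. specialize (HX0 n).
      eapply Rle_trans; [apply Rabs_triang|]. rewrite Rabs_Ropp. nra.
    + intros n. refine (filterlim_R_intro _ _ _ _).
      intros e He.
      destruct (filterlim_R_elim (Hc n t) e He) as [d Hd].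
      exists d. intros x Hx _. rewrite Rminus_0_r. now apply Hd.
Qed.

Lemma derive_h_of_modes (r K : R) (a b : Rbar) (w w' : R -> nat -> R) (X : nat -> R) :
  0 <= K -> in_h r X -> (forall n t, is_derive (fun t => w t n) t (w' t n)) ->
  (forall t n, Rabs (w' t n) <= exp (K * Rabs t) * X n) ->
  derive_h r a b w w'.
Proof.
  intros HK HX Hd Hb t _ _.
  pose proof (dominated_nonneg _ _ _ Hb) as HX0.
  assert (E2 : exp (K * Rabs t) <= exp (K * (Rabs t + 1))).
  { apply exp_near; auto. rewrite Rminus_diag, Rabs_R0. lra. }
  apply (h_norm_tendsto_0 (locally' 0) (FF := Rbar_locally'_filter 0) r
    (fun k n => (w (t + k) n - w t n) / k - w' t n) (fun n => 2 * exp (K * (Rabs t + 1)) * X n)).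
  - now apply in_h_scal.
  - exists (mkposreal 1 Rlt_0_1). intros k Hk Hk0 n. change (Rabs (k - 0) < 1) in Hk.
    rewrite Rminus_0_r in Hk. specialize (HX0 n).
    assert (B1 : Rabs ((w (t + k) n - w t n) / k) <= exp (K * (Rabs t + 1)) * X n).
    { apply (quotient_le (fun t => w t n) (fun t => w' t n) t 1); auto.
      intros y Hy. eapply Rle_trans; [apply Hb|]. apply Rmult_le_compat_r; auto.
      now apply exp_near. }
    pose proof (Hb t n) as B2.
    eapply Rle_trans; [apply Rabs_triang|]. rewrite Rabs_Ropp. nra.
  - intros n. refine (filterlim_R_intro _ _ _ _).
    intros e He.
    generalize (filterlim_R_elim
      (proj1 (is_derive_quotient _ _ _) (Hd n t)) e He).
    apply (filter_imp (Filter := locally'_filter 0)). intros k Hk. now rewrite Rminus_0_r.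
Qed.

(** [X] and [Y] dominate the modes up to a factor that depends on time only, so that
    continuity and differentiability in the norms follow from those of each
    coefficient by dominated convergence. *)
Lemma weak_solution_of_modes (m s K C : R) (a b : Rbar) (u0 v0 : R -> R)
  (U V : R -> nat -> R) (Q : R -> R) (X Y : nat -> R) :
  s > 1 / 2 -> 0 <= K -> in_Hstar (s + 2) u0 -> in_Hstar s v0 ->
  in_h (s + 2) X -> in_h s Y ->
  (forall n, U 0 n = coef u0 n) -> (forall n, V 0 n = coef v0 n) ->
  (forall t n, Rabs (U t n) <= exp (K * Rabs t) * X n) ->
  (forall t n, Rabs (V t n) <= exp (K * Rabs t) * Y n) ->
  (forall n t, is_derive (fun t => U t n) t (V t n)) ->
  (forall n t, is_derive (fun t => V t n) t (- (nn n * hh m n + Q t * nn n) * U t n)) ->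
  (forall t, continuous Q t) -> (forall t, Rabs (Q t) <= C) ->
  Rbar_lt a 0 -> Rbar_lt 0 b ->
  (forall t : R, Rbar_lt a t -> Rbar_lt t b -> Q t = cc * stretch (U t)) ->
  weak_solution m s a b u0 v0 (fun t x => sine_series (U t) x).
Proof.
  intros Hs HK Hu0 Hv0 HX HY HU0 HV0 BU BV DU DV HQc HQb Ha Hb HQ.
  pose proof (in_h_weaken2 s) as Hw.
  pose proof (dominated_nonneg _ _ _ BU) as HX0.
  pose proof (dominated_nonneg _ _ _ BV) as HY0.
  assert (HUt : forall t, in_h (s + 2) (U t)).
  { intros t. apply in_h_dom with X (exp (K * Rabs t)); auto. intros n.
    rewrite (Rabs_pos_eq (X n)); auto. }
  assert (HUl : forall t, ex_series (fun n => Rabs (U t n))).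
  { intros t. apply (in_h_l1 s); auto. }
  assert (HUn : forall t, ex_series (fun n => nn n * Rabs (U t n))).
  { intros t. now apply (Hstar_l1 s). }
  assert (HC : forall t, coef (fun x => sine_series (U t) x) = U t).
  { intros t. apply functional_extensionality. intros n. now apply coef_unique. }
  assert (HH : forall t, in_Hstar (s + 2) (fun x => sine_series (U t) x)).
  { intros t. split; rewrite HC; [apply HUt|]. intros x _. apply Series_correct.
    apply (ex_series_fun (U t) (fun n => phi (S n)) x); auto. intros; apply phi_le1. }
  assert (HCf : (fun t => coef ((fun t x => sine_series (U t) x) t)) = U).
  { apply functional_extensionality. intros t. apply HC. }
  split; [exact Ha|]. split; [exact Hb|]. split; [auto|]. split; [|split].
  - intros x Hx. rewrite (Hstar_sine_series _ _ x Hu0 Hx). apply Series_ext.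
    intros n. now rewrite HU0.
  - intros x Hx. rewrite (Hstar_sine_series _ _ x Hv0 Hx).
    assert (E : sine_series (coef v0) x = Series (fun n => V 0 n * phi (S n) x)).
    { apply Series_ext. intros n. now rewrite HV0. }
    rewrite E.
    apply (is_derive_Series (fun n t => U t n * phi (S n) x) (fun n t => V t n * phi (S n) x)
      (fun n => exp (K * (Rabs 0 + 1)) * Y n) 0 1); [lra| | | |].
    + apply (ex_series_Rscal (exp (K * (Rabs 0 + 1)))).
      apply ex_series_dom with (fun n => Rabs (Y n)); [intros; lra|]. now apply (in_h_l1 s).
    + intros t _. apply (ex_series_fun (U t) (fun n => phi (S n)) x); auto.
      intros; apply phi_le1.
    + intros n t _. apply (is_derive_ext (fun t => phi (S n) x * U t n)).
      * intros y. apply Rmult_comm.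
      * rewrite Rmult_comm. apply is_derive_scal. apply DU.
    + intros n t Ht. rewrite Rabs_mult. pose proof (phi_le1 (S n) x).
      pose proof (Rabs_pos (phi (S n) x)). pose proof (Rabs_pos (V t n)).
      apply Rle_trans with (Rabs (V t n) * 1); [apply Rmult_le_compat_l; auto|].
      rewrite Rmult_1_r. eapply Rle_trans; [apply BV|]. apply Rmult_le_compat_r; auto.
      now apply exp_near.
  - exists V, (fun t n => - (nn n * hh m n + Q t * nn n) * U t n).
    assert (HC0 : 0 <= C) by (eapply Rle_trans; [apply Rabs_pos|apply (HQb 0)]).
    set (Z := fun n => (1 + Rabs m + C) * (nn n * (nn n * X n))).
    assert (HZ : in_h (s - 2) Z).
    { apply in_h_scal. apply (in_h_nn (s - 2)). replace (s - 2 + 2) with s by ring.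
      now apply in_h_nn. }
    assert (BZ : forall t n, Rabs (- (nn n * hh m n + Q t * nn n) * U t n)
      <= exp (K * Rabs t) * Z n).
    { intros t n. pose proof (nn_ge1 n) as Hn. unfold Z.
      rewrite Rabs_mult, Rabs_Ropp.
      replace (exp (K * Rabs t) * ((1 + Rabs m + C) * (nn n * (nn n * X n))))
        with ((nn n * nn n * (1 + Rabs m + C)) * (exp (K * Rabs t) * X n)) by ring.
      apply Rmult_le_compat; auto using Rabs_pos.
      unfold hh. eapply Rle_trans; [apply Rabs_triang|].
      rewrite !Rabs_mult, (Rabs_pos_eq (nn n)) by lra.
      assert (Rabs (nn n + m) <= nn n + Rabs m).
      { eapply Rle_trans; [apply Rabs_triang|]. rewrite (Rabs_pos_eq (nn n)); lra. }
      specialize (HQb t). pose proof (Rabs_pos m). pose proof (Rabs_pos (Q t)).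
      assert (nn n * Rabs (nn n + m) <= nn n * (nn n + Rabs m)) by (apply Rmult_le_compat_l; lra).
      assert (Rabs m * nn n <= Rabs m * (nn n * nn n)) by (apply Rmult_le_compat_l; nra).
      assert (Rabs (Q t) * nn n <= C * (nn n * nn n)) by (apply Rmult_le_compat; nra).
      nra. }
    split; [|split; [|split; [|split; [|split]]]].
    + rewrite HCf. apply C0_h_of_modes with K X; auto.
      intros n t. exact (continuous_derive _ _ _ (DU n t)).
    + apply C0_h_of_modes with K Y; auto.
      intros n t. exact (continuous_derive _ _ _ (DV n t)).
    + apply C0_h_of_modes with K Z; auto. intros n t.
      apply continuous_Rmult; [|exact (continuous_derive _ _ _ (DU n t))].
      apply (continuous_opp (V := R_NormedModule) (fun t => nn n * hh m n + Q t * nn n)).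
      apply continuous_plus_const.
      apply continuous_Rmult; [apply HQc|apply continuous_const].
    + rewrite HCf. apply derive_h_of_modes with K Y; auto.
    + apply derive_h_of_modes with K Z; auto.
    + intros eta He t H1 H2.
      pose proof (RInt_Derive_sqr (fun x => sine_series (U t) x) (U t) (HUn t)
        (fun x _ => eq_refl)) as HP.
      rewrite <- (is_series_unique _ _ HP). fold (stretch (U t)).
      assert (Hg : ex_series (fun n => Rabs (- (nn n * hh m n + Q t * nn n) * U t n / nn n))).
      { apply (in_h_quotient_l1 s); auto.
        apply in_h_dom with Z (exp (K * Rabs t)); auto. intros n.
        rewrite (Rabs_pos_eq (Z n)); [apply BZ|].
        pose proof (nn_ge1 n). pose proof (Rabs_pos m). specialize (HX0 n). unfold Z.
        apply Rmult_le_pos; [lra|]. apply Rmult_le_pos; [lra|]. apply Rmult_le_pos; lra. }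
      rewrite (weak_form (fun x => sine_series (U t) x) (U t) _ _ eta (HUn t) Hg
        (fun x _ => eq_refl) He).
      apply Series_zero. intros n. rewrite (HQ t H1 H2). unfold hh, cc. ring.
Qed.

(** * The mode system in rotating coordinates *)

Definition freq (m : R) (j : nat) : R := INR (S j) * sqrt (hh m j).

(** In a mode, the rotating coordinates [x (j, true)], [x (j, false)] are constant
    under the linear flow.  [rot_p] and [rot_q] recover the displacement times the
    wavenumber and the velocity divided by [sqrt (hh m j)]. *)
Definition rot_p (m : R) (t : R) (x : nat * bool -> R) (j : nat) : R :=
  cos (freq m j * t) * x (j, true) + sin (freq m j * t) * x (j, false).

Definition rot_q (m : R) (t : R) (x : nat * bool -> R) (j : nat) : R :=
  - sin (freq m j * t) * x (j, true) + cos (freq m j * t) * x (j, false).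

(** The clamp bounds the strength of the nonlinearity, which therefore grows at most
    linearly. *)
Definition clamped (B : R) (p : nat -> R) : R := Rmin (Series (fun j => p j ^ 2)) B.

(** The nonlinear term of the equation for [rot_q], up to sign. *)
Definition mode_force (m B t : R) (x : nat * bool -> R) (j : nat) : R :=
  cc * clamped B (rot_p m t x) * (INR (S j) / sqrt (hh m j)) * rot_p m t x j.

Definition rotating_field (m B t : R) (x : nat * bool -> R) (i : nat * bool) : R :=
  let (j, c) := i in
  if c then sin (freq m j * t) * mode_force m B t x j else - cos (freq m j * t) * mode_force m B t x j.

Lemma rot_bound (m t r : R) (M : nat -> R) (x : nat * bool -> R) :
  (forall i, Rabs (x i) <= M (fst i) * r) ->
  (forall j, Rabs (rot_p m t x j) <= 2 * M j * r) /\
  (forall j, Rabs (rot_q m t x j) <= 2 * M j * r).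
Proof.
  intros H.
  assert (G : forall c y X, Rabs c <= 1 -> Rabs y <= X -> Rabs (c * y) <= X).
  { intros c y X Hc Hy. rewrite Rabs_mult. pose proof (Rabs_pos c). pose proof (Rabs_pos y). nra. }
  assert (Hs : forall z, Rabs (sin z) <= 1) by (intros; apply Rabs_le, SIN_bound).
  assert (Hc : forall z, Rabs (cos z) <= 1) by (intros; apply Rabs_le, COS_bound).
  split; intros j; pose proof (H (j, true)) as H1; pose proof (H (j, false)) as H2;
    simpl in H1, H2; unfold rot_p, rot_q; (eapply Rle_trans; [apply Rabs_triang|]).
  - pose proof (G _ _ _ (Hc (freq m j * t)) H1). pose proof (G _ _ _ (Hs (freq m j * t)) H2). lra.
  - assert (Hs' : Rabs (- sin (freq m j * t)) <= 1) by (rewrite Rabs_Ropp; apply Hs).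
    pose proof (G _ _ _ Hs' H1). pose proof (G _ _ _ (Hc (freq m j * t)) H2). lra.
Qed.

Lemma rot_p_minus (m t : R) (x y : nat * bool -> R) (j : nat) :
  rot_p m t x j - rot_p m t y j = rot_p m t (fun i => x i - y i) j.
Proof. unfold rot_p. ring. Qed.

Lemma speed_bound (m : R) (j : nat) : m >= - (1 / 2) ->
  0 < sqrt (hh m j) /\ 0 < INR (S j) / sqrt (hh m j) <= 2.
Proof.
  intros Hm. pose proof (hh_pos m j Hm) as Hh. pose proof (INR_S_ge1 j) as Hk.
  assert (Hw : 0 < sqrt (hh m j)) by now apply sqrt_lt_R0.
  split; auto. split; [apply Rdiv_lt_0_compat; lra|].
  pose proof (nn_le_hh m j Hm) as Hn. unfold nn in Hn.
  rewrite <- (sqrt_sqrt (hh m j)) in Hn by lra. set (w := sqrt (hh m j)) in *.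
  apply Rmult_le_reg_r with w; auto. unfold Rdiv. rewrite Rmult_assoc, Rinv_l by lra. nra.
Qed.

Lemma Rmin_lipschitz (x y B : R) : Rabs (Rmin x B - Rmin y B) <= Rabs (x - y).
Proof.
  unfold Rmin. destruct (Rle_dec x B), (Rle_dec y B); unfold Rabs;
    repeat destruct Rcase_abs; lra.
Qed.

Lemma square_summable (M : nat -> R) (p : nat -> R) (r : R) :
  (forall j, Rabs (p j) <= 2 * M j * r) -> ex_series (fun j => M j ^ 2) ->
  ex_series (fun j => p j ^ 2).
Proof.
  intros Hp HM. apply ex_series_pos_dom with (fun j => (4 * r ^ 2) * M j ^ 2).
  - intros j. split; [apply pow2_ge_0|].
    rewrite <- (pow2_abs (p j)). replace ((4 * r ^ 2) * M j ^ 2) with ((2 * M j * r) ^ 2) by ring.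
    apply pow_incr. split; [apply Rabs_pos|apply Hp].
  - now apply (ex_series_Rscal (4 * r ^ 2)).
Qed.

Lemma clamped_bound (M : nat -> R) (p : nat -> R) (r B : R) : 0 <= B ->
  (forall j, Rabs (p j) <= 2 * M j * r) -> ex_series (fun j => M j ^ 2) ->
  0 <= clamped B p <= B.
Proof.
  intros HB Hp HM. split; [|apply Rmin_r]. apply Rmin_glb; auto.
  apply Series_ge0; [intros; apply pow2_ge_0|]. now apply square_summable with M r.
Qed.

Lemma rotating_field_le (m B t : R) (x : nat * bool -> R) (i : nat * bool) :
  Rabs (rotating_field m B t x i) <= Rabs (mode_force m B t x (fst i)).
Proof.
  destruct i as [j []]; simpl; rewrite Rabs_mult, ?Rabs_Ropp.
  - assert (Rabs (sin (freq m j * t)) <= 1) by (apply Rabs_le, SIN_bound).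
    pose proof (Rabs_pos (sin (freq m j * t))). pose proof (Rabs_pos (mode_force m B t x j)). nra.
  - assert (Rabs (cos (freq m j * t)) <= 1) by (apply Rabs_le, COS_bound).
    pose proof (Rabs_pos (cos (freq m j * t))). pose proof (Rabs_pos (mode_force m B t x j)). nra.
Qed.

Lemma rotating_field_minus_le (m B t : R) (x y : nat * bool -> R) (i : nat * bool) :
  Rabs (rotating_field m B t x i - rotating_field m B t y i)
  <= Rabs (mode_force m B t x (fst i) - mode_force m B t y (fst i)).
Proof.
  destruct i as [j []]; simpl; rewrite <- Rmult_minus_distr_l, Rabs_mult, ?Rabs_Ropp;
    set (d := Rabs (mode_force m B t x j - mode_force m B t y j)); assert (0 <= d) by apply Rabs_pos.
  - assert (Rabs (sin (freq m j * t)) <= 1) by (apply Rabs_le, SIN_bound).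
    pose proof (Rabs_pos (sin (freq m j * t))). nra.
  - assert (Rabs (cos (freq m j * t)) <= 1) by (apply Rabs_le, COS_bound).
    pose proof (Rabs_pos (cos (freq m j * t))). nra.
Qed.

Lemma weight_cc_speed (m : R) (j : nat) : m >= - (1 / 2) ->
  0 <= cc * (INR (S j) / sqrt (hh m j)) <= 1 / 3.
Proof.
  intros Hm. pose proof cc_bound. pose proof (speed_bound m j Hm) as [_ H2]. split; nra.
Qed.

Lemma rotating_field_growth (m B : R) (M : nat -> R) (t r : R) (x : nat * bool -> R) :
  m >= - (1 / 2) -> 0 <= B -> ex_series (fun j => M j ^ 2) ->
  (forall i, Rabs (x i) <= M (fst i) * r) ->
  forall i, Rabs (rotating_field m B t x i) <= M (fst i) * r * B.
Proof.
  intros Hm HB HM Hx i. eapply Rle_trans; [apply rotating_field_le|]. set (j := fst i).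
  destruct (rot_bound m t r M x Hx) as [Hp _].
  pose proof (clamped_bound M _ r B HB Hp HM) as Hc. specialize (Hp j).
  pose proof (weight_cc_speed m j Hm) as Hk. unfold mode_force.
  set (k := INR (S j) / sqrt (hh m j)) in *. set (C := clamped B (rot_p m t x)) in *.
  replace (cc * C * k * rot_p m t x j) with ((cc * k) * C * rot_p m t x j) by ring.
  rewrite !Rabs_mult, <- Rabs_mult, (Rabs_pos_eq (cc * k)), (Rabs_pos_eq C) by lra.
  set (y := Rabs (rot_p m t x j)) in *. assert (0 <= y) by apply Rabs_pos.
  apply Rle_trans with (1 / 3 * B * (2 * M j * r)).
  - apply Rmult_le_compat; auto; [nra|]. apply Rmult_le_compat; lra.
  - assert (0 <= M j * r) by nra. nra.
Qed.

(** Only the clamped factor couples the modes; it is Lipschitz on bounded sets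
    because the squares of the weights [M] are summable. *)
Lemma rotating_field_lipschitz (m B : R) (M : nat -> R) (r : R) :
  m >= - (1 / 2) -> 0 <= B -> (forall j, 0 <= M j) -> ex_series (fun j => M j ^ 2) -> 0 <= r ->
  exists L, 0 <= L /\ forall t (x y : nat * bool -> R) d, 0 <= d ->
    (forall i, Rabs (x i) <= M (fst i) * r) -> (forall i, Rabs (y i) <= M (fst i) * r) ->
    (forall i, Rabs (x i - y i) <= M (fst i) * d) ->
    forall i, Rabs (rotating_field m B t x i - rotating_field m B t y i) <= M (fst i) * d * L.
Proof.
  intros Hm HB HM0 HM Hr.
  set (W := Series (fun j => M j ^ 2)).
  assert (HW : 0 <= W) by (apply Series_ge0; auto; intros; apply pow2_ge_0).
  (* The first part comes from the mode itself, the second from the clamped factor. *)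
  exists (2 * B + 16 * r ^ 2 * W). split.
  { pose proof (pow2_ge_0 r). assert (0 <= r ^ 2 * W) by nra. nra. }
  intros t x y d Hd Hx Hy Hxy i. eapply Rle_trans; [apply rotating_field_minus_le|]. set (j := fst i).
  destruct (rot_bound m t r M x Hx) as [Hpx _]. destruct (rot_bound m t r M y Hy) as [Hpy _].
  destruct (rot_bound m t d M _ Hxy) as [Hpd _].
  assert (Hpd' : forall j, Rabs (rot_p m t x j - rot_p m t y j) <= 2 * M j * d).
  { intros k. rewrite rot_p_minus. apply Hpd. }
  pose proof (clamped_bound M _ r B HB Hpx HM) as Hcx.
  assert (HP : Rabs (clamped B (rot_p m t x) - clamped B (rot_p m t y)) <= 8 * r * d * W).
  { eapply Rle_trans; [apply Rmin_lipschitz|].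
    rewrite <- Series_minus by (apply square_summable with M r; auto).
    unfold W. rewrite <- Series_scal_l.
    apply Series_abs_le; [|now apply (ex_series_Rscal (8 * r * d))].
    intros k. replace (rot_p m t x k ^ 2 - rot_p m t y k ^ 2)
      with ((rot_p m t x k - rot_p m t y k) * (rot_p m t x k + rot_p m t y k)) by ring.
    rewrite Rabs_mult. specialize (HM0 k).
    replace (8 * r * d * M k ^ 2) with ((2 * M k * d) * (4 * M k * r)) by ring.
    apply Rmult_le_compat; auto using Rabs_pos.
    eapply Rle_trans; [apply Rabs_triang|]. specialize (Hpx k). specialize (Hpy k). lra. }
  pose proof (weight_cc_speed m j Hm) as Hk. unfold mode_force.
  set (k := INR (S j) / sqrt (hh m j)) in *.
  set (Cx := clamped B (rot_p m t x)) in *. set (Cy := clamped B (rot_p m t y)) in *.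
  replace (cc * Cx * k * rot_p m t x j - cc * Cy * k * rot_p m t y j)
    with ((cc * k) * (Cx * (rot_p m t x j - rot_p m t y j) + (Cx - Cy) * rot_p m t y j)) by ring.
  rewrite Rabs_mult, (Rabs_pos_eq (cc * k)) by lra.
  specialize (HM0 j).
  assert (Hb : Rabs (Cx * (rot_p m t x j - rot_p m t y j) + (Cx - Cy) * rot_p m t y j)
    <= B * (2 * M j * d) + 8 * r * d * W * (2 * M j * r)).
  { eapply Rle_trans; [apply Rabs_triang|]. rewrite !Rabs_mult, (Rabs_pos_eq Cx) by lra.
    apply Rplus_le_compat; apply Rmult_le_compat; auto using Rabs_pos; lra. }
  set (z := Rabs (_ + _)) in *. assert (Hz : 0 <= z) by apply Rabs_pos.
  assert (Hkz : cc * k * z <= 1 * z) by (apply Rmult_le_compat_r; lra).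
  apply Rle_trans with z; [lra|]. eapply Rle_trans; [exact Hb|]. right. ring.
Qed.

Lemma rot_p_continuous (m : R) (y : R -> nat * bool -> R) (j : nat) (t : R) :
  (forall i t, continuous (fun t => y t i) t) -> continuous (fun t => rot_p m t (y t) j) t.
Proof.
  intros Hy. unfold rot_p.
  apply (continuous_Rplus (fun t => cos (freq m j * t) * y t (j, true)));
    (apply continuous_Rmult; [|apply Hy]).
  - eapply (continuous_derive (fun t => cos (freq m j * t))). auto_derive; auto.
  - eapply (continuous_derive (fun t => sin (freq m j * t))). auto_derive; auto.
Qed.

Lemma clamped_continuous (m B K : R) (M : nat -> R) (y : R -> nat * bool -> R) (t : R) :
  0 <= K -> (forall j, 0 <= M j) -> ex_series (fun j => M j ^ 2) ->
  (forall i t, continuous (fun t => y t i) t) ->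
  (forall t i, Rabs (y t i) <= M (fst i) * exp (K * Rabs t)) ->
  continuous (fun t => clamped B (rot_p m t (y t))) t.
Proof.
  intros HK HM0 HM Hc Hb.
  set (E := exp (K * (Rabs t + 1))).
  assert (HS : continuous (fun t => Series (fun j => rot_p m t (y t) j ^ 2)) t).
  { apply (tannery (locally t) (fun j t => rot_p m t (y t) j ^ 2)
      (fun j => rot_p m t (y t) j ^ 2) (fun j => (4 * E ^ 2) * M j ^ 2)).
    - now apply (ex_series_Rscal (4 * E ^ 2)).
    - exists (mkposreal 1 Rlt_0_1). intros x Hx j. change (Rabs (x - t) < 1) in Hx.
      destruct (rot_bound m x (exp (K * Rabs x)) M (y x) (Hb x)) as [Hp _]. specialize (Hp j).
      rewrite Rabs_pos_eq by apply pow2_ge_0. rewrite <- (pow2_abs (rot_p m x (y x) j)).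
      replace (4 * E ^ 2 * M j ^ 2) with ((2 * M j * E) ^ 2) by ring.
      apply pow_incr. split; [apply Rabs_pos|]. eapply Rle_trans; [exact Hp|].
      apply Rmult_le_compat_l; [specialize (HM0 j); lra|]. now apply exp_near.
    - intros j. simpl. apply (continuous_Rmult (fun t => rot_p m t (y t) j)
        (fun t => rot_p m t (y t) j * 1)); [now apply rot_p_continuous|].
      apply continuous_Rmult; [now apply rot_p_continuous|apply continuous_const]. }
  refine (filterlim_R_intro _ _ _ _). intros e He.
  generalize (filterlim_R_elim HS e He). apply filter_imp.
  intros x Hx. eapply Rle_lt_trans; [apply Rmin_lipschitz|exact Hx].
Qed.

Lemma rotating_field_continuous (m B K : R) (M : nat -> R) (y : R -> nat * bool -> R) (i : nat * bool) (t : R) :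
  0 <= K -> (forall j, 0 <= M j) -> ex_series (fun j => M j ^ 2) ->
  (forall i t, continuous (fun t => y t i) t) ->
  (forall t i, Rabs (y t i) <= M (fst i) * exp (K * Rabs t)) ->
  continuous (fun t => rotating_field m B t (y t) i) t.
Proof.
  intros HK HM0 HM Hc Hb.
  assert (HF : forall j, continuous (fun t => mode_force m B t (y t) j) t).
  { intros j. unfold mode_force. apply continuous_Rmult; [|now apply rot_p_continuous].
    apply continuous_Rmult; [|apply continuous_const].
    apply continuous_Rmult; [apply continuous_const|].
    now apply clamped_continuous with K M. }
  destruct i as [j []]; simpl; (apply continuous_Rmult; [|apply HF]).
  - eapply (continuous_derive (fun t => sin (freq m j * t))). auto_derive; auto.
  - eapply (continuous_derive (fun t => - cos (freq m j * t))). auto_derive; auto.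
Qed.

(** The weights [M] are the sizes of the initial values of the modes, so their
    summability properties, which are those of the data, pass to the solution at
    every time. *)
Lemma clamped_modes (m s B : R) (A0 B0 : nat -> R) :
  m >= - (1 / 2) -> s > 1 / 2 -> 0 <= B -> in_h (s + 2) A0 -> in_h s B0 ->
  exists (U V : R -> nat -> R) (X Y : nat -> R),
    in_h (s + 2) X /\ in_h s Y /\
    (forall n, U 0 n = A0 n) /\ (forall n, V 0 n = B0 n) /\
    (forall t n, Rabs (U t n) <= exp (B * Rabs t) * X n) /\
    (forall t n, Rabs (V t n) <= exp (B * Rabs t) * Y n) /\
    (forall n t, is_derive (fun t => U t n) t (V t n)) /\
    (forall n t, is_derive (fun t => V t n) t
       (- (nn n * hh m n + cc * Rmin (stretch (U t)) B * nn n) * U t n)) /\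
    (forall t, continuous (fun t => Rmin (stretch (U t)) B) t) /\
    (forall t, 0 <= Rmin (stretch (U t)) B <= B).
Proof.
  intros Hm Hs HB HA0 HB0.
  set (w := fun j => sqrt (hh m j)). set (k := fun j => INR (S j)).
  assert (Hk : forall j, 1 <= k j) by (intros; apply INR_S_ge1).
  assert (Hw : forall j, 0 < w j /\ k j <= 2 * w j).
  { intros j. destruct (speed_bound m j Hm) as [H1 [_ H2]]. split; [exact H1|].
    unfold w, k. apply Rmult_le_compat_r with (r := sqrt (hh m j)) in H2; [|lra].
    unfold Rdiv in H2. rewrite Rmult_assoc, Rinv_l in H2; lra. }
  assert (Hww : forall j, w j * w j = hh m j).
  { intros j. apply sqrt_sqrt. left. now apply hh_pos. }
  assert (Hkk : forall j, k j * k j = nn j) by (intros; unfold k, nn; ring).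
  assert (Hwk : forall j, w j <= (1 + Rabs m) * k j).
  { intros j. destruct (Hw j) as [H1 _]. specialize (Hk j). specialize (Hkk j). specialize (Hww j).
    apply Rnot_lt_le. intros Hlt.
    assert (((1 + Rabs m) * k j) * ((1 + Rabs m) * k j) < w j * w j).
    { apply Rmult_le_0_lt_compat; auto; pose proof (Rabs_pos m); nra. }
    unfold hh in Hww. pose proof (Rle_abs m). pose proof (Rabs_pos m). pose proof (nn_ge1 j). nra. }
  set (M := fun j => k j * Rabs (A0 j) + Rabs (B0 j) / w j).
  assert (HM0 : forall j, 0 <= M j).
  { intros j. destruct (Hw j). specialize (Hk j). apply Rplus_le_le_0_compat.
    - apply Rmult_le_pos; [lra|apply Rabs_pos].
    - apply Rdiv_le_0_compat; auto using Rabs_pos. }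
  set (X := fun j => 2 * (M j / k j)). set (Y := fun j => 2 * (w j * M j)).
  assert (HX : in_h (s + 2) X).
  { apply in_h_scal.
    apply in_h_ext with (fun j => Rabs (A0 j) + Rabs (B0 j) / (w j * k j)).
    { intros j. unfold M. destruct (Hw j). specialize (Hk j).
      as_R. field. lra. }
    apply in_h_plus.
    - apply in_h_dom with A0 1; auto. intros n. rewrite Rabs_Rabsolu. lra.
    - apply in_h_nn. apply in_h_dom with B0 2; auto. intros n. destruct (Hw n) as [H1 H2].
      specialize (Hk n). rewrite <- Hkk.
      replace (k n * k n * (Rabs (B0 n) / (w n * k n))) with (k n / w n * Rabs (B0 n)) by (field; lra).
      rewrite Rabs_mult, Rabs_Rabsolu. apply Rmult_le_compat_r; [apply Rabs_pos|].
      rewrite Rabs_pos_eq by (apply Rdiv_le_0_compat; lra).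
      apply Rmult_le_reg_r with (w n); auto. unfold Rdiv. rewrite Rmult_assoc, Rinv_l; lra. }
  assert (HY : in_h s Y).
  { apply in_h_scal.
    apply in_h_ext with (fun j => w j * k j * Rabs (A0 j) + Rabs (B0 j)).
    { intros j. unfold M. destruct (Hw j).
      as_R. field. lra. }
    apply in_h_plus.
    - apply in_h_dom with (fun n => nn n * A0 n) (1 + Rabs m); [|now apply in_h_nn].
      intros n. destruct (Hw n) as [H1 _]. specialize (Hk n). specialize (Hwk n).
      pose proof (nn_ge1 n). rewrite !Rabs_mult, Rabs_Rabsolu, (Rabs_pos_eq (nn n)), (Rabs_pos_eq (w n)),
        (Rabs_pos_eq (k n)) by lra.
      rewrite <- Rmult_assoc. apply Rmult_le_compat_r; [apply Rabs_pos|]. rewrite <- Hkk. nra.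
    - apply in_h_dom with B0 1; auto. intros n. rewrite Rabs_Rabsolu. lra. }
  assert (HM : ex_series (fun j => M j ^ 2)).
  { apply ex_series_pos_dom with (h_term (s + 2) X); auto. intros n.
    split; [apply pow2_ge_0|]. apply Rle_trans with (2 := nn2_le_h_term s X n ltac:(lra)).
    unfold X. specialize (Hk n). pose proof (nn_ge1 n).
    replace (nn n * (2 * (M n / k n)) ^ 2) with (4 * M n ^ 2) by (rewrite <- Hkk; field; lra).
    pose proof (pow2_ge_0 (M n)). nra. }
  set (x0 := fun i : nat * bool => let (j, c) := i in if c then k j * A0 j else B0 j / w j).
  assert (Hx0 : forall i, Rabs (x0 i) <= M (fst i)).
  { intros [j []]; simpl; unfold M; destruct (Hw j); specialize (Hk j).
    - rewrite Rabs_mult, (Rabs_pos_eq (k j)) by lra.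
      assert (0 <= Rabs (B0 j) / w j) by (apply Rdiv_le_0_compat; auto using Rabs_pos). lra.
    - unfold Rdiv. rewrite Rabs_mult, (Rabs_pos_eq (/ w j)) by (left; now apply Rinv_0_lt_compat).
      assert (0 <= k j * Rabs (A0 j)) by (apply Rmult_le_pos; [lra|apply Rabs_pos]). lra. }
  destruct (picard_lindelof (rotating_field m B) (fun i => M (fst i)) x0 B HB Hx0) as [y [Hy0 [Hyb Hyd]]].
  { intros t x r Hr Hx. now apply rotating_field_growth. }
  { intros r Hr. now apply rotating_field_lipschitz. }
  { intros y Hc Hb i t. now apply rotating_field_continuous with B M. }
  assert (Hyc : forall i t, continuous (fun t => y t i) t)
    by (intros i t; exact (continuous_derive _ _ _ (Hyd t i))).
  set (P := fun t j => rot_p m t (y t) j). set (Q := fun t j => rot_q m t (y t) j).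
  assert (HPQ : forall t j, Rabs (P t j) <= 2 * M j * exp (B * Rabs t) /\
    Rabs (Q t j) <= 2 * M j * exp (B * Rabs t)).
  { intros t j. destruct (rot_bound m t (exp (B * Rabs t)) M (y t) (Hyb t)) as [H1 H2].
    split; [apply H1|apply H2]. }
  assert (DP : forall t j, is_derive (fun t => P t j) t (k j * w j * Q t j)).
  { intros t j. pose proof (Hyd t (j, true)) as D1. pose proof (Hyd t (j, false)) as D2.
    unfold P, Q, rot_p, rot_q. evar_last.
    - apply (is_derive_Rplus (fun t => cos (freq m j * t) * y t (j, true)));
        apply (is_derive_Rmult (fun t => _ (freq m j * t))).
      + auto_derive; auto.
      + exact D1.
      + auto_derive; auto.
      + exact D2.
    - unfold plus, mult; simpl. unfold mult; simpl. unfold freq, k, w. ring. }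
  assert (DQ : forall t j, is_derive (fun t => Q t j) t
    (- (k j * w j) * P t j - mode_force m B t (y t) j)).
  { intros t j. pose proof (Hyd t (j, true)) as D1. pose proof (Hyd t (j, false)) as D2.
    unfold P, Q, rot_p, rot_q. evar_last.
    - apply (is_derive_Rplus (fun t => - sin (freq m j * t) * y t (j, true))).
      + apply (is_derive_Rmult (fun t => - sin (freq m j * t))).
        * auto_derive; auto.
        * exact D1.
      + apply (is_derive_Rmult (fun t => cos (freq m j * t))).
        * auto_derive; auto.
        * exact D2.
    - unfold plus, mult; simpl. unfold mult; simpl.
      pose proof (sin2_cos2 (freq m j * t)) as E. unfold Rsqr in E.
      set (F := mode_force m B t (y t) j). set (sn := sin (freq m j * t)) in *.
      set (cs := cos (freq m j * t)) in *.
      transitivity (- (k j * w j) * (cs * y t (j, true) + sn * y t (j, false))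
        - (sn * sn + cs * cs) * F); [unfold freq, k, w; ring|]. rewrite E. ring. }
  assert (EP : forall t, stretch (fun j => P t j / k j) = Series (fun j => P t j ^ 2)).
  { intros t. apply Series_ext. intros j. specialize (Hk j). rewrite <- Hkk. field. lra. }
  (* P and Q stand for the wavenumber times the displacement and for the velocity
     divided by w. *)
  exists (fun t j => P t j / k j), (fun t j => w j * Q t j), X, Y.
  split; [exact HX|]. split; [exact HY|].
  split; [|split; [|split; [|split; [|split; [|split; [|split]]]]]].
  - intros n. specialize (Hk n). destruct (Hw n). unfold P, rot_p. rewrite Rmult_0_r, cos_0, sin_0, !Hy0.
    change (x0 (n, true)) with (k n * A0 n). change (x0 (n, false)) with (B0 n / w n).
    field. lra.
  - intros n. destruct (Hw n). unfold Q, rot_q. rewrite Rmult_0_r, cos_0, sin_0, !Hy0.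
    change (x0 (n, true)) with (k n * A0 n). change (x0 (n, false)) with (B0 n / w n).
    field. lra.
  - intros t n. destruct (HPQ t n) as [H1 _]. specialize (Hk n). unfold X, Rdiv.
    rewrite Rabs_mult, (Rabs_pos_eq (/ k n)) by (left; apply Rinv_0_lt_compat; lra).
    replace (exp (B * Rabs t) * (2 * (M n * / k n))) with (2 * M n * exp (B * Rabs t) * / k n) by ring.
    apply Rmult_le_compat_r; auto. left; apply Rinv_0_lt_compat; lra.
  - intros t n. destruct (HPQ t n) as [_ H1]. destruct (Hw n). unfold Y.
    rewrite Rabs_mult, (Rabs_pos_eq (w n)) by lra.
    replace (exp (B * Rabs t) * (2 * (w n * M n))) with (w n * (2 * M n * exp (B * Rabs t))) by ring.
    apply Rmult_le_compat_l; auto. lra.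
  - intros n t. specialize (Hk n).
    apply (is_derive_ext (fun t => / k n * P t n)).
    + intros x. unfold Rdiv. apply Rmult_comm.
    + replace (w n * Q t n) with (/ k n * (k n * w n * Q t n)) by (field; lra).
      apply is_derive_scal. apply DP.
  - intros n t. specialize (Hk n). destruct (Hw n) as [H1 _]. evar_last.
    + apply is_derive_scal. apply DQ.
    + rewrite EP. unfold mode_force, clamped. fold (w n) (k n).
      change (rot_p m t (y t)) with (P t). change (fun j => P t j ^ 2) with (fun j => P t j ^ 2).
      rewrite <- Hkk, <- Hww. field. lra.
  - intros t. apply (continuous_ext (fun t => clamped B (rot_p m t (y t)))).
    + intros x. unfold clamped. f_equal. symmetry. apply EP.
    + apply clamped_continuous with B M; auto.
  - intros t. rewrite EP.
    apply (clamped_bound M (P t) (exp (B * Rabs t)) B HB); auto. intros j. apply HPQ.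
Qed.

(** By [stretch_bound] the clamp at [B = 3 * (64/10000 mu)] is inactive as long as
    [|t| epsilon^4 <= mu / 100], the amplitude [e] used there being such that
    [3 e^2 <= B].  The interval of existence has to be open, hence larger than the
    closed window of the theorem. *)
Lemma weak_solution_exists (m s : R) (u0 v0 : R -> R) :
  m >= - (1 / 2) -> s > 1 / 2 -> in_Hstar (s + 2) u0 -> in_Hstar s v0 ->
  epsilon m u0 v0 <= 8 / 100 * sqrt (mu m) ->
  exists (a b : Rbar) (u : R -> R -> R),
    weak_solution m s a b u0 v0 u /\
    forall t : R, Rabs t * epsilon m u0 v0 ^ 4 < 1 / 100 * mu m -> Rbar_lt a t /\ Rbar_lt t b.
Proof.
  intros Hm Hs Hu0 Hv0 Heps.
  pose proof (mu_bounds m Hm) as [Hmu _]. pose proof (epsilon_ge0 m u0 v0) as He0.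
  pose proof (epsilon_sqr m u0 v0 Hm Heps) as He2.
  set (ep := epsilon m u0 v0) in *.
  set (B := 3 * (64 / 10000 * mu m)).
  assert (HB : 0 <= B) by (unfold B; lra).
  destruct (clamped_modes m s B (coef u0) (coef v0) Hm Hs HB (proj1 Hu0) (proj1 Hv0))
    as [U [V [X [Y [HX [HY [HU0 [HV0 [BU [BV [DU [DV [Cc Bc]]]]]]]]]]]]].
  set (Q := fun t => cc * Rmin (stretch (U t)) B).
  pose proof (dominated_nonneg _ _ _ BU) as HX0.
  assert (Hin : forall t : R, Rabs t * ep ^ 4 <= 1 / 100 * mu m -> Q t = cc * stretch (U t)).
  { intros t Ht.
    destruct (bound_by_margin ep (mu m) (Rabs t) 1) as [e [He [Hee [Hes He4]]]];
      auto using Rabs_pos; [lra|].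
    assert (HS : stretch (U t) <= 3 * e ^ 2).
    { apply (stretch_bound m s e u0 v0 U V Q t
        (Series (fun n => exp (B * Rabs t) ^ 2 * h_term (s + 2) X n))); auto.
      - fold ep. lra.
      - intros x _ HSx. unfold Q. f_equal. apply Rmin_left. unfold B. lra.
      - intros x Hx.
        assert (Hb : forall n, 0 <= h_term (s + 2) (U x) n
          <= exp (B * Rabs t) ^ 2 * h_term (s + 2) X n).
        { intros n. split; [apply h_term_ge0|]. unfold h_term. rewrite <- Rmult_assoc.
          apply Rmult_le_compat_r; [left; apply Rpower_pos|].
          rewrite <- (pow2_abs (U x n)), <- Rpow_mult_distr. apply pow_incr.
          split; [apply Rabs_pos|]. eapply Rle_trans; [apply BU|].
          apply Rmult_le_compat_r; auto. apply exp_mul_Rabs_le; auto.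
          unfold Rmin, Rmax in Hx. destruct (Rle_dec 0 t); unfold Rabs;
            repeat destruct Rcase_abs; lra. }
        assert (Hex : ex_series (fun n => exp (B * Rabs t) ^ 2 * h_term (s + 2) X n))
          by now apply (ex_series_Rscal (exp (B * Rabs t) ^ 2)).
        split; [now apply ex_series_pos_dom with (2 := Hex)|].
        now apply Series_le. }
    unfold Q. f_equal. apply Rmin_left. unfold B. lra. }
  assert (Hab : exists b : Rbar, Rbar_lt 0 b /\
    (forall t : R, Rabs t * ep ^ 4 < 1 / 100 * mu m <-> Rbar_lt (Rabs t) b)).
  { destruct He0 as [He0|He0].
    - assert (H4 : 0 < ep ^ 4) by now apply pow_lt.
      exists (Finite (1 / 100 * mu m / ep ^ 4)). split.
      + simpl. apply Rdiv_lt_0_compat; lra.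
      + intros t. now apply Rlt_div_r.
    - exists p_infty. split; [exact I|]. intros t. rewrite <- He0. simpl. split; intros; auto. lra. }
  destruct Hab as [b [Hb0 Hb]].
  assert (Hba : Rbar_lt (Rbar_opp b) 0) by (destruct b; simpl in *; auto; lra).
  assert (Hbt : forall t : R, Rbar_lt (Rabs t) b <-> Rbar_lt (Rbar_opp b) t /\ Rbar_lt t b).
  { intros t. destruct b as [b| |]; simpl; [|tauto|tauto]. split; intros Ht.
    - apply Rabs_def2 in Ht. lra.
    - apply Rabs_def1; lra. }
  exists (Rbar_opp b), b, (fun t x => sine_series (U t) x). split.
  - apply (weak_solution_of_modes m s B (cc * B) (Rbar_opp b) b u0 v0 U V Q X Y); auto.
    + intros t. apply continuous_Rmult; [apply continuous_const|apply Cc].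
    + intros t. unfold Q. pose proof cc_bound. specialize (Bc t).
      rewrite Rabs_pos_eq by nra. apply Rmult_le_compat_l; lra.
    + intros t H1 H2. apply Hin. left. apply Hb, Hbt. now split.
  - intros t Ht. apply Hbt, Hb, Ht.
Qed.

(** * Existence and size of the solution on the long time window *)

Theorem theorem1 :
  forall (m s : R) (u0 v0 : R -> R),
    m >= - (1 / 2) ->
    s > 1 / 2 ->
    in_Hstar (s + 2) u0 ->
    in_Hstar s v0 ->
    epsilon m u0 v0 <= 8 / 100 * sqrt (mu m) ->
    exists T0 : R,
      T0 >= 8 / 1000 * (1 - 68 * epsilon m u0 v0 ^ 2 / mu m) /\
      8 / 1000 * (1 - 68 * epsilon m u0 v0 ^ 2 / mu m) >= 45 / 10000 /\
      (exists (a b : Rbar) (u : R -> R -> R),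
          weak_solution m s a b u0 v0 u /\
          forall t : R, in_window T0 (mu m) (epsilon m u0 v0) t ->
            Rbar_lt a t /\ Rbar_lt t b) /\
      (forall (a b : Rbar) (u : R -> R -> R),
          weak_solution m s a b u0 v0 u ->
          forall t : R, Rbar_lt a t -> Rbar_lt t b ->
            in_window T0 (mu m) (epsilon m u0 v0) t ->
            Rbar_le (sup_abs (u t)) (2 * epsilon m u0 v0)).
Proof.
  intros m s u0 v0 Hm Hs Hu0 Hv0 Heps.
  pose proof (mu_bounds m Hm) as [Hmu _].
  pose proof (epsilon_sqr m u0 v0 Hm Heps) as He2.
  assert (Hratio : 0 <= 68 * epsilon m u0 v0 ^ 2 / mu m <= 4352 / 10000).
  { split.
    - apply Rdiv_le_0_compat; auto. pose proof (pow2_ge_0 (epsilon m u0 v0)). lra.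
    - apply Rmult_le_reg_r with (mu m); auto. unfold Rdiv at 1. rewrite Rmult_assoc, Rinv_l; lra. }
  set (T0 := 8 / 1000 * (1 - 68 * epsilon m u0 v0 ^ 2 / mu m)).
  assert (HT0 : T0 * mu m < 1 / 100 * mu m) by (unfold T0; nra).
  exists T0. split; [unfold T0; lra|]. split; [unfold T0; lra|]. split.
  - destruct (weak_solution_exists m s u0 v0 Hm Hs Hu0 Hv0 Heps) as [a [b [u [Hw Hin]]]].
    exists a, b, u. split; auto. intros t Ht. apply Hin. unfold in_window in Ht. lra.
  - intros a b u Hw t Ha Hb Ht. unfold in_window in Ht.
    apply (proj2 (Lub_Rbar_correct (fun y => exists x, 0 <= x <= PI /\ y = Rabs (u t x)))).
    intros y [x [Hx ->]]. simpl.
    apply (weak_solution_bound m s a b u0 v0 u t x); auto. lra.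
Qed.
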